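(* Let $X$ be a one-dimensional, Noetherian, regular, irreducible scheme, with function field $K(X)$ and set of closed points $X_0$. For $x\in X_0$, let $K(X)_x=\operatorname{Frac}\widehat{\mathcal O_{X,x}}$ be the complete discrete valuation field associated to $x$. Then $$\mathbb A(\mathbf 0,\mathcal O_X)=K(X),\qquad \mathbb A(\mathbf 1,\mathcal O_X)=\prod_{x\in X_0}\widehat{\mathcal O_{X,x}},$$ and $$\mathbb A(\mathbf{01},\mathcal O_X)=\Big\{(f_x)\in\prod_{x\in X_0}K(X)_x:\ f_x\in\widehat{\mathcal O_{X,x}}\text{ for all but finitely many }x\Big\}$$ is the usual ring of (finite) adèles. Under these identifications the homomorphisms $\partial^{\mathbf 0}:\mathbb A(\mathbf 0,\mathcal O_X)\to\mathbb A(\mathbf{01},\mathcal O_X)$ and $\partial^{\mathbf 1}:\mathbb A(\mathbf 1,\mathcal O_X)\to\mathbb A(\mathbf{01},\mathcal O_X)$ are respectively the diagonal embedding of $K(X)$ and the natural inclusion of $\prod_{x\in X_0}\widehat{\mathcal O_{X,x}}$.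
   Context: Adèle groups. Let $X$ be a Noetherian scheme. $S_m(X)$ is the set of chains of length $m$, i.e. sequences of points $(x_0,\dots,x_m)$ with $x_i\in\overline{\{x_{i-1}\}}$ for $i=1,\dots,m$. For $T\subseteq S_m(X)$ and $x\in X$, put ${}_xT=\{\xi\in S_{m-1}(X):(x,\xi)\in T\}$. For $x\in X$ and $r\ge0$, $\tilde j_{rx}M$ denotes $(j_{rx})_*(j_{rx})^*M$, where $j_{rx}:\operatorname{Spec}\mathcal O_{X,x}/\mathfrak m_{X,x}^r\to X$ is the natural morphism (so it is the quasi-coherent sheaf constantly equal to $M_x/\mathfrak m_{X,x}^rM_x$ along $\overline{\{x\}}$ and zero elsewhere). For quasi-coherent $M$ and $T\subseteq S_m(X)$, the abelian group $\mathbb A(T,M)$ is uniquely defined (functorially and exactly in $M$) by the recursive rules: (A1) $\mathbb A(T,\cdot)$ commutes with direct limits; (A2) if $M$ is coherent and $m=0$, then $\mathbb A(T,M)=\prod_{x\in T}\widehat{M_x}$, with $\widehat{M_x}$ the $\mathfrak m_{X,x}$-adic completion of the stalk; (A3) if $M$ is coherent and $m\ge1$, then $\mathbb A(T,M)=\prod_{x\in X}\varprojlim_r\mathbb A({}_xT,\tilde j_{rx}M)$; (A4) $\mathbb A(\emptyset,M)=0$. For $X$ one-dimensional and irreducible with generic point $\eta$: $\mathbf 0=\{\eta\}\subseteq S_0(X)$, $\mathbf 1=X_0\subseteq S_0(X)$, $\mathbf{01}=\{(\eta,x):x\in X_0\}\subseteq S_1(X)$. When $X$ is also regular, $\mathfrak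 m_{X,\eta}=0$, so by (A3) $\mathbb A(\mathbf{01},\mathcal O_X)=\mathbb A(\mathbf 1,\mathcal K)$, where $\mathcal K=\tilde j_{1\eta}\mathcal O_X$ is the constant sheaf $K(X)$. The map $\partial^{\mathbf 1}$ is $\mathbb A(\mathbf 1,\mathcal O_X)\to\mathbb A(\mathbf 1,\mathcal K)$ induced by $\mathcal O_X\to\mathcal K$. The map $\partial^{\mathbf 0}$ is $K(X)=\Gamma(X,\mathcal K)\to\mathbb A(\mathbf 1,\mathcal K)=\varinjlim_N\prod_{x\in X_0}\widehat{N_x}$ (limit over coherent subsheaves $N\subseteq\mathcal K$), sending a section, viewed in $\Gamma(X,N)$ for some $N$, to its images in the $\widehat{N_x}$. *)

(* Defs.v *)
From HB Require Import structures.
From mathcomp Require Import all_boot all_algebra.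
From mathcomp Require Import boolp classical_sets functions cardinality topology.

Set Implicit Arguments.
Unset Strict Implicit.
Unset Printing Implicit Defensive.

Import GRing.Theory.

Local Open Scope classical_set_scope.
Local Open Scope ring_scope.
Local Open Scope quotient_scope.

Section Ideals.
Variable R : comPzRingType.
Implicit Types I P : set R.

Definition is_unit (a : R) : Prop := exists b : R, a * b = 1.

Definition nonunits : set R := [set a | ~ is_unit a].

Definition is_ideal I : Prop :=
  [/\ I 0, forall a b, I a -> I b -> I (a + b) & forall a b, I b -> I (a * b)].

Definition is_prime_ideal P : Prop :=
  [/\ is_ideal P, ~ P 1 & forall a b, P (a * b) -> P a \/ P b].

Definition ideal_gen n (g : 'I_n -> R) : set R :=
  [set \sum_(i < n) a i * g i | a in [set: 'I_n -> R]].

Definition noetherian_ring : Prop :=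
  forall I, is_ideal I -> exists n (g : 'I_n -> R), I = ideal_gen g.

Definition prime_chain (n : nat) : Prop :=
  exists P : nat -> set R,
    (forall i, (i <= n)%N -> is_prime_ideal (P i)) /\
    (forall i, (i < n)%N -> P i `<` P i.+1).

Definition krull_dim (n : nat) : Prop := prime_chain n /\ ~ prime_chain n.+1.

(* The zero ring is excluded: there 0 is a unit, so [nonunits] is empty. *)
Definition local_ring : Prop := is_ideal nonunits.

Definition regular_local_ring : Prop :=
  [/\ local_ring, noetherian_ring &
      exists2 d, krull_dim d & exists g : 'I_d -> R, nonunits = ideal_gen g].

Definition integral_domain : Prop :=
  (1 : R) <> 0 /\ forall a b : R, a * b = 0 -> a = 0 \/ b = 0.

(* Complete discrete valuation ring with uniformizer [t]: every nonzero element
   is a unit times a power of [t], and the [t]-adic topology is complete and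
   separated. *)
Definition complete_dvr : Prop :=
  integral_domain /\
  exists t : R,
    [/\ t <> 0, ~ is_unit t,
        forall a, a <> 0 -> exists n u, is_unit u /\ a = u * t ^+ n &
        forall s : nat -> R,
          (forall n, exists c, s n.+1 - s n = t ^+ n * c) ->
          exists! l, forall n, exists c, l - s n = t ^+ n * c].

Definition is_fraction_field (F : fieldType) (i : {rmorphism R -> F}) : Prop :=
  injective i /\ forall z : F, exists a b : R, i b != 0 /\ z = i a / i b.

Definition finitely_generated (M : lmodType R) : Prop :=
  exists n (g : 'I_n -> M), forall m, exists a : 'I_n -> R,
    m = \sum_(i < n) a i *: g i.

End Ideals.

Identity Coercion fun_of_set : set >-> Funclass.

Record submod (R : comPzRingType) (M : lmodType R) := Submod {
  submod_set :> set M;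
  submod0 : submod_set 0;
  submodD : forall u v, submod_set u -> submod_set v -> submod_set (u + v);
  submodZ : forall a u, submod_set u -> submod_set (a *: u) }.

Section QuotientModule.
Variables (R : comPzRingType) (M : lmodType R) (N : submod M).

Lemma submodN u : N u -> N (- u).
Proof. by rewrite -scaleN1r; exact: submodZ. Qed.

Lemma submodB u v : N u -> N v -> N (u - v).
Proof. by move=> hu hv; apply: submodD => //; exact: submodN. Qed.

Definition qmod_rel (u v : M) : bool := `[< N (u - v) >].

Lemma qmod_rel_refl : reflexive qmod_rel.
Proof. by move=> u; apply/asboolP; rewrite subrr; exact: submod0. Qed.

Lemma qmod_rel_sym : symmetric qmod_rel.
Proof.
by move=> u v; apply/asboolP/asboolP => /submodN; rewrite opprB.
Qed.

Lemma qmod_rel_trans : transitive qmod_rel.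
Proof.
move=> v u w /asboolP h1 /asboolP h2; apply/asboolP.
by have := submodD h1 h2; rewrite addrA subrK.
Qed.

Canonical qmod_equiv := EquivRel qmod_rel qmod_rel_refl qmod_rel_sym qmod_rel_trans.

Definition qmod := {eq_quot qmod_equiv}.

HB.instance Definition _ := Choice.on qmod.
HB.instance Definition _ := Quotient.on qmod.

Definition qpi (u : M) : qmod := \pi_qmod u.

Lemma qpi_eq u v : qpi u = qpi v <-> N (u - v).
Proof.
by split=> [/eqmodP /asboolP //|h]; apply/eqmodP/asboolP.
Qed.

Lemma qpi_surj (q : qmod) : exists u, q = qpi u.
Proof. by exists (repr q); rewrite /qpi reprK. Qed.

Lemma repr_qpi u : N (repr (qpi u) - u).
Proof. by apply/qpi_eq; rewrite /qpi reprK. Qed.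

Definition qmod_add (p q : qmod) : qmod := qpi (repr p + repr q).
Definition qmod_opp (p : qmod) : qmod := qpi (- repr p).
Definition qmod_scale (a : R) (p : qmod) : qmod := qpi (a *: repr p).

Lemma qmod_addE u v : qmod_add (qpi u) (qpi v) = qpi (u + v).
Proof.
by apply/qpi_eq; rewrite opprD addrACA; apply: submodD; exact: repr_qpi.
Qed.

Lemma qmod_oppE u : qmod_opp (qpi u) = qpi (- u).
Proof. by apply/qpi_eq; rewrite -opprD; apply: submodN; exact: repr_qpi. Qed.

Lemma qmod_scaleE a u : qmod_scale a (qpi u) = qpi (a *: u).
Proof. by apply/qpi_eq; rewrite -scalerBr; apply: submodZ; exact: repr_qpi. Qed.

Lemma qmod_addA : associative qmod_add.
Proof.
move=> p q r; have [u ->] := qpi_surj p; have [v ->] := qpi_surj q.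
by have [w ->] := qpi_surj r; rewrite !qmod_addE addrA.
Qed.

Lemma qmod_addC : commutative qmod_add.
Proof. by move=> p q; rewrite /qmod_add addrC. Qed.

Lemma qmod_add0 : left_id (qpi 0) qmod_add.
Proof. by move=> p; have [u ->] := qpi_surj p; rewrite qmod_addE add0r. Qed.

Lemma qmod_addN : left_inverse (qpi 0) qmod_opp qmod_add.
Proof.
by move=> p; have [u ->] := qpi_surj p; rewrite qmod_oppE qmod_addE addNr.
Qed.

HB.instance Definition _ :=
  GRing.isZmodule.Build qmod qmod_addA qmod_addC qmod_add0 qmod_addN.

Lemma qpiD u v : qpi u + qpi v = qpi (u + v).
Proof. exact: qmod_addE. Qed.

Lemma qmod_scaleA a b q : qmod_scale a (qmod_scale b q) = qmod_scale (a * b) q.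
Proof. by have [u ->] := qpi_surj q; rewrite !qmod_scaleE scalerA. Qed.

Lemma qmod_scale1 : left_id 1 qmod_scale.
Proof. by move=> q; have [u ->] := qpi_surj q; rewrite qmod_scaleE scale1r. Qed.

Lemma qmod_scaleDr : right_distributive qmod_scale +%R.
Proof.
move=> a p q; have [u ->] := qpi_surj p; have [v ->] := qpi_surj q.
by rewrite qpiD !qmod_scaleE scalerDr qpiD.
Qed.

Lemma qmod_scaleDl q : {morph qmod_scale^~ q : a b / a + b}.
Proof.
move=> a b; have [u ->] := qpi_surj q.
by rewrite !qmod_scaleE scalerDl qpiD.
Qed.

HB.instance Definition _ := GRing.Zmodule_isLmodule.Build R qmod
  qmod_scaleA qmod_scale1 qmod_scaleDr qmod_scaleDl.

Lemma qpi_is_linear : linear qpi.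
Proof. by move=> a u v; rewrite -qpiD -qmod_scaleE. Qed.

HB.instance Definition _ := GRing.isLinear.Build R M qmod _ qpi qpi_is_linear.

End QuotientModule.

Section QuotientMap.
Variables (R : comPzRingType) (M M' : lmodType R).
Variables (N : submod M) (N' : submod M') (f : {linear M -> M'}).
Hypothesis fN : forall u, N u -> N' (f u).

Definition qmod_map of (forall u, N u -> N' (f u)) : qmod N -> qmod N' :=
  fun q => qpi N' (f (repr q)).

Lemma qmod_mapE u : qmod_map fN (qpi N u) = qpi N' (f u).
Proof. by apply/qpi_eq; rewrite -linearB; apply: fN; exact: repr_qpi. Qed.

Lemma qmod_map_is_linear : linear (qmod_map fN).
Proof.
move=> a p q; have [u ->] := qpi_surj p; have [v ->] := qpi_surj q.
by rewrite -linearP !qmod_mapE linearP linearP.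
Qed.

HB.instance Definition _ :=
  GRing.isLinear.Build R (qmod N) (qmod N') _ (qmod_map fN) qmod_map_is_linear.

End QuotientMap.

Section IdealPower.
Variables (R : comPzRingType) (I : set R) (M : lmodType R).

Definition ideal_smul_set (N : submod M) : set M :=
  [set \sum_(p <- s) p.1 *: p.2 |
    s in [set s : seq (R * M) | forall p, p \in s -> I p.1 /\ N p.2]].

Lemma ideal_smul0 N : ideal_smul_set N 0.
Proof. by exists [::]; rewrite ?big_nil. Qed.

Lemma ideal_smulD N u v :
  ideal_smul_set N u -> ideal_smul_set N v -> ideal_smul_set N (u + v).
Proof.
move=> [s hs <-] [t ht <-]; exists (s ++ t); last by rewrite big_cat.
by move=> p /=; rewrite mem_cat => /orP[/hs|/ht].
Qed.

Lemma ideal_smulZ N a u : ideal_smul_set N u -> ideal_smul_set N (a *: u).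
Proof.
move=> [s hs <-]; exists [seq (p.1, a *: p.2) | p <- s].
  by move=> _ /mapP[p /hs[h1 h2] ->]; split=> //=; exact: submodZ.
rewrite big_map scaler_sumr; apply: eq_bigr => p _ /=.
by rewrite !scalerA mulrC.
Qed.

Definition ideal_smul N : submod M :=
  Submod (@ideal_smul0 N) (@ideal_smulD N) (@ideal_smulZ N).

Definition full_submod : submod M :=
  @Submod R M setT Logic.I (fun _ _ _ _ => Logic.I) (fun _ _ _ => Logic.I).

Definition ideal_pow (r : nat) : submod M := iter r ideal_smul full_submod.

Lemma ideal_smulS (N N' : submod M) :
  N `<=` N' -> ideal_smul N `<=` ideal_smul N'.
Proof. by move=> h u [s hs <-]; exists s => // p /hs[? /h]. Qed.

Lemma ideal_powS r : ideal_pow r.+1 `<=` ideal_pow r.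
Proof. by elim: r => [//|r IH]; exact: ideal_smulS. Qed.

End IdealPower.

Lemma ideal_pow_map (R : comPzRingType) (I : set R) (M M' : lmodType R)
    (f : {linear M -> M'}) r u : ideal_pow I M r u -> ideal_pow I M' r (f u).
Proof.
elim: r u => [//|r IH] u [s hs <-]; exists [seq (p.1, f p.2) | p <- s].
  by move=> _ /mapP[p /hs[h1 h2] ->]; split=> //=; exact: IH.
by rewrite big_map linear_sum; apply: eq_bigr => p _; rewrite linearZ.
Qed.

Lemma ideal_pow_ring (R : comPzRingType) (I : set R) (M : lmodType R) r u a :
  ideal_pow I R^o r a -> ideal_pow I M r (a *: u).
Proof.
elim: r a => [//|r IH] a [s hs <-]; exists [seq (p.1, p.2 *: u) | p <- s].
  by move=> _ /mapP[p /hs[h1 h2] ->]; split=> //=; exact: IH.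
rewrite big_map scaler_suml; apply: eq_bigr => p _ /=.
by rewrite scalerA.
Qed.

Section Completion.
Variables (R : comPzRingType) (I : set R) (M : lmodType R).

Definition adic_quo (r : nat) := qmod (ideal_pow I M r).

Definition adic_trans (r : nat) : {linear adic_quo r.+1 -> adic_quo r} :=
  qmod_map (f := idfun) (@ideal_powS R I M r).

Record completion := Completion {
  comp_at :> forall r, adic_quo r;
  comp_compat : forall r, adic_trans r (comp_at r.+1) = comp_at r }.

HB.instance Definition _ := gen_eqMixin completion.
HB.instance Definition _ := gen_choiceMixin completion.

Lemma completionP (f g : completion) : (forall r, f r = g r) -> f = g.
Proof.
case: f g => [f hf] [g hg] /= fg.
have e : f = g by apply: functional_extensionality_dep.
by case: g / e hg {fg} => hg; congr Completion; exact: Prop_irrelevance.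
Qed.

Lemma comp_zero_compat r : adic_trans r 0 = 0.
Proof. exact: linear0. Qed.

Lemma comp_add_compat (f g : completion) r :
  adic_trans r (f r.+1 + g r.+1) = f r + g r.
Proof. by rewrite linearD !comp_compat. Qed.

Lemma comp_opp_compat (f : completion) r : adic_trans r (- f r.+1) = - f r.
Proof. by rewrite linearN comp_compat. Qed.

Definition comp_zero := Completion comp_zero_compat.
Definition comp_add (f g : completion) := Completion (comp_add_compat f g).
Definition comp_opp (f : completion) := Completion (comp_opp_compat f).

Lemma comp_addA : associative comp_add.
Proof. by move=> f g h; apply: completionP => r /=; rewrite addrA. Qed.
Lemma comp_addC : commutative comp_add.
Proof. by move=> f g; apply: completionP => r /=; rewrite addrC. Qed.
Lemma comp_add0 : left_id comp_zero comp_add.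
Proof. by move=> f; apply: completionP => r /=; rewrite add0r. Qed.
Lemma comp_addN : left_inverse comp_zero comp_opp comp_add.
Proof. by move=> f; apply: completionP => r /=; rewrite addNr. Qed.

HB.instance Definition _ :=
  GRing.isZmodule.Build completion comp_addA comp_addC comp_add0 comp_addN.

Lemma to_comp_compat u r :
  adic_trans r (qpi (ideal_pow I M r.+1) u) = qpi (ideal_pow I M r) u.
Proof. exact: qmod_mapE. Qed.

Definition to_comp (u : M) : completion := Completion (to_comp_compat u).

End Completion.

Section CompletionMap.
Variables (R : comPzRingType) (I : set R) (M M' : lmodType R).
Variable f : {linear M -> M'}.

Definition adic_map r : {linear adic_quo I M r -> adic_quo I M' r} :=
  qmod_map (@ideal_pow_map R I M M' f r).

Lemma comp_map_compat (c : completion I M) r :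
  adic_trans I M' r (adic_map r.+1 (c r.+1)) = adic_map r (c r).
Proof.
rewrite -(comp_compat c r); have [u ->] := qpi_surj (c r.+1).
by rewrite /= !qmod_mapE.
Qed.

Definition comp_map (c : completion I M) : completion I M' :=
  Completion (comp_map_compat c).

End CompletionMap.

Section RingCompletion.
Variables (R : comPzRingType) (I : set R).

Definition ring_completion := completion I R^o.

HB.instance Definition _ := GRing.Zmodule.on ring_completion.

Let J r := ideal_pow I R^o r.

Definition adic_mul r (p q : adic_quo I R^o r) : adic_quo I R^o r :=
  qpi (J r) ((repr p : R) * (repr q : R) : R).

Lemma adic_mulE r (a b : R) :
  adic_mul (qpi (J r) a) (qpi (J r) b) = qpi (J r) (a * b : R).
Proof.
apply/qpi_eq; set a' := repr _; set b' := repr _.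
have ha : J r (a' - a) by exact: repr_qpi.
have hb : J r (b' - b) by exact: repr_qpi.
have -> : (a' : R) * b' - a * b = (a' - a) * b' + a * (b' - b).
  by rewrite mulrBl mulrBr addrA subrK.
apply: submodD; last exact: (submodZ a hb).
rewrite mulrC; exact: (submodZ (b' : R) ha).
Qed.

Lemma rcomp_one_compat r :
  adic_trans I R^o r (qpi (J r.+1) (1 : R)) = qpi (J r) (1 : R).
Proof. exact: qmod_mapE. Qed.

Lemma rcomp_mul_compat (f g : ring_completion) r :
  adic_trans I R^o r (adic_mul (f r.+1) (g r.+1)) = adic_mul (f r) (g r).
Proof.
rewrite -(comp_compat f r) -(comp_compat g r).
have [a ->] := qpi_surj (f r.+1); have [b ->] := qpi_surj (g r.+1).
by rewrite /= adic_mulE !qmod_mapE adic_mulE.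
Qed.

Definition rcomp_one : ring_completion := Completion rcomp_one_compat.
Definition rcomp_mul (f g : ring_completion) : ring_completion :=
  Completion (rcomp_mul_compat f g).

Lemma rcomp_mulA : associative rcomp_mul.
Proof.
move=> f g h; apply: completionP => r /=; have [a ->] := qpi_surj (f r).
have [b ->] := qpi_surj (g r); have [c ->] := qpi_surj (h r).
by rewrite (adic_mulE r b c) (adic_mulE r a b) !adic_mulE; congr qpi; exact: mulrA.
Qed.

Lemma rcomp_mulC : commutative rcomp_mul.
Proof. by move=> f g; apply: completionP => r /=; rewrite /adic_mul mulrC. Qed.

Lemma rcomp_mul1 : left_id rcomp_one rcomp_mul.
Proof.
move=> f; apply: completionP => r /=; have [a ->] := qpi_surj (f r).
by rewrite adic_mulE; congr qpi; exact: mul1r.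
Qed.

Lemma rcomp_mulDl : left_distributive rcomp_mul +%R.
Proof.
move=> f g h; apply: completionP => r /=; have [a ->] := qpi_surj (f r).
have [b ->] := qpi_surj (g r); have [c ->] := qpi_surj (h r).
rewrite qpiD (adic_mulE r a c) (adic_mulE r b c) qpiD adic_mulE.
by congr qpi; exact: mulrDl.
Qed.

HB.instance Definition _ := GRing.Zmodule_isComPzRing.Build ring_completion
  rcomp_mulA rcomp_mulC rcomp_mul1 rcomp_mulDl.

Definition to_rcomp (a : R) : ring_completion := to_comp I (M := R^o) a.

End RingCompletion.

Record opens (X : topologicalType) := Opens {
  opens_set :> set X;
  opens_open : open opens_set }.

Definition opensT (X : topologicalType) : opens X := Opens openT.

Definition opensI (X : topologicalType) (U V : opens X) : opens X :=
  Opens (openI (opens_open U) (opens_open V)).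

Lemma opensIl (X : topologicalType) (U V : opens X) : opensI U V `<=` U.
Proof. by move=> ? []. Qed.

Lemma opensIr (X : topologicalType) (U V : opens X) : opensI U V `<=` V.
Proof. by move=> ? []. Qed.

Record ab_presheaf (X : topologicalType) := AbPresheaf {
  ab_sec :> opens X -> zmodType;
  ab_res : forall U V : opens X, V `<=` U -> {additive ab_sec U -> ab_sec V};
  ab_res_id : forall (U : opens X) (h : U `<=` U) s, ab_res h s = s;
  ab_res_comp : forall (U V W : opens X) (h : V `<=` U) (k : W `<=` V) (l : W `<=` U) s,
    ab_res k (ab_res h s) = ab_res l s }.

Definition is_sheaf (X : topologicalType) (F : ab_presheaf X) : Prop :=
  forall (U : opens X) (I : Type) (V : I -> opens X) (h : forall i, V i `<=` U),
    U `<=` \bigcup_i V i ->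
    forall s : forall i, F (V i),
      (forall i j (W : opens X) (hi : W `<=` V i) (hj : W `<=` V j),
        ab_res F hi (s i) = ab_res F hj (s j)) ->
      exists! t : F U, forall i, ab_res F (h i) t = s i.

Section Stalk.
Variables (X : topologicalType) (F : ab_presheaf X) (x : X).

Record pregerm := Pregerm {
  pg_open : opens X;
  pg_in : pg_open x;
  pg_sec : F pg_open }.

HB.instance Definition _ := gen_eqMixin pregerm.
HB.instance Definition _ := gen_choiceMixin pregerm.

Definition same_germ (p q : pregerm) : Prop :=
  exists (W : opens X) (hp : W `<=` pg_open p) (hq : W `<=` pg_open q),
    W x /\ ab_res F hp (pg_sec p) = ab_res F hq (pg_sec q).

Definition same_germb (p q : pregerm) : bool := `[< same_germ p q >].

Lemma same_germ_refl : reflexive same_germb.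
Proof.
move=> p; apply/asboolP; exists (pg_open p), (fun _ h => h), (fun _ h => h).
by split=> //; exact: pg_in.
Qed.

Lemma same_germ_sym : symmetric same_germb.
Proof.
by move=> p q; apply/asboolP/asboolP => -[W [h [k [hx e]]]]; exists W, k, h.
Qed.

Lemma same_germ_trans : transitive same_germb.
Proof.
move=> q p r /asboolP[W [h [k [hx e]]]] /asboolP[W' [h' [k' [hx' e']]]].
apply/asboolP; have i : opensI W W' `<=` W by move=> ? [].
have i' : opensI W W' `<=` W' by move=> ? [].
exists (opensI W W'), (fun _ j => h _ (i _ j)), (fun _ j => k' _ (i' _ j)).
split=> //; rewrite -(ab_res_comp h i) e -(ab_res_comp k' i') -e'.
by rewrite (ab_res_comp k i (fun _ j => k _ (i _ j)))
  (ab_res_comp h' i' (fun _ j => k _ (i _ j))).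
Qed.

Canonical germ_equiv :=
  EquivRel same_germb same_germ_refl same_germ_sym same_germ_trans.

Definition stalk := {eq_quot germ_equiv}.

HB.instance Definition _ := Choice.on stalk.

Definition germ (U : opens X) (hx : U x) (s : F U) : stalk :=
  \pi_({eq_quot germ_equiv}) (Pregerm hx s).

Lemma germ_eq (U V : opens X) (hU : U x) (hV : V x) (s : F U) (t : F V) :
  germ hU s = germ hV t <->
  exists (W : opens X) (h : W `<=` U) (k : W `<=` V),
    W x /\ ab_res F h s = ab_res F k t.
Proof.
by split=> [/eqmodP /asboolP //|h]; apply/eqmodP/asboolP.
Qed.

Lemma germ_res (U V : opens X) (h : V `<=` U) (hU : U x) (hV : V x) (s : F U) :
  germ hV (ab_res F h s) = germ hU s.
Proof.
apply/germ_eq; exists V, (fun _ j => j), h; split=> //.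
exact: ab_res_id.
Qed.

Lemma stalk_surj (a : stalk) : exists (U : opens X) (hU : U x) s, a = germ hU s.
Proof.
exists (pg_open (repr a)), (pg_in (repr a)), (pg_sec (repr a)).
rewrite -[LHS]reprK /germ; by case: (repr a).
Qed.

Lemma stalk_surj2 (a b : stalk) :
  exists (U : opens X) (hU : U x) s t, a = germ hU s /\ b = germ hU t.
Proof.
have [U [hU [s ->]]] := stalk_surj a; have [V [hV [t ->]]] := stalk_surj b.
have i : opensI U V `<=` U by move=> ? [].
have j : opensI U V `<=` V by move=> ? [].
have h : opensI U V x by [].
by exists (opensI U V), h, (ab_res F i s), (ab_res F j t); rewrite !germ_res.
Qed.

Lemma stalk_surj3 (a b c : stalk) :
  exists (U : opens X) (hU : U x) s t u, [/\ a = germ hU s, b = germ hU t & c = germ hU u].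
Proof.
have [U [hU [s [t [-> ->]]]]] := stalk_surj2 a b.
have [V [hV [u ->]]] := stalk_surj c.
have i : opensI U V `<=` U by move=> ? [].
have j : opensI U V `<=` V by move=> ? [].
have h : opensI U V x by [].
exists (opensI U V), h, (ab_res F i s), (ab_res F i t), (ab_res F j u).
by rewrite !germ_res.
Qed.

Definition stalk_add (a b : stalk) : stalk :=
  let p := repr a in let q := repr b in
  @germ (opensI (pg_open p) (pg_open q)) (conj (pg_in p) (pg_in q))
    (ab_res F (@opensIl _ _ _) (pg_sec p) + ab_res F (@opensIr _ _ _) (pg_sec q)).

Definition stalk_opp (a : stalk) : stalk :=
  let p := repr a in germ (pg_in p) (- pg_sec p).

Definition stalk_zero : stalk := @germ (opensT X) Logic.I 0.

Lemma repr_germ (U : opens X) (hU : U x) (s : F U) :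
  germ (pg_in (repr (germ hU s))) (pg_sec (repr (germ hU s))) = germ hU s.
Proof. by rewrite -[RHS]reprK /germ; case: (repr _). Qed.

Lemma stalk_addE (U : opens X) (hU : U x) (s t : F U) :
  stalk_add (germ hU s) (germ hU t) = germ hU (s + t).
Proof.
rewrite /stalk_add; move: (repr_germ hU s) (repr_germ hU t).
case: (repr _) => P hP p; case: (repr _) => Q hQ q /=.
move=> /germ_eq[V [h [k [hV e]]]] /germ_eq[W [h' [k' [hW e']]]].
have i : opensI V W `<=` V by move=> ? [].
have j : opensI V W `<=` W by move=> ? [].
have l : opensI V W `<=` opensI P Q by move=> y [/h ? /h' ?].
apply/germ_eq; exists (opensI V W), l, (fun _ z => k _ (i _ z)); split=> //.
rewrite !raddfD; congr (_ + _).
  rewrite (ab_res_comp _ l (fun _ z => h _ (i _ z))) -(ab_res_comp h i) e.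
  exact: ab_res_comp.
rewrite (ab_res_comp _ l (fun _ z => h' _ (j _ z))) -(ab_res_comp h' j) e'.
exact: ab_res_comp.
Qed.

Lemma stalk_oppE (U : opens X) (hU : U x) (s : F U) :
  stalk_opp (germ hU s) = germ hU (- s).
Proof.
rewrite /stalk_opp; move: (repr_germ hU s); case: (repr _) => P hP p /=.
move=> /germ_eq[V [h [k [hV e]]]]; apply/germ_eq; exists V, h, k.
by rewrite !raddfN e.
Qed.

Lemma stalk_zeroE (U : opens X) (hU : U x) : stalk_zero = germ hU 0.
Proof.
apply/germ_eq; exists U, (@subsetT _ _), (fun _ z => z).
by rewrite !raddf0.
Qed.

Lemma stalk_addA : associative stalk_add.
Proof.
move=> a b c; have [U [hU [s [t [u [-> -> ->]]]]]] := stalk_surj3 a b c.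
by rewrite !stalk_addE addrA.
Qed.

Lemma stalk_addC : commutative stalk_add.
Proof.
move=> a b; have [U [hU [s [t [-> ->]]]]] := stalk_surj2 a b.
by rewrite !stalk_addE addrC.
Qed.

Lemma stalk_add0 : left_id stalk_zero stalk_add.
Proof.
move=> a; have [U [hU [s ->]]] := stalk_surj a.
by rewrite (stalk_zeroE hU) stalk_addE add0r.
Qed.

Lemma stalk_addN : left_inverse stalk_zero stalk_opp stalk_add.
Proof.
move=> a; have [U [hU [s ->]]] := stalk_surj a.
by rewrite (stalk_zeroE hU) stalk_oppE stalk_addE addNr.
Qed.

HB.instance Definition _ :=
  GRing.isZmodule.Build stalk stalk_addA stalk_addC stalk_add0 stalk_addN.

Lemma germ_is_additive (U : opens X) (hU : U x) : zmod_morphism (germ hU).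
Proof.
move=> s t; rewrite -stalk_addE -stalk_oppE; reflexivity.
Qed.

HB.instance Definition _ (U : opens X) (hU : U x) :=
  GRing.isZmodMorphism.Build (F U) stalk (germ hU) (germ_is_additive hU).

End Stalk.

Section StalkMap.
Variables (X : topologicalType) (F G : ab_presheaf X) (x : X).
Variable f : forall U, {additive F U -> G U}.
Hypothesis f_res : forall (U V : opens X) (h : V `<=` U) s,
  f V (ab_res F h s) = ab_res G h (f U s).

Definition stalk_map (a : stalk F x) : stalk G x :=
  germ (pg_in (repr a)) (f (pg_open (repr a)) (pg_sec (repr a))).

Lemma stalk_mapE (U : opens X) (hU : U x) s : stalk_map (germ hU s) = germ hU (f U s).
Proof.
rewrite /stalk_map; move: (repr_germ hU s); case: (repr _) => P hP p /=.
move=> /germ_eq[V [h [k [hV e]]]]; apply/germ_eq; exists V, h, k.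
by rewrite -!f_res e.
Qed.

End StalkMap.

Record ring_presheaf (X : topologicalType) := RingPresheaf {
  rg_sec :> opens X -> comPzRingType;
  rg_res : forall U V : opens X, V `<=` U -> {rmorphism rg_sec U -> rg_sec V};
  rg_res_id : forall (U : opens X) (h : U `<=` U) s, rg_res h s = s;
  rg_res_comp : forall (U V W : opens X) (h : V `<=` U) (k : W `<=` V) (l : W `<=` U) s,
    rg_res k (rg_res h s) = rg_res l s }.

Definition ab_of_ring (X : topologicalType) (O : ring_presheaf X) : ab_presheaf X :=
  @AbPresheaf X (fun U => O U) (fun U V h => rg_res O h) (@rg_res_id X O)
    (@rg_res_comp X O).

Record ringed_space := RingedSpace {
  rs_space :> topologicalType;
  rs_sheaf : ring_presheaf rs_space;
  rs_is_sheaf : is_sheaf (ab_of_ring rs_sheaf) }.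

Notation "'O_ X" := (rs_sheaf X) (at level 8, X at level 2, format "''O_' X").

Section LocalRing.
Variables (X : ringed_space) (x : X).

Definition lring := stalk (ab_of_ring 'O_X) x.

HB.instance Definition _ := GRing.Zmodule.on lring.

Definition rgerm (U : opens X) (hU : U x) (f : 'O_X U) : lring :=
  @germ X (ab_of_ring 'O_X) x U hU f.

Definition lring_mul (a b : lring) : lring :=
  let p := repr a in let q := repr b in
  @rgerm (opensI (pg_open p) (pg_open q)) (conj (pg_in p) (pg_in q))
    (rg_res 'O_X (@opensIl _ _ _) (pg_sec p) *
     rg_res 'O_X (@opensIr _ _ _) (pg_sec q)).

Definition lring_one : lring := @rgerm (opensT X) Logic.I 1.

Lemma lring_mulE (U : opens X) (hU : U x) s t :
  lring_mul (rgerm hU s) (rgerm hU t) = rgerm hU (s * t).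
Proof.
rewrite /lring_mul; move: (repr_germ (F := ab_of_ring 'O_X) hU s).
move: (repr_germ (F := ab_of_ring 'O_X) hU t).
rewrite -![germ hU _]/(rgerm hU _).
case: (repr _) => Q hQ q; case: (repr _) => P hP p /=.
move=> /germ_eq[W [h' [k' [hW e']]]] /germ_eq[V [h [k [hV e]]]].
have i : opensI V W `<=` V by move=> ? [].
have j : opensI V W `<=` W by move=> ? [].
have l : opensI V W `<=` opensI P Q by move=> y [/h ? /h' ?].
apply/germ_eq; exists (opensI V W), l, (fun _ z => k _ (i _ z)); split=> //.
rewrite /= !rmorphM; congr (_ * _).
  rewrite (rg_res_comp _ l (fun _ z => h _ (i _ z))) -(rg_res_comp h i).
  by rewrite [X in rg_res _ _ X]e; exact: rg_res_comp.
rewrite (rg_res_comp _ l (fun _ z => h' _ (j _ z))) -(rg_res_comp h' j).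
by rewrite [X in rg_res _ _ X]e'; exact: rg_res_comp.
Qed.

Lemma lring_oneE (U : opens X) (hU : U x) : lring_one = rgerm hU 1.
Proof.
apply/germ_eq; exists U, (@subsetT _ _), (fun _ z => z).
by rewrite /= !rmorph1.
Qed.

Lemma lring_mulA : associative lring_mul.
Proof.
move=> a b c; have [U [hU [s [t [u [-> -> ->]]]]]] := stalk_surj3 a b c.
rewrite -![germ hU _]/(rgerm hU _).
by rewrite (lring_mulE hU t u) (lring_mulE hU s t) !lring_mulE mulrA.
Qed.

Lemma lring_mulC : commutative lring_mul.
Proof.
move=> a b; have [U [hU [s [t [-> ->]]]]] := stalk_surj2 a b.
rewrite -![germ hU _]/(rgerm hU _).
by rewrite (lring_mulE hU s t) (lring_mulE hU t s) mulrC.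
Qed.

Lemma lring_mul1 : left_id lring_one lring_mul.
Proof.
move=> a; have [U [hU [s ->]]] := stalk_surj a.
by rewrite (lring_oneE hU) (lring_mulE hU 1 s) mul1r.
Qed.

Lemma lring_mulDl : left_distributive lring_mul +%R.
Proof.
move=> a b c; have [U [hU [s [t [u [-> -> ->]]]]]] := stalk_surj3 a b c.
rewrite -raddfD (lring_mulE hU (s + t) u) (lring_mulE hU s u) (lring_mulE hU t u).
by rewrite mulrDl; exact: raddfD.
Qed.

HB.instance Definition _ := GRing.Zmodule_isComPzRing.Build lring
  lring_mulA lring_mulC lring_mul1 lring_mulDl.

Lemma rgerm_is_additive (U : opens X) (hU : U x) : zmod_morphism (rgerm hU).
Proof. exact: (@germ_is_additive X (ab_of_ring 'O_X) x U hU). Qed.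

Lemma rgerm_is_multiplicative (U : opens X) (hU : U x) : monoid_morphism (rgerm hU).
Proof.
by split=> [|s t]; [rewrite -(lring_oneE hU)|rewrite -(lring_mulE hU s t)].
Qed.

HB.instance Definition _ (U : opens X) (hU : U x) :=
  GRing.isZmodMorphism.Build ('O_X U) lring (rgerm hU) (rgerm_is_additive hU).
HB.instance Definition _ (U : opens X) (hU : U x) :=
  GRing.isMonoidMorphism.Build ('O_X U) lring (rgerm hU)
    (rgerm_is_multiplicative hU).

End LocalRing.

Notation "'m_ x" := (@nonunits (lring x)) (at level 8, x at level 2, format "''m_' x").

Section Modules.
Variable X : ringed_space.

Record premod := Premod {
  pm_sec :> forall U : opens X, lmodType ('O_X U);
  pm_res : forall U V : opens X, V `<=` U -> {additive pm_sec U -> pm_sec V};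
  pm_res_id : forall (U : opens X) (h : U `<=` U) s, pm_res h s = s;
  pm_res_comp : forall (U V W : opens X) (h : V `<=` U) (k : W `<=` V)
    (l : W `<=` U) s, pm_res k (pm_res h s) = pm_res l s;
  pm_resZ : forall (U V : opens X) (h : V `<=` U) a s,
    pm_res h (a *: s) = rg_res 'O_X h a *: pm_res h s }.

Definition ab_of_mod (M : premod) : ab_presheaf X :=
  @AbPresheaf X (fun U => M U) (@pm_res M) (@pm_res_id M) (@pm_res_comp M).

Record omod := Omod {
  om_pre :> premod;
  om_is_sheaf : is_sheaf (ab_of_mod om_pre) }.

Record mhom (M N : omod) := Mhom {
  mh_fun :> forall U : opens X, {linear M U -> N U};
  mh_res : forall (U V : opens X) (h : V `<=` U) s,
    mh_fun V (pm_res M h s) = pm_res N h (mh_fun U s) }.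

Definition mhom_eq (M N : omod) (f g : mhom M N) : Prop :=
  forall U s, f U s = g U s.

Definition mhom_mono (M N : omod) (f : mhom M N) : Prop :=
  forall U, injective (f U).

Lemma mhom_id_res (M : omod) (U V : opens X) (h : V `<=` U) (s : M U) :
  (idfun : {linear M V -> M V}) (pm_res M h s) = pm_res M h (idfun s).
Proof. by []. Qed.

Definition mhom_id (M : omod) : mhom M M := Mhom (@mhom_id_res M).

Lemma mhom_comp_res (M N P : omod) (g : mhom N P) (f : mhom M N)
    (U V : opens X) (h : V `<=` U) s :
  (g V \o f V) (pm_res M h s) = pm_res P h ((g U \o f U) s).
Proof. by rewrite /= !mh_res. Qed.

Definition mhom_comp (M N P : omod) (g : mhom N P) (f : mhom M N) : mhom M P :=
  @Mhom M P (fun U => g U \o f U) (mhom_comp_res g f).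

Definition OX_pre : premod :=
  @Premod (fun U => ('O_X U)^o) (fun U V h => rg_res 'O_X h)
    (@rg_res_id X 'O_X) (@rg_res_comp X 'O_X)
    (fun U V h a s => rmorphM (rg_res 'O_X h) a s).

Definition OX : omod := @Omod OX_pre (@rs_is_sheaf X).

Section ModuleStalk.
Variables (M : premod) (x : X).

Definition mstalk := stalk (ab_of_mod M) x.

HB.instance Definition _ := GRing.Zmodule.on mstalk.

Definition mgerm (U : opens X) (hU : U x) (s : M U) : mstalk :=
  @germ X (ab_of_mod M) x U hU s.

Definition mstalk_scale (a : lring x) (m : mstalk) : mstalk :=
  let p := repr a in let q := repr m in
  @mgerm (opensI (pg_open p) (pg_open q)) (conj (pg_in p) (pg_in q))
    (rg_res 'O_X (@opensIl _ _ _) (pg_sec p) *: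
     pm_res M (@opensIr _ _ _) (pg_sec q)).

Lemma mstalk_scaleE (U : opens X) (hU : U x) (a : 'O_X U) (s : M U) :
  mstalk_scale (rgerm hU a) (mgerm hU s) = mgerm hU (a *: s).
Proof.
rewrite /mstalk_scale; move: (repr_germ (F := ab_of_ring 'O_X) hU a).
move: (repr_germ (F := ab_of_mod M) hU s).
rewrite -![@germ _ (ab_of_ring 'O_X) _ _ hU a]/(rgerm hU a).
rewrite -![@germ _ (ab_of_mod M) _ _ hU s]/(mgerm hU s).
case: (repr _) => Q hQ q; case: (repr _) => P hP p /=.
move=> /germ_eq[W [h' [k' [hW e']]]] /germ_eq[V [h [k [hV e]]]].
have i : opensI V W `<=` V by move=> ? [].
have j : opensI V W `<=` W by move=> ? [].
have l : opensI V W `<=` opensI P Q by move=> y [/h ? /h' ?].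
apply/germ_eq; exists (opensI V W), l, (fun _ z => k _ (i _ z)); split=> //.
rewrite /= !pm_resZ; congr (_ *: _).
  rewrite (rg_res_comp _ l (fun _ z => h _ (i _ z))) -(rg_res_comp h i).
  by rewrite [X in rg_res _ _ X]e; exact: rg_res_comp.
rewrite (pm_res_comp _ l (fun _ z => h' _ (j _ z))) -(pm_res_comp h' j).
by rewrite [X in pm_res _ _ X]e'; exact: pm_res_comp.
Qed.

Lemma mstalk_surj2 (a : lring x) (m : mstalk) :
  exists (U : opens X) (hU : U x) f s, a = rgerm hU f /\ m = mgerm hU s.
Proof.
have [U [hU [f ->]]] := stalk_surj a; have [V [hV [s ->]]] := stalk_surj m.
have h : opensI U V x by [].
exists (opensI U V), h, (rg_res 'O_X (@opensIl _ _ _) f),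
  (pm_res M (@opensIr _ _ _) s).
split; first exact/esym/(@germ_res X (ab_of_ring 'O_X)).
exact/esym/(@germ_res X (ab_of_mod M)).
Qed.

Lemma mstalk_surj3 (a b : lring x) (m : mstalk) :
  exists (U : opens X) (hU : U x) f g s,
    [/\ a = rgerm hU f, b = rgerm hU g & m = mgerm hU s].
Proof.
have [U [hU [f [g [-> ->]]]]] := stalk_surj2 a b.
have [V [hV [s ->]]] := stalk_surj m.
have h : opensI U V x by [].
exists (opensI U V), h, (rg_res 'O_X (@opensIl _ _ _) f),
  (rg_res 'O_X (@opensIl _ _ _) g), (pm_res M (@opensIr _ _ _) s).
split; [exact/esym/(@germ_res X (ab_of_ring 'O_X))..|].
exact/esym/(@germ_res X (ab_of_mod M)).
Qed.

Lemma mstalk_surj3' (a : lring x) (m n : mstalk) :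
  exists (U : opens X) (hU : U x) f s t,
    [/\ a = rgerm hU f, m = mgerm hU s & n = mgerm hU t].
Proof.
have [U [hU [f ->]]] := stalk_surj a.
have [V [hV [s [t [-> ->]]]]] := stalk_surj2 m n.
have h : opensI U V x by [].
exists (opensI U V), h, (rg_res 'O_X (@opensIl _ _ _) f),
  (pm_res M (@opensIr _ _ _) s), (pm_res M (@opensIr _ _ _) t).
split; first exact/esym/(@germ_res X (ab_of_ring 'O_X)).
  exact/esym/(@germ_res X (ab_of_mod M)).
exact/esym/(@germ_res X (ab_of_mod M)).
Qed.

Lemma mgermD (U : opens X) (hU : U x) (s t : M U) :
  mgerm hU (s + t) = mgerm hU s + mgerm hU t.
Proof. exact: (raddfD (@germ X (ab_of_mod M) x U hU)). Qed.

Lemma mstalk_scaleA a b m :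
  mstalk_scale a (mstalk_scale b m) = mstalk_scale (a * b) m.
Proof.
have [U [hU [f [g [s [-> -> ->]]]]]] := mstalk_surj3 a b m.
by rewrite -rmorphM (mstalk_scaleE hU g s) !mstalk_scaleE scalerA.
Qed.

Lemma mstalk_scale1 : left_id 1 mstalk_scale.
Proof.
move=> m; have [U [hU [s ->]]] := stalk_surj m.
by rewrite -(rmorph1 (rgerm hU)) (mstalk_scaleE hU 1 s) scale1r.
Qed.

Lemma mstalk_scaleDr : right_distributive mstalk_scale +%R.
Proof.
move=> a m n; have [U [hU [f [s [t [-> -> ->]]]]]] := mstalk_surj3' a m n.
by rewrite -mgermD !mstalk_scaleE scalerDr mgermD.
Qed.

Lemma mstalk_scaleDl m : {morph mstalk_scale^~ m : a b / a + b}.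
Proof.
move=> a b; have [U [hU [f [g [s [-> -> ->]]]]]] := mstalk_surj3 a b m.
by rewrite -rmorphD !mstalk_scaleE scalerDl mgermD.
Qed.

HB.instance Definition _ := GRing.Zmodule_isLmodule.Build (lring x) mstalk
  mstalk_scaleA mstalk_scale1 mstalk_scaleDr mstalk_scaleDl.

Lemma mgermZ (U : opens X) (hU : U x) a (s : M U) :
  mgerm hU (a *: s) = rgerm hU a *: mgerm hU s.
Proof. by rewrite -mstalk_scaleE. Qed.

Lemma mgerm_res (U V : opens X) (h : V `<=` U) (hU : U x) (hV : V x) s :
  mgerm hV (pm_res M h s) = mgerm hU s.
Proof. exact: (@germ_res X (ab_of_mod M)). Qed.

End ModuleStalk.

Lemma rgerm_res x (U V : opens X) (h : V `<=` U) (hU : U x) (hV : V x) s :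
  rgerm hV (rg_res 'O_X h s) = rgerm hU s.
Proof. exact: (@germ_res X (ab_of_ring 'O_X)). Qed.

Section StalkHom.
Variables (M N : omod) (f : mhom M N) (x : X).

Definition mstalk_map : mstalk M x -> mstalk N x :=
  @stalk_map X (ab_of_mod M) (ab_of_mod N) x (fun U => f U).

Lemma mstalk_mapE (U : opens X) (hU : U x) s :
  mstalk_map (mgerm hU s) = mgerm hU (f U s).
Proof. exact: (@stalk_mapE X (ab_of_mod M) (ab_of_mod N) x _ (mh_res f)). Qed.

Lemma mstalk_map_is_linear : linear mstalk_map.
Proof.
move=> a m n; have [U [hU [g [s [t [-> -> ->]]]]]] := mstalk_surj3' a m n.
by rewrite -mgermZ -mgermD !mstalk_mapE linearP mgermD mgermZ.
Qed.

HB.instance Definition _ := GRing.isLinear.Build (lring x) (mstalk M x)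
  (mstalk N x) _ mstalk_map mstalk_map_is_linear.

End StalkHom.

(* The identification of the local ring at [x] with the stalk of the module [OX]. *)
Section StalkOX.
Variable x : X.

Definition lring_OX : (lring x)^o -> mstalk OX x :=
  @stalk_map X (ab_of_ring 'O_X) (ab_of_mod OX) x (fun U => idfun).

Lemma lring_OXE (U : opens X) (hU : U x) (s : 'O_X U) :
  lring_OX (rgerm hU s) = mgerm (M := OX) hU s.
Proof. exact: (@stalk_mapE X (ab_of_ring 'O_X) (ab_of_mod OX) x). Qed.

Lemma lring_OX_is_linear : linear lring_OX.
Proof.
move=> a m n; have [U [hU [f [s [t [-> -> ->]]]]]] := stalk_surj3 a m n.
rewrite -![germ hU _]/(rgerm hU _).
have -> : rgerm hU f *: (rgerm hU s : (lring x)^o) + rgerm hU t =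
          rgerm hU (f * s + t) by rewrite rmorphD rmorphM.
rewrite (lring_OXE hU) mgermD (mgermZ (M := OX) hU f s).
by rewrite (lring_OXE hU s) (lring_OXE hU t).
Qed.

HB.instance Definition _ := GRing.isLinear.Build (lring x) (lring x)^o
  (mstalk OX x) _ lring_OX lring_OX_is_linear.

End StalkOX.

Lemma basic_open_is_open (U : opens X) (f : 'O_X U) :
  open [set y | exists h : U y, is_unit (rgerm h f)].
Proof.
rewrite openE => y [h [b]]; have [V [hV [g ->]]] := stalk_surj b.
have hW : opensI U V y by [].
rewrite -(rgerm_res (@opensIl _ U V) h hW) -[germ hV g]/(rgerm hV g).
rewrite -(rgerm_res (@opensIr _ U V) hV hW) -rmorphM.
rewrite -(rmorph1 (rgerm hW)) => /germ_eq[W [k [l [hy e]]]].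
rewrite /interior; apply: (filterS (P := W)); last first.
  by apply: open_nbhs_nbhs; split=> //; exact: opens_open.
move=> z hz; have hUV : opensI U V z := k z hz.
have hU : U z by case: hUV.
exists hU, (rgerm hUV (rg_res 'O_X (@opensIr _ U V) g)).
rewrite -(rgerm_res (@opensIl _ U V) hU hUV) -rmorphM /=.
rewrite -(rgerm_res k hUV hz) [X in rgerm _ X]e rgerm_res.
exact: rmorph1.
Qed.

Definition basic_open (U : opens X) (f : 'O_X U) : opens X :=
  Opens (basic_open_is_open f).

Lemma basic_open_sub (U : opens X) (f : 'O_X U) : basic_open f `<=` U.
Proof. by move=> y []. Qed.

(* [M U -> M (D(f))] is the localization at [f], for every [f]: on an affine [U]
   this says that [M] restricted to [U] is the sheaf associated to [M U].
   Invertibility of [f] on [M (D(f))] comes from its invertibility in O(D(f)). *)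
Definition localizes (M : premod) (U : opens X) : Prop :=
  forall f : 'O_X U,
    (forall s : M (basic_open f), exists n m,
      pm_res M (@basic_open_sub U f) m =
      rg_res 'O_X (@basic_open_sub U f) f ^+ n *: s) /\
    (forall m : M U, pm_res M (@basic_open_sub U f) m = 0 ->
      exists n, f ^+ n *: m = 0).

Definition vanishing (U : opens X) (y : X) (h : U y) : set ('O_X U) :=
  [set f | ~ is_unit (rgerm h f)].

(* [(U, O_X|U)] is isomorphic to Spec O_X(U): the point [y] corresponds to the
   prime ideal [vanishing y] of the functions that are not invertible at [y],
   the topology is generated by the sets D(f), and O_X(D(f)) is the
   localization of O_X(U) at [f]. *)
Definition affine (U : opens X) : Prop :=
  [/\ forall y (h : U y), is_prime_ideal (vanishing h),
      forall y z (h : U y) (k : U z), vanishing h = vanishing k -> y = z,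
      forall P : set ('O_X U), is_prime_ideal P ->
        exists y (h : U y), vanishing h = P,
      forall (V : opens X) y, V `<=` U -> V y ->
        exists f : 'O_X U, basic_open f y /\ basic_open f `<=` V &
      (forall f : 'O_X U, is_unit (rg_res 'O_X (@basic_open_sub U f) f)) /\
      localizes OX U].

Definition quasi_coherent (M : premod) : Prop :=
  forall x, exists U : opens X, [/\ U x, affine U & localizes M U].

(* Over a Noetherian scheme, coherent means quasi-coherent and locally finitely
   generated. *)
Definition coherent (M : premod) : Prop :=
  forall x, exists U : opens X,
    [/\ U x, affine U, localizes M U & finitely_generated (M U)].

Record qcoh := Qcoh {
  qc_mod :> omod;
  qc_quasi_coherent : quasi_coherent qc_mod }.

(* [jomod x r M] is the pushforward of the pullback of [M] along
   Spec (O_x / m_x ^ r) -> X. As this spectrum has at most one point, lying over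
   [x], the sections over [U] are [M_x / m_x ^ r M_x] if [x] is in [U], and 0
   otherwise, i.e. the functions from the proofs of [U x] to
   [M_x / m_x ^ r M_x]. *)
Section JMod.
Variables (x : X) (r : nat) (M : omod).

Let Q : lmodType (lring x) := adic_quo 'm_x (mstalk M x) r.

Definition jsec (U : opens X) := U x -> adic_quo 'm_x (mstalk M x) r.

HB.instance Definition _ U := Choice.copy (jsec U) (U x -> Q).
HB.instance Definition _ U := GRing.Zmodule.copy (jsec U) (U x -> Q).

Definition jscale (U : opens X) (a : 'O_X U) (s : jsec U) : jsec U :=
  fun h => rgerm h a *: s h.

Lemma jscaleA U a b (s : jsec U) : jscale a (jscale b s) = jscale (a * b) s.
Proof. by apply/funext => h; rewrite /jscale scalerA rmorphM. Qed.

Lemma jscale1 U : left_id 1 (@jscale U).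
Proof. by move=> s; apply/funext => h; rewrite /jscale rmorph1 scale1r. Qed.

Lemma jscaleDr U : right_distributive (@jscale U) +%R.
Proof. by move=> a s t; apply/funext => h; rewrite /jscale scalerDr. Qed.

Lemma jscaleDl U (s : jsec U) : {morph (@jscale U)^~ s : a b / a + b}.
Proof. by move=> a b; apply/funext => h; rewrite /jscale rmorphD scalerDl. Qed.

HB.instance Definition _ U := GRing.Zmodule_isLmodule.Build ('O_X U) (jsec U)
  (@jscaleA U) (@jscale1 U) (@jscaleDr U) (@jscaleDl U).

Definition jres (U V : opens X) (h : V `<=` U) (s : jsec U) : jsec V :=
  fun k => s (h x k).

Lemma jres_is_additive (U V : opens X) (h : V `<=` U) : zmod_morphism (jres h).
Proof. by []. Qed.

HB.instance Definition _ (U V : opens X) (h : V `<=` U) :=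
  GRing.isZmodMorphism.Build (jsec U) (jsec V) (jres h) (jres_is_additive h).

Lemma jres_id (U : opens X) (h : U `<=` U) s : jres h s = s.
Proof. by apply/funext => k; rewrite /jres; congr s; exact: Prop_irrelevance. Qed.

Lemma jres_comp (U V W : opens X) (h : V `<=` U) (k : W `<=` V) (l : W `<=` U) s :
  jres k (jres h s) = jres l s.
Proof. by apply/funext => i; rewrite /jres; congr s; exact: Prop_irrelevance. Qed.

Lemma jresZ (U V : opens X) (h : V `<=` U) a (s : jsec U) :
  jres h (a *: s) = rg_res 'O_X h a *: jres h s.
Proof.
apply/funext => k; rewrite /jres.
by rewrite -[RHS]/(rgerm k (rg_res 'O_X h a) *: _) (rgerm_res h (h x k)).
Qed.

Definition jpre : premod := @Premod jsec jres jres_id jres_comp jresZ.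

Lemma j_is_sheaf : is_sheaf (ab_of_mod jpre).
Proof.
move=> U I V h cov s glue.
have ex (k : U x) : exists q : Q, forall i (l : V i x), s i l = q.
  have [i _ ki] := cov x k; exists (s i ki) => j l.
  have := glue i j (opensI (V i) (V j)) (@opensIl _ _ _) (@opensIr _ _ _).
  move=> /(congr1 (fun g => g (conj ki l))) /=.
  rewrite /jres => e; rewrite -[l](Prop_irrelevance (@opensIr _ (V i) (V j) x (conj ki l))) -e.
  by congr (s i _); exact: Prop_irrelevance.
exists (fun k => sval (cid (ex k))); split=> [i|t ht].
  apply/funext => l; rewrite /= /jres; case: cid => q /= hq; exact/esym/hq.
apply/funext => k; case: cid => q /= hq; have [i _ ki] := cov x k.
rewrite -(hq i ki) -(ht i) /= /jres; congr t; exact: Prop_irrelevance.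
Qed.

Definition jomod : omod := Omod j_is_sheaf.

End JMod.

Lemma adic_quo_kill (x : X) (r : nat) (M : omod) (a : lring x)
    (q : adic_quo 'm_x (mstalk M x) r) : ~ is_unit a -> a ^+ r *: q = 0.
Proof.
move=> ha; have [u ->] := qpi_surj q; rewrite -linearZ -[RHS](linear0 (qpi _)).
apply/qpi_eq; rewrite subr0.
elim: r u {q} => [//|r IH] u; exists [:: (a, a ^+ r *: u)].
  by move=> p; rewrite inE => /eqP-> /=; split=> //; exact: IH.
by rewrite big_seq1 /= scalerA -exprS.
Qed.

Lemma j_quasi_coherent (x : X) (r : nat) (M : omod) :
  (forall y, exists2 U : opens X, U y & affine U) ->
  quasi_coherent (jomod x r M).
Proof.
move=> aff y; have [U hU aU] := aff y; exists U; split=> // f; split=> [s|m hm].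
  have [[hx hf]|hx] := pselect (basic_open f x); last first.
    by exists 0%N, 0; apply/funext => k; case: (hx k).
  exists 0%N, (fun _ => s (ex_intro _ hx hf)); rewrite expr0 scale1r.
  by apply/funext => k; rewrite /= /jres; congr s; exact: Prop_irrelevance.
have [hx|hx] := pselect (U x); last first.
  by exists 0%N; apply/funext => k; case: (hx k).
have [hf|hf] := pselect (is_unit (rgerm hx f)).
  exists 0%N; rewrite expr0 scale1r; apply/funext => k.
  have := congr1 (fun g => g (ex_intro _ hx hf)) hm.
  by apply: etrans; rewrite /= /jres; congr m; exact: Prop_irrelevance.
exists r; apply/funext => k; rewrite -[LHS]/(rgerm k (f ^+ r) *: m k) rmorphXn.
by apply: adic_quo_kill; rewrite (Prop_irrelevance k hx).
Qed.

Section JMaps.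
Variables (x : X) (r : nat).

Section JSecMap.
Variables (r' : nat) (M N : omod).
Variable f : {linear adic_quo 'm_x (mstalk M x) r' -> adic_quo 'm_x (mstalk N x) r}.

Definition jsec_map (U : opens X) (s : jomod x r' M U) : jomod x r N U :=
  fun h => f (s h).

Lemma jsec_map_is_linear U : linear (@jsec_map U).
Proof.
move=> a s t; apply/funext => h; rewrite /jsec_map.
exact: (linearP f (rgerm h a) (s h) (t h)).
Qed.

HB.instance Definition _ U := GRing.isLinear.Build ('O_X U) (jomod x r' M U)
  (jomod x r N U) _ (@jsec_map U) (@jsec_map_is_linear U).

Lemma jsec_map_res (U V : opens X) (h : V `<=` U) s :
  jsec_map (pm_res (jomod x r' M) h s) = pm_res (jomod x r N) h (jsec_map s).
Proof. by []. Qed.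

Definition jmap_of : mhom (jomod x r' M) (jomod x r N) :=
  @Mhom (jomod x r' M) (jomod x r N) (fun U => @jsec_map U) jsec_map_res.

End JSecMap.

Definition jmap (M N : omod) (f : mhom M N) : mhom (jomod x r M) (jomod x r N) :=
  jmap_of (adic_map 'm_x (mstalk_map (x := x) f) r).

Definition jtrans (M : omod) : mhom (jomod x r.+1 M) (jomod x r M) :=
  jmap_of (adic_trans 'm_x (mstalk M x) r).

Definition jmul (M : omod) (a : lring x) : mhom (jomod x r M) (jomod x r M) :=
  jmap_of ( *:%R a : {linear adic_quo 'm_x (mstalk M x) r -> _}).

Definition junit_sec (M : omod) (U : opens X) (s : M U) : jomod x r M U :=
  fun h => qpi (ideal_pow 'm_x (mstalk M x) r) (mgerm h s).

Lemma junit_is_linear (M : omod) U : linear (@junit_sec M U).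
Proof.
move=> a s t; apply/funext => h; rewrite /junit_sec mgermD mgermZ.
exact: linearP.
Qed.

HB.instance Definition _ (M : omod) U := GRing.isLinear.Build ('O_X U) (M U)
  (jomod x r M U) _ (@junit_sec M U) (@junit_is_linear M U).

Lemma junit_res (M : omod) (U V : opens X) (h : V `<=` U) s :
  junit_sec (pm_res M h s) = pm_res (jomod x r M) h (junit_sec s).
Proof.
by apply/funext => k; rewrite /junit_sec (mgerm_res h (h x k)).
Qed.

Definition junit (M : omod) : mhom M (jomod x r M) :=
  @Mhom M (jomod x r M) (fun U => @junit_sec M U) (@junit_res M).

End JMaps.

End Modules.

Section MhomExt.
Variable X : ringed_space.

Lemma linear_ext (R : pzRingType) (U V : lmodType R) (f g : {linear U -> V}) :
  f =1 g -> f = g.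
Proof.
case: f g => [f [[f1] [f2]]] [g [[g1] [g2]]] /= fg0.
have fg : f = g by apply/funext.
case: g / fg {fg0} g1 g2 => g1 g2.
by rewrite (Prop_irrelevance f1 g1) (Prop_irrelevance f2 g2).
Qed.

Lemma mhomP (M N : omod X) (f g : mhom M N) : (forall U, f U =1 g U) -> f = g.
Proof.
case: f g => [f hf] [g hg] /= fg.
have e : f = g by apply: functional_extensionality_dep => U; exact/linear_ext/fg.
by case: g / e hg {fg} => hg; congr Mhom; exact: Prop_irrelevance.
Qed.

End MhomExt.

Section Topology.
Variable X : topologicalType.

Definition irreducible_set (Z : set X) : Prop :=
  Z !=set0 /\
  forall C D : set X, closed C -> closed D -> Z `<=` C `|` D ->
    Z `<=` C \/ Z `<=` D.

Definition irreducible_space : Prop := irreducible_set [set: X].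

Definition irreducible_chain (n : nat) : Prop :=
  exists Z : nat -> set X,
    (forall i, (i <= n)%N -> closed (Z i) /\ irreducible_set (Z i)) /\
    (forall i, (i < n)%N -> Z i `<` Z i.+1).

Definition has_dimension (n : nat) : Prop :=
  irreducible_chain n /\ ~ irreducible_chain n.+1.

Definition generic_point (x : X) : Prop := closure [set x] = [set: X].

Definition closed_point := {x : X | closed [set x]}.

Definition chains (m : nat) : set (m.+1.-tuple X) :=
  [set t | sorted (fun x y => `[< closure [set x] y >]) t].

Arguments chains : clear implicits.

Definition slice (m : nat) (x : X) (T : set (m.+2.-tuple X)) :
    set (m.+1.-tuple X) :=
  [set t | chains m t /\ T (cons_tuple x t)].

Definition bold0 (eta : X) : set (1.-tuple X) := [set [tuple eta]].

Definition bold1 : set (1.-tuple X) :=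
  [set t | exists x : closed_point, t = [tuple sval x]].

Definition bold01 (eta : X) : set (2.-tuple X) :=
  [set t | exists x : closed_point, t = [tuple eta; sval x]].

Lemma bold0_in (eta : X) : bold0 eta [tuple eta].
Proof. by []. Qed.

Lemma bold1_in (x : closed_point) : bold1 [tuple sval x].
Proof. by exists x. Qed.

Lemma bold01_chains eta : generic_point eta -> bold01 eta `<=` chains 1.
Proof.
move=> h t [x ->]; rewrite /chains /= andbT; apply/asboolP.
by rewrite h.
Qed.

Lemma slice_bold01 eta : slice eta (bold01 eta) = bold1.
Proof.
apply/seteqP; split=> t.
  move=> [_ [x /(congr1 (@tval _ _)) [e]]]; exists x.
  exact: val_inj.
move=> [x ->]; split; first by rewrite /chains.
by exists x; exact: val_inj.
Qed.

End Topology.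

Arguments chains {X} m _.
Arguments bold1 : clear implicits.

Record scheme := Scheme {
  sch_space :> ringed_space;
  sch_affine : forall x : sch_space, exists2 U : opens sch_space, U x & affine U }.

Section Schemes.
Variable X : scheme.

Definition noetherian_scheme : Prop :=
  exists n (U : 'I_n -> opens X),
    (forall i, affine (U i) /\ noetherian_ring ('O_X (U i))) /\
    \bigcup_i U i = [set: X].

Definition regular_scheme : Prop :=
  forall x : X, regular_local_ring (lring x).

Definition function_field (eta : X) : comPzRingType := lring eta.

Definition hatO (x : X) : comPzRingType := ring_completion 'm_x.

Lemma OX_localizes (U : opens X) : affine U -> localizes (OX X) U.
Proof. by case=> _ _ _ _ []. Qed.

Lemma OX_quasi_coherent : quasi_coherent (OX X).
Proof.
move=> x; have [U hU aU] := sch_affine x.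
by exists U; split=> //; exact: OX_localizes.
Qed.

Lemma OX_coherent : coherent (OX X).
Proof.
move=> x; have [U hU aU] := sch_affine x.
exists U; split=> //; first exact: OX_localizes.
exists 1%N, (fun _ => (1 : 'O_X U) : OX X U) => m; exists (fun _ => m : 'O_X U).
by rewrite big_ord1; exact/esym/(mulr1 (m : 'O_X U)).
Qed.

Definition qcOX : qcoh X := Qcoh OX_quasi_coherent.

Lemma qcOX_coherent : coherent qcOX.
Proof. exact: OX_coherent. Qed.

Definition qcj (x : X) (r : nat) (M : qcoh X) : qcoh X :=
  Qcoh (@j_quasi_coherent X x r M (@sch_affine X)).

Record direct_system := DirectSystem {
  ds_index : Type;
  ds_le : ds_index -> ds_index -> Prop;
  ds_refl : forall i, ds_le i i;
  ds_trans : forall i j k, ds_le i j -> ds_le j k -> ds_le i k;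
  ds_inhabited : inhabited ds_index;
  ds_directed : forall i j, exists k, ds_le i k /\ ds_le j k;
  ds_obj :> ds_index -> qcoh X;
  ds_map : forall i j, ds_le i j -> mhom (ds_obj i) (ds_obj j);
  ds_map_id : forall i (h : ds_le i i), ds_map h = mhom_id (ds_obj i);
  ds_map_comp : forall i j k (h : ds_le i j) (h' : ds_le j k) (l : ds_le i k),
    mhom_comp (ds_map h') (ds_map h) = ds_map l }.

Definition is_cocone (D : direct_system) (M : qcoh X)
    (c : forall i, mhom (D i) M) : Prop :=
  forall i j (h : ds_le i j), mhom_comp (c j) (ds_map h) = c i.

Definition is_direct_limit (D : direct_system) (M : qcoh X)
    (c : forall i, mhom (D i) M) : Prop :=
  is_cocone c /\
  forall (N : qcoh X) (g : forall i, mhom (D i) N), is_cocone g ->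
    exists! f : mhom M N, forall i, mhom_comp f (c i) = g i.

(* A family of functors M |-> A(T, M) satisfying the recursive rules of the adele
   groups. The product of completed stalks computing A(T, M) for m = 0, and the
   product over x of the limits over r of the A(xT, j_rx M) for m > 0, are given
   by their projections [ad_stalk] and [ad_slice], natural in M; [ad_stalk_prod]
   and [ad_slice_prod] say that these projections exhibit A(T, M) as the product,
   respectively as the product of limits. Sets T not contained in [chains m] are
   unconstrained. *)
Record adele_functor := AdeleFunctor {
  ad :> forall m, set (m.+1.-tuple X) -> qcoh X -> zmodType;

  ad_map : forall m (T : set (m.+1.-tuple X)) (M N : qcoh X),
    mhom M N -> {additive ad T M -> ad T N};

  ad_map_id : forall m (T : set (m.+1.-tuple X)) (M : qcoh X) (a : ad T M),
    ad_map T (mhom_id M) a = a;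

  ad_map_comp : forall m (T : set (m.+1.-tuple X)) (M N P : qcoh X)
    (g : mhom N P) (f : mhom M N) (a : ad T M),
    ad_map T (mhom_comp g f) a = ad_map T g (ad_map T f a);

  ad_lim : forall m (T : set (m.+1.-tuple X)) (D : direct_system) (M : qcoh X)
    (c : forall i, mhom (D i) M),
    T `<=` chains m -> is_direct_limit c ->
    (forall a : ad T M, exists i (b : ad T (D i)), ad_map T (c i) b = a) /\
    (forall i (b : ad T (D i)), ad_map T (c i) b = 0 ->
       exists j (h : ds_le i j), ad_map T (ds_map h) b = 0);

  ad_stalk : forall (T : set (1.-tuple X)) (M : qcoh X), coherent M ->
    forall x, T [tuple x] -> {additive ad T M -> completion 'm_x (mstalk M x)};

  ad_stalk_prod : forall (T : set (1.-tuple X)) (M : qcoh X) (hM : coherent M)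
    (y : forall x, T [tuple x] -> completion 'm_x (mstalk M x)),
    exists! a : ad T M, forall x (h : T [tuple x]), ad_stalk hM h a = y x h;

  ad_stalk_map : forall (T : set (1.-tuple X)) (M N : qcoh X) (hM : coherent M)
    (hN : coherent N) (f : mhom M N) x (h : T [tuple x]) (a : ad T M),
    ad_stalk hN h (ad_map T f a) =
    comp_map (mstalk_map (x := x) f) (ad_stalk hM h a);

  ad_slice : forall m (T : set (m.+2.-tuple X)) (M : qcoh X),
    T `<=` chains m.+1 -> coherent M ->
    forall x r, {additive ad T M -> ad (slice x T) (qcj x r M)};

  ad_slice_compat : forall m (T : set (m.+2.-tuple X)) (M : qcoh X)
    (hT : T `<=` chains m.+1) (hM : coherent M) x r (a : ad T M),
    ad_map (M := qcj x r.+1 M) (N := qcj x r M) (slice x T) (jtrans x r M)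
      (ad_slice hT hM x r.+1 a) = ad_slice hT hM x r a;

  ad_slice_prod : forall m (T : set (m.+2.-tuple X)) (M : qcoh X)
    (hT : T `<=` chains m.+1) (hM : coherent M)
    (y : forall x r, ad (slice x T) (qcj x r M)),
    (forall x r,
      ad_map (M := qcj x r.+1 M) (N := qcj x r M) (slice x T) (jtrans x r M)
        (y x r.+1) = y x r) ->
    exists! a : ad T M, forall x r, ad_slice hT hM x r a = y x r;

  ad_slice_map : forall m (T : set (m.+2.-tuple X)) (M N : qcoh X)
    (hT : T `<=` chains m.+1) (hM : coherent M) (hN : coherent N)
    (f : mhom M N) x r (a : ad T M),
    ad_slice hT hN x r (ad_map T f a) =
    ad_map (M := qcj x r M) (N := qcj x r N) (slice x T) (jmap x r f)
      (ad_slice hT hM x r a);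

  ad_empty : forall m (M : qcoh X) (a : ad (@set0 (m.+1.-tuple X)) M), a = 0 }.

Section Boundaries.
Variables (A : adele_functor) (eta : X).

Definition constK : qcoh X := qcj eta 1 qcOX.

Definition OX_to_constK : mhom qcOX constK := junit eta 1 qcOX.

Definition global_constK (f : function_field eta) : constK (opensT X) :=
  fun _ => qpi (ideal_pow 'm_eta (mstalk (OX X) eta) 1) (lring_OX f).

Definition constK_mul (f : function_field eta) : mhom constK constK :=
  jmul 1 qcOX f.

Definition ad_cast m (T T' : set (m.+1.-tuple X)) (e : T = T') (M : qcoh X) :
    {additive A m T M -> A m T' M} :=
  let: erefl in _ = T' := e return {additive A m T M -> A m T' M} in idfun.

Hypothesis eta_gen : generic_point eta.

(* The identification of A(01, O_X) with A(1, K): the factor x = eta, where the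
   inverse system in r is constant for r > 0 since m_eta = 0; the other factors
   vanish. *)
Definition ad01_to_ad1 : A 1%N (bold01 eta) qcOX -> A 0%N (bold1 X) constK :=
  fun a => ad_cast (slice_bold01 eta) constK
    (ad_slice A (bold01_chains eta_gen) qcOX_coherent eta 1 a).

(* [c] is the image in A(1, K) of the global section [f] of K: [f] is a global
   section [s] of a coherent submodule [N], and [c] comes from the element of
   A(1, N) whose components are the images of [s] in the completed stalks. *)
Definition constK_diag (f : function_field eta)
    (c : A 0%N (bold1 X) constK) : Prop :=
  exists (N : qcoh X) (hN : coherent N) (i : mhom N constK)
    (s : N (opensT X)) (b : A 0%N (bold1 X) N),
    [/\ mhom_mono i, i (opensT X) s = global_constK f,
        forall (x : X) (h : bold1 X [tuple x]), ad_stalk A hN h b =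
          to_comp 'm_x (mgerm (U := opensT X) (x := x) Logic.I s) &
        c = ad_map A (bold1 X) i b].

Definition is_partial0 (phi0 : A 0%N (bold0 eta) qcOX -> function_field eta)
    (d : A 0%N (bold0 eta) qcOX -> A 1%N (bold01 eta) qcOX) : Prop :=
  forall a c, constK_diag (phi0 a) c <-> c = ad01_to_ad1 (d a).

Definition is_partial1
    (d : A 0%N (bold1 X) qcOX -> A 1%N (bold01 eta) qcOX) : Prop :=
  forall a, ad01_to_ad1 (d a) = ad_map A (bold1 X) OX_to_constK a.

End Boundaries.

End Schemes.

(* Main.v *)
(** At a closed point x the maximal ideal of O_x is principal, say (t), and the
    kernel of the specialization map O_x -> K = K(X) is a prime not containing
    t.  Such a prime P satisfies P = t P, hence vanishes by Noetherianity; so O_x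
    is a discrete valuation ring inside K and its completion is a complete one.

    The constant sheaf K is the direct limit of the coherent sheaves O(D), D an
    effective divisor: a rational function has finitely many poles, and O(D) is
    locally g^-1 O_X for one equation g of D.  As A(1, _) commutes with direct
    limits, A(1, K) is the union of the products over x of the completed stalks
    of the O(D), that is of the t_x^(-D_x) times the completion of O_x, which is
    the restricted product.  Finally A(01, O_X) = A(1, K) because the maximal
    ideal at the generic point is zero. *)

From HB Require Import structures.
Require Import Defs.
From mathcomp Require Import all_boot all_algebra.
From mathcomp Require Import boolp classical_sets cardinality topology.
From mathcomp Require Import ring.

Set Implicit Arguments.
Unset Strict Implicit.
Unset Printing Implicit Defensive.

Import GRing.Theory.

Local Open Scope classical_set_scope.
Local Open Scope ring_scope.

(** * Discrete valuation rings *)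

(** Regularity counts generators of the maximal ideal, so that the local rings are domains is a
    conclusion. It comes from the generic point: its local ring has no chain of two primes and is
    therefore a field K. The dimension of X reaches the local rings through the affine charts, where
    primes are points. Once every O_x embeds in K, sheaf arguments become statements about subsets
    of K: a section is an element of K lying in O_x for each x of the open set.

    [adele_functor] has no exactness clause, so elements of A(1, K) are compared by their
    components: an equality there already holds at some large enough D, and the transition maps
    preserve components in K_x. The diagonal map is described through an arbitrary coherent subsheaf
    N of K, so its independence of N must be shown: a global section of N is the image of 1 under a
    map from O_X, and this removes N. *)

Section Units.
Variable R : comPzRingType.
Implicit Types (a b t : R) (I J P : set R).

Lemma is_unit1 : is_unit (1 : R).
Proof. by exists 1; rewrite mulr1. Qed.

Lemma is_unitM a b : is_unit a -> is_unit b -> is_unit (a * b).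
Proof. by move=> [c ac] [d bd]; exists (c * d); rewrite mulrACA ac bd mulr1. Qed.

Lemma is_unitMl a b : is_unit (a * b) -> is_unit a.
Proof. by move=> [c abc]; exists (b * c); rewrite mulrA. Qed.

Lemma is_unitMr a b : is_unit (a * b) -> is_unit b.
Proof. by rewrite mulrC; exact: is_unitMl. Qed.

Lemma is_unitX a n : is_unit a -> is_unit (a ^+ n).
Proof.
move=> ua; elim: n => [|n IH]; first exact: is_unit1.
by rewrite exprS; exact: is_unitM.
Qed.

Lemma is_unit_mulI a b c : is_unit a -> a * b = a * c -> b = c.
Proof.
move=> [d ad] e; rewrite -[b]mul1r -ad mulrAC mulrC e.
by rewrite mulrA [d * a]mulrC ad mul1r.
Qed.

Lemma is_unit_rmorph (S : comPzRingType) (f : {rmorphism R -> S}) a :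
  is_unit a -> is_unit (f a).
Proof. by move=> [b ab]; exists (f b); rewrite -rmorphM ab rmorph1. Qed.

Lemma local_unitB a b : local_ring R -> ~ is_unit b -> is_unit (1 - a * b).
Proof.
move=> [_ addI mulI] nb; apply: contrapT => h.
suff : nonunits (1 : R) by case; exact: is_unit1.
by rewrite -(subrK (a * b) 1); apply: addI => //; exact: mulI.
Qed.

Lemma local_nonunits_prime : local_ring R -> is_prime_ideal (@nonunits R).
Proof.
move=> locR; split=> [//|[]|a b nab]; first exact: is_unit1.
apply: contrapT => /not_orP[/contrapT ua /contrapT ub]; apply: nab.
exact: is_unitM.
Qed.

Lemma ideal_sum I n (a g : 'I_n -> R) :
  is_ideal I -> (forall i, I (g i)) -> I (\sum_(i < n) a i * g i).
Proof.
by move=> [I0 ID IM] Ig; elim/big_ind: _ => // i _; exact: IM.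
Qed.

Lemma ideal_gen_mem n (g : 'I_n -> R) i : ideal_gen g (g i).
Proof.
exists (fun j => (j == i)%:R) => //; rewrite (bigD1 i) //= eqxx mul1r.
by rewrite big1 ?addr0 // => j /negPf->; rewrite mul0r.
Qed.

Lemma nonunits1_principal (g : 'I_1 -> R) :
  @nonunits R = ideal_gen g -> forall a, ~ is_unit a -> exists b, a = b * g ord0.
Proof.
move=> e a na; have : ideal_gen g a by rewrite -e.
by move=> [b _ <-]; exists (b ord0); rewrite big_ord1.
Qed.

Lemma ord_bound n (Q : 'I_n -> nat -> Prop) :
  (forall i j k, (j <= k)%N -> Q i j -> Q i k) ->
  (forall i, exists k, Q i k) -> exists k, forall i, Q i k.
Proof.
move=> mono /choice[f Qf]; exists (\max_(i < n) f i)%N => i.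
by apply: mono (Qf i); exact: leq_bigmax.
Qed.

Lemma noetherian_stationary (I_ : nat -> set R) : noetherian_ring R ->
  (forall n, is_ideal (I_ n)) -> (forall n, I_ n `<=` I_ n.+1) ->
  exists n, forall k, I_ k `<=` I_ n.
Proof.
move=> noethR idI incr.
have mono : forall j k, (j <= k)%N -> I_ j `<=` I_ k.
  move=> j k /subnK<-; elim: (k - j)%N => [//|m IH] a /IH; exact: incr.
have [|n [g eg]] := noethR (\bigcup_n I_ n).
  split=> [|a b [j _ Ia] [k _ Ib]|a b [j _ Ib]].
  - by exists 0%N => //; case: (idI 0%N).
  - exists (maxn j k) => //; case: (idI (maxn j k)) => _ ID _.
    by apply: ID; [apply: mono Ia; exact: leq_maxl|apply: mono Ib; exact: leq_maxr].
  - by exists j => //; case: (idI j) => _ _; apply.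
have [|N IN] := @ord_bound n (fun i k => I_ k (g i)) (fun i j k h => mono j k h (g i)).
  by move=> i; have := ideal_gen_mem g i; rewrite -eg => -[k _ Ik]; exists k.
exists N => k a Ia; have : ideal_gen g a by rewrite -eg; exists k.
by move=> [c _ <-]; exact: ideal_sum.
Qed.

(** A failing ideal always has a strictly larger failing one; dependent choice strings these into a
    chain that never becomes stationary. *)
Lemma noetherian_ind (Q : set R -> Prop) : noetherian_ring R ->
  (forall I, is_ideal I -> (forall J, is_ideal J -> I `<` J -> Q J) -> Q I) ->
  forall I, is_ideal I -> Q I.
Proof.
move=> noethR step I idI; apply: contrapT => nQ.
pose T := {J : set R | is_ideal J /\ ~ Q J}.
have next (J : T) : {J' : T | sval J `<` sval J'}.
  case: J => J [idJ nQJ] /=; apply: cid; apply: contrapT => h; apply: nQJ.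
  apply: step => // J' idJ' JJ'; apply: contrapT => nQJ'; apply: h.
  by exists (exist _ J' (conj idJ' nQJ')).
have [f [_ fS]] := dependent_choice next (exist _ I (conj idI nQ)).
have [||n stat] := @noetherian_stationary (fun n => sval (f n)) noethR.
- by move=> n; case: (svalP (f n)).
- by move=> n; apply: properW; exact: fS.
- by have := fS n; rewrite properEneq => -[/eqP ne sub]; case: ne; apply/seteqP; split.
Qed.

(* The chain of principal ideals (p n) becomes stationary, and then p n.+1
   is a multiple of t * p n.+1. *)
Lemma divisible_chain0 t (p : nat -> R) :
  local_ring R -> noetherian_ring R -> ~ is_unit t ->
  (forall n, p n = t * p n.+1) -> p 0%N = 0.
Proof.
move=> locR noethR nt pS.
have [||n stat] := @noetherian_stationary (fun n => [set a | exists c, a = c * p n]) noethR.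
- move=> n; split=> [|_ _ [a ->] [b ->]|a _ [b ->]].
  + by exists 0; rewrite mul0r.
  + by exists (a + b); rewrite mulrDl.
  + by exists (a * b); rewrite mulrA.
- by move=> n _ [a ->]; exists (a * t); rewrite -mulrA -pS.
have [|c ec] := stat n.+1 (p n.+1); first by exists 1; rewrite mul1r.
have pn0 : p n.+1 = 0.
  apply: (is_unit_mulI (local_unitB c locR nt)).
  by rewrite mulr0 mulrBl mul1r -mulrA -pS -ec subrr.
elim: n.+1 pn0 => [//|m IH pm]; apply: IH; by rewrite pS pm mulr0.
Qed.

(** A discrete valuation ring described by elements: [complete_dvr] without the completeness,
    relative to a chosen [t]. *)
Definition uniformizer t : Prop :=
  [/\ integral_domain R, t <> 0, ~ is_unit t &
      forall a, a <> 0 -> exists n u, is_unit u /\ a = u * t ^+ n].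

Lemma uniformizer_of_prime t P :
  local_ring R -> noetherian_ring R ->
  (forall a, ~ is_unit a -> exists b, a = b * t) -> ~ is_unit t ->
  is_prime_ideal P -> ~ P t -> uniformizer t /\ P = [set 0].
Proof.
move=> locR noethR princ nt [[P0 PD PM] P1 prP] nPt.
have unitP a : P a -> ~ is_unit a.
  by move=> Pa [b ab]; apply: P1; rewrite -ab mulrC; exact: PM.
have P_eq0 a : P a -> a = 0.
  move=> Pa; pose T := {b | P b}.
  have next (b : T) : {b' : T | sval b = t * sval b'}.
    case: b => b Pb /=; apply: cid; have [c ec] := princ b (unitP _ Pb).
    have [Pc|//] : P c \/ P t by apply: prP; rewrite -ec.
    by exists (exist _ c Pc) => /=; rewrite mulrC.
  have [f [f0 fS]] := dependent_choice next (exist _ a Pa).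
  have := divisible_chain0 (p := fun n => sval (f n)) locR noethR nt fS.
  by rewrite f0.
have dom : integral_domain R.
  split; first by move=> e; apply: P1; rewrite e.
  by move=> a b ab; case: (prP a b); rewrite ?ab // => /P_eq0; [left|right].
split; last by apply/seteqP; split=> [a /P_eq0//|a ->].
split=> //; first by move=> t0; apply: nPt; rewrite t0.
move=> a a0; apply: contrapT => h.
(* The cofactors of [a] by powers of [t]: none is a unit, so each is divisible by [t] again, and the
   endless chain starting at [a] makes [a] zero. *)
pose T := {b : R | exists n, a = b * t ^+ n}.
have next (b : T) : {b' : T | sval b = t * sval b'}.
  apply: cid; case: b => b [n eb] /=.
  have [//|c ec] := princ b; first by move=> ub; apply: h; exists n, b.
  have hc : exists n, a = c * t ^+ n by exists n.+1; rewrite eb ec exprS mulrA.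
  by exists (exist _ c hc) => /=; rewrite mulrC.
have a1 : exists n, a = a * t ^+ n by exists 0%N; rewrite expr0 mulr1.
have [f [f0 fS]] := dependent_choice next (exist _ a a1).
have := divisible_chain0 (p := fun n => sval (f n)) locR noethR nt fS.
by rewrite f0.
Qed.

Lemma uniformizer_dvd t a : uniformizer t -> ~ is_unit a -> exists b, a = t * b.
Proof.
move=> [_ _ nt val] na.
have [->|/eqP a0] := eqVneq a 0; first by exists 0; rewrite mulr0.
have [[|n] [v [uv ea]]] := val a a0; first by case: na; rewrite ea mulr1.
by exists (v * t ^+ n); rewrite ea exprS mulrCA.
Qed.

(** Replaces sums of products by one multiple of t ^ r, so that congruences modulo a power of the
    maximal ideal have a single witness. *)
Lemma ideal_pow_nonunits (t : R) (M : lmodType R) r (u : M) : uniformizer t ->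
  ideal_pow (@nonunits R) M r u <-> exists v, u = t ^+ r *: v.
Proof.
move=> ht; have [dom t0 nt val] := ht.
elim: r u => [|r IH] u; first by split=> // _; exists u; rewrite scale1r.
split=> [[s hs <-]|[v ->]]; last first.
  exists [:: (t, t ^+ r *: v)]; last by rewrite big_seq1 scalerA -exprS.
  by move=> p; rewrite inE => /eqP-> /=; split=> //; apply/IH; exists v.
elim: s hs => [|p s IHs] hs; first by exists 0; rewrite big_nil scaler0.
have [|v ev] := IHs; first by move=> q qs; apply: hs; rewrite inE qs orbT.
have [|/(uniformizer_dvd ht)[b eb] /IH[w ew]] := hs p; first by rewrite inE eqxx.
exists (b *: w + v); rewrite big_cons ev eb ew scalerDr; congr (_ + _).
by rewrite !scalerA exprS; congr (_ *: _); ring.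
Qed.

End Units.

(** * Adic completions *)

(** Serves maps obtained by choice or as inverses, which exist only inside a proof. *)
Lemma ex_additive (U V : zmodType) (f : U -> V) :
  zmod_morphism f -> exists g : {additive U -> V}, g =1 f.
Proof.
move=> hf; pose m := GRing.isZmodMorphism.Build U V f hf.
by exists (HB.pack_for {additive U -> V} f m).
Qed.

Lemma ex_linear (R : pzRingType) (U V : lmodType R) (f : U -> V) :
  linear f -> exists g : {linear U -> V}, g =1 f.
Proof.
move=> hf; pose m := GRing.isLinear.Build R U V _ f hf.
by exists (HB.pack_for {linear U -> V} f m).
Qed.

Lemma bij_additive (U V : zmodType) (f : {additive U -> V}) : bijective f ->
  exists g : {additive V -> U}, cancel f g /\ cancel g f.
Proof.
move=> [g fK gK]; have [|h e] := @ex_additive _ _ g.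
  by move=> x y; apply: (can_inj fK); rewrite gK raddfB !gK.
by exists h; split=> x; rewrite e.
Qed.

Section CompletionTheory.
Variables (R : comPzRingType) (I : set R).

Lemma comp_map_is_additive (M N : lmodType R) (f : {linear M -> N}) :
  zmod_morphism (comp_map f : completion I M -> completion I N).
Proof. by move=> c d; apply: completionP => r /=; rewrite linearB. Qed.

HB.instance Definition _ (M N : lmodType R) (f : {linear M -> N}) :=
  GRing.isZmodMorphism.Build (completion I M) (completion I N) (comp_map f)
    (comp_map_is_additive f).

Lemma comp_map_comp (M N P : lmodType R) (f : {linear M -> N})
    (g : {linear N -> P}) (h : {linear M -> P}) (c : completion I M) :
  (forall u, h u = g (f u)) -> comp_map g (comp_map f c) = comp_map h c.
Proof.
move=> e; apply: completionP => r /=; have [u ->] := qpi_surj (c r).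
by rewrite !qmod_mapE e.
Qed.

Lemma comp_map_id (M : lmodType R) (f : {linear M -> M}) (c : completion I M) :
  f =1 id -> comp_map f c = c.
Proof.
move=> e; apply: completionP => r /=; have [u ->] := qpi_surj (c r).
by rewrite !qmod_mapE e.
Qed.

Lemma comp_map_to_comp (M N : lmodType R) (f : {linear M -> N}) u :
  comp_map f (to_comp I u) = to_comp I (f u).
Proof. by apply: completionP => r /=; rewrite qmod_mapE. Qed.

Lemma comp_map_bij (M N : lmodType R) (f : {linear M -> N}) :
  bijective f -> bijective (comp_map f : completion I M -> completion I N).
Proof.
move=> [g fK gK]; have [|h e] := @ex_linear R N M g.
  by move=> a x y; apply: (can_inj fK); rewrite gK linearP !gK.
by exists (comp_map h) => c; rewrite (@comp_map_comp _ _ _ _ _ idfun) ?comp_map_id // => u;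
  rewrite e ?fK ?gK.
Qed.

Lemma to_comp_is_additive (M : lmodType R) : zmod_morphism (to_comp I (M := M)).
Proof. by move=> u v; apply: completionP => r /=; rewrite linearB. Qed.

HB.instance Definition _ (M : lmodType R) :=
  GRing.isZmodMorphism.Build M (completion I M) (to_comp I (M := M))
    (@to_comp_is_additive M).

Lemma ideal_pow0 (M : lmodType R) r (u : M) :
  (forall a, I a -> a = 0) -> ideal_pow I M r.+1 u -> u = 0.
Proof.
move=> I0 [s hs <-]; elim: s hs => [|p s IH] hs; first by rewrite big_nil.
rewrite big_cons IH => [|q qs]; last by apply: hs; rewrite inE qs orbT.
have [|/I0-> _] := hs p; first by rewrite inE eqxx.
by rewrite scale0r addr0.
Qed.

Lemma to_comp_bij (M : lmodType R) :
  (forall a, I a -> a = 0) -> bijective (to_comp I (M := M)).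
Proof.
move=> I0; have qI r (u v : M) :
    qpi (ideal_pow I M r.+1) u = qpi (ideal_pow I M r.+1) v -> u = v.
  by move/qpi_eq/(ideal_pow0 I0)/eqP; rewrite subr_eq0 => /eqP.
(* Level 0 is the zero module; level 1 is the first at which nothing is divided out. *)
exists (fun c : completion I M => repr (c 1%N)) => [u|c].
  by apply/esym/(@qI 0%N)/qpi_eq; rewrite -opprB; apply: submodN; exact: repr_qpi.
have lvl r : c r.+1 = qpi (ideal_pow I M r.+1) (repr (c 1%N)).
  elim: r => [|r]; first by have [u ->] := qpi_surj (c 1%N);
    apply/esym/qpi_eq; exact: repr_qpi.
  rewrite -(comp_compat c r.+1); have [u ->] := qpi_surj (c r.+2).
  have -> : adic_trans I M r.+1 (qpi _ u) = qpi (ideal_pow I M r.+1) u.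
    exact: qmod_mapE.
  by move/qI->.
apply: completionP => -[|r]; last exact/esym/lvl.
have [u ->] := qpi_surj (c 0%N); apply/qpi_eq; exact: Logic.I.
Qed.

Lemma to_rcomp_is_additive : zmod_morphism (to_rcomp I).
Proof. by move=> a b; apply: completionP => r /=; rewrite linearB. Qed.

Lemma to_rcomp_is_multiplicative : monoid_morphism (to_rcomp I).
Proof.
split; first by apply: completionP.
by move=> a b; apply: completionP => r; rewrite /= adic_mulE.
Qed.

HB.instance Definition _ := GRing.isZmodMorphism.Build R (ring_completion I)
  (to_rcomp I) to_rcomp_is_additive.
HB.instance Definition _ := GRing.isMonoidMorphism.Build R (ring_completion I)
  (to_rcomp I) to_rcomp_is_multiplicative.

(** Proportionality of two maps without division: it will compare trivializations of the stalks of
    different sheaves, whose ratio need not lie in [R]. *)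
Lemma comp_map_scale (M : lmodType R) (f g : {linear M -> R^o}) (a b : R)
    (c : completion I M) : (forall u, a * f u = b * g u :> R) ->
  to_rcomp I a * comp_map f c = to_rcomp I b * comp_map g c :> ring_completion I.
Proof.
move=> e; apply: completionP => r /=; have [u ->] := qpi_surj (c r).
by rewrite !qmod_mapE !adic_mulE e.
Qed.

End CompletionTheory.

(** * Completion of a discrete valuation ring *)

Section DvrCompletion.
Variables (R : comPzRingType) (t : R).
Hypothesis ht : uniformizer t.
Let I := @nonunits R.
Let hatR := ring_completion I.
Let q r := qpi (ideal_pow I R^o r).
Let tt : hatR := to_rcomp I t.

Lemma uniformizer_domain : integral_domain R. Proof. by case: ht. Qed.

Lemma domain_mulI (a b c : R) : a <> 0 -> a * b = a * c -> b = c.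
Proof.
move=> a0 /eqP; rewrite -subr_eq0 -mulrBr => /eqP e.
have [_ /(_ _ _ e)[//|/eqP]] := uniformizer_domain.
by rewrite subr_eq0 => /eqP.
Qed.

Lemma uniformizerX_neq0 n : t ^+ n <> 0.
Proof.
have [[one0 dom] t0 _ _] := ht.
by elim: n => [//|n IH]; rewrite exprS => /dom[].
Qed.

Lemma quo_eq r (a b : R) : q r a = q r b <-> exists v, a - b = t ^+ r * v.
Proof.
split=> [/qpi_eq/(ideal_pow_nonunits _ _ ht)//|h].
exact/qpi_eq/(ideal_pow_nonunits _ _ ht).
Qed.

Lemma rcomp_lift (c : hatR) : exists s : nat -> R,
  (forall r, c r = q r (s r)) /\
  forall r k, exists v, s (r + k)%N - s r = t ^+ r * v.
Proof.
have /choice[s hs] r : exists a, c r = q r a by exact: qpi_surj.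
exists s; split=> // r k; apply/quo_eq.
elim: k => [|k IH]; first by rewrite addn0.
rewrite -IH; apply/quo_eq.
have /quo_eq[v ev] : q (r + k)%N (s (r + k.+1)%N) = q (r + k)%N (s (r + k)%N).
  rewrite -hs -(comp_compat c) addnS hs; exact/esym/qmod_mapE.
by exists (t ^+ k * v); rewrite mulrA -exprD.
Qed.

Lemma ex_rcomp (s : nat -> R) :
  (forall r, exists v, s r.+1 - s r = t ^+ r * v) ->
  exists c : hatR, forall r, c r = q r (s r).
Proof.
move=> hs; have h r : adic_trans I R^o r (q r.+1 (s r.+1)) = q r (s r).
  by apply: etrans; [exact: qmod_mapE|apply/quo_eq; exact: hs].
by exists (@Completion R I R^o (fun r => q r (s r)) h).
Qed.

Lemma rcomp_mulq (c d : hatR) r a b :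
  c r = q r a -> d r = q r b -> (c * d) r = q r (a * b).
Proof.
move=> hc hd; rewrite -[LHS]/(adic_mul (c r) (d r)) hc hd; exact: adic_mulE.
Qed.

Lemma tt_exp n r : (tt ^+ n) r = q r (t ^+ n).
Proof. by rewrite -rmorphXn. Qed.

(** The kernel of the projection to level n is generated by t ^ n, which lets divisibility and
    convergence be read off the levels. *)
Lemma rcomp_dvd n (c : hatR) : c n = 0 <-> exists d, c = tt ^+ n * d.
Proof.
split=> [cn0|[d ->]]; last first.
  have [s [hs _]] := rcomp_lift d; rewrite (rcomp_mulq (tt_exp n n) (hs n)).
  rewrite -[RHS](linear0 (qpi _)); apply/quo_eq; exists (s n); exact: subr0.
have [s [hs hsS]] := rcomp_lift c.
have /quo_eq[w ew] : q n (s n) = q n 0 by rewrite -hs cn0; exact/esym/linear0.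
(* Division by t ^ n costs n levels: the quotient at level r comes from the representative at level
   n + r. *)
have /choice[b eb] r : exists b, s (n + r)%N = t ^+ n * b.
  have [v ev] := hsS n r; exists (v + w).
  by rewrite mulrDr -ev -ew subr0 subrK.
have [r|d hd] := ex_rcomp (s := b).
  have [v ev] := hsS (n + r)%N 1%N; exists v; apply: (domain_mulI (@uniformizerX_neq0 n)).
  by rewrite mulrBr -!eb mulrA -exprD -ev addn1 addnS.
exists d; apply: completionP => r; rewrite (rcomp_mulq (tt_exp n r) (hd r)) hs.
by apply/esym/quo_eq; rewrite -eb addnC; exact: hsS.
Qed.

Lemma rcomp_unit (c : hatR) : c 1%N <> 0 -> is_unit c.
Proof.
move=> c1; have [s [hs hsS]] := rcomp_lift c.
(* The representative at level 0 is arbitrary, so the units start at index 1 and [w r] inverts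
   [s r.+1]. *)
have us r : is_unit (s r.+1).
  apply: contrapT => /(uniformizer_dvd ht)[b eb]; apply: c1; rewrite hs.
  rewrite -[RHS](linear0 (qpi _)); apply/quo_eq; have [v ev] := hsS 1%N r.
  exists (b - v); rewrite expr1 mulrBr -eb; move: ev; rewrite expr1 add1n => <-.
  by rewrite subr0 opprB addrC subrK.
have /choice[w ew] := us.
have [r|d hd] := ex_rcomp (s := w).
  have [v] := hsS r.+1 1%N; rewrite addn1 => ev.
  (* This is 1/y - 1/x = -(y - x)/(x y): the inverses converge because the representatives do. *)
  have -> : w r.+1 - w r = - (s r.+2 - s r.+1) * w r * w r.+1.
    by move: (ew r) (ew r.+1) => e0 e1; ring: e0 e1.
  by exists (- (t * v * w r * w r.+1)); rewrite ev exprS; ring.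
exists d; apply: completionP => r; rewrite (rcomp_mulq (hs r) (hd r)).
apply/quo_eq; have [v] := hsS r 1%N; rewrite addn1 => ev; exists (- (v * w r)).
suff : s r * w r - 1 = t ^+ r * - (v * w r) by [].
by rewrite -[1](ew r) -[s r.+1](subrK (s r)) ev; ring.
Qed.

(** A nonzero difference is a unit times t ^ n for some n, and it survives at level n + 1. *)
Lemma to_rcomp_inj : injective (to_rcomp I).
Proof.
move=> a b /eqP; rewrite -subr_eq0 -raddfB => /eqP e; apply/eqP.
rewrite -subr_eq0; apply/eqP; apply: contrapT => ab0.
have [_ _ nt val] := ht; have [n [u [uu eu]]] := val _ ab0.
have : q n.+1 (a - b) = q n.+1 0 by move: (congr1 (fun c : hatR => c n.+1) e).
move=> /quo_eq[v]; rewrite subr0 eu exprS mulrC -mulrA mulrCA => ev.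
apply: nt; have := domain_mulI (@uniformizerX_neq0 n) ev.
by move=> uv; move: uu; rewrite uv; exact: is_unitMl.
Qed.

Lemma rcomp_factor (c : hatR) : c <> 0 ->
  exists n u, is_unit u /\ c = u * tt ^+ n.
Proof.
move=> c0; have [n cn0] : exists n, c n <> 0.
  apply: contrapT => h; apply: c0; apply: completionP => r.
  by apply: contrapT => cr; apply: h; exists r.
have ex : exists n, `[< c n <> 0 >] by exists n; exact/asboolP.
(* The least level with nonzero image exceeds the valuation by one; it is not level 0, which is the
   zero module. *)
case: (ex_minnP ex) => -[|m] /asboolP cm0 minm.
  have [u eu] := qpi_surj (c 0%N); case: cm0; rewrite eu -[RHS](linear0 (qpi _)).
  apply/qpi_eq; exact: Logic.I.
have /rcomp_dvd[d ed] : c m = 0.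
  by apply: contrapT => /asboolP/minm; rewrite ltnn.
exists m, d; split; last by rewrite mulrC.
apply: rcomp_unit => d1; have /rcomp_dvd[d' ed'] := d1.
by apply: cm0; apply/rcomp_dvd; exists d'; rewrite ed ed' expr1 exprSr mulrA.
Qed.

Lemma rcomp_domain : integral_domain hatR.
Proof.
have [[one0 _] _ nt _] := ht.
have one0' : (1 : hatR) <> 0.
  by move=> e; apply: one0; apply: to_rcomp_inj; rewrite rmorph1 rmorph0.
split=> // a b ab0; apply: contrapT => /not_orP[a0 b0].
have [n [u [[u' uu'] ea]]] := rcomp_factor a0.
have [m [v [[v' vv'] eb]]] := rcomp_factor b0.
apply: (@uniformizerX_neq0 (n + m)); apply: to_rcomp_inj.
rewrite rmorph0 rmorphXn -/tt exprD.
have : u' * v' * (a * b) = 0 by rewrite ab0 mulr0.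
rewrite ea eb => <-.
transitivity ((u * u') * (v * v') * (tt ^+ n * tt ^+ m)); last by ring.
by rewrite uu' vv' !mul1r.
Qed.

Lemma complete_dvr_completion : complete_dvr hatR.
Proof.
split; first exact: rcomp_domain.
have [_ t0 nt _] := ht; exists tt; split.
- by move=> e; apply: t0; apply: to_rcomp_inj; rewrite rmorph0.
- move=> [d ed]; have [s [hs _]] := rcomp_lift d.
  have /quo_eq[v] : q 1%N (t * s 1%N) = q 1%N 1.
    by rewrite -(rcomp_mulq (erefl : tt 1%N = q 1%N t) (hs 1%N)) ed.
  rewrite expr1 => ev; apply: nt; exists (s 1%N - v).
  by rewrite mulrBr -ev opprB addrC subrK.
- exact: rcomp_factor.
(* The limit is the diagonal family: at level r, the term [s r], with which all later terms agree at
   that level. *)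
- move=> s hs; have compat r : adic_trans I R^o r (s r.+1 r.+1) = s r r.
    rewrite comp_compat; apply/eqP; rewrite -subr_eq0; apply/eqP.
    exact/(rcomp_dvd r (s r.+1 - s r)).
  exists (Completion compat); split=> [n|l' hl'].
    by apply/rcomp_dvd; rewrite /= subrr.
  apply: completionP => r /=; have /rcomp_dvd/eqP := hl' r.
  by rewrite /= subr_eq0 => /eqP.
Qed.

End DvrCompletion.

(** * Points, primes and generizations *)

Lemma closure1P (X : topologicalType) (x y : X) :
  closure [set x] y <-> forall V : opens X, V y -> V x.
Proof.
split=> [h V Vy|h B]; last first.
  rewrite nbhsE => -[W [oW Wy] WB]; exists x; split=> //.
  by apply: WB; exact: (h (Opens oW)).
have [|z [-> //]] := h V; apply: open_nbhs_nbhs; split=> //; exact: opens_open.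
Qed.

(** * Maps of local rings along generizations *)

Section Cospecialization.
Variables (X : ringed_space) (x y : X).
Hypothesis xy : forall V : opens X, V x -> V y.

Definition cosp (a : lring x) : lring y :=
  rgerm (xy (pg_in (repr a))) (pg_sec (repr a)).

Lemma cospE (V : opens X) (hx : V x) (hy : V y) (s : 'O_X V) :
  cosp (rgerm hx s) = rgerm hy s.
Proof.
rewrite /cosp; move: (repr_germ (F := ab_of_ring 'O_X) hx s).
rewrite -![@germ _ (ab_of_ring 'O_X) _ _ hx s]/(rgerm hx s).
case: (repr _) => P hP p /= /germ_eq[W [h [k [Wx e]]]].
by rewrite -(rgerm_res h _ (xy Wx)) [X in rgerm _ X]e rgerm_res.
Qed.

Lemma cosp_is_additive : zmod_morphism cosp.
Proof.
move=> a b; have [U [hU [s [t [-> ->]]]]] := stalk_surj2 a b.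
rewrite -!/(rgerm _ _) -raddfB.
by rewrite !(cospE hU (xy hU)) raddfB.
Qed.

Lemma cosp_is_multiplicative : monoid_morphism cosp.
Proof.
have hx : opensT X x by []; have hy : opensT X y by [].
split; first by rewrite -(rmorph1 (rgerm hx)) (cospE hx hy) rmorph1.
move=> a b; have [U [hU [s [t [-> ->]]]]] := stalk_surj2 a b.
rewrite -!/(rgerm _ _) -rmorphM.
by rewrite !(cospE hU (xy hU)) rmorphM.
Qed.

HB.instance Definition _ := GRing.isZmodMorphism.Build (lring x) (lring y) cosp
  cosp_is_additive.
HB.instance Definition _ := GRing.isMonoidMorphism.Build (lring x) (lring y) cosp
  cosp_is_multiplicative.

End Cospecialization.

Lemma sheaf_ext (X : topologicalType) (F : ab_presheaf X) (U : opens X)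
    (s t : F U) : is_sheaf F ->
  (forall x (h : U x), germ h s = germ h t) -> s = t.
Proof.
move=> shF st.
have /choice[W hW] (i : {x | U x}) : exists W : opens X, exists h : W `<=` U,
    W (sval i) /\ ab_res F h s = ab_res F h t.
  case: i => x hx; have /germ_eq[W [h [k [Wx e]]]] := st x hx.
  by exists W, h; split=> //; rewrite e (Prop_irrelevance k h).
have hWU i : W i `<=` U by case: (hW i).
have [||u [_ uniq]] := shF U {x | U x} W hWU _ (fun i => ab_res F (hWU i) t).
- by move=> x hx; exists (exist _ x hx) => //; case: (hW (exist _ x hx)) => ? [].
- by move=> i j V hi hj; rewrite !(ab_res_comp _ _ (subset_trans hi (hWU i))).
rewrite -(uniq t) // -(uniq s) // => i; case: (hW i) => h [_].
by rewrite (Prop_irrelevance h (hWU i)).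
Qed.

(** * Affine charts: fractions, primes and specialization *)

Section AffineOpen.
Variables (X : ringed_space) (U : opens X).
Hypothesis aU : affine U.

(** A germ is a fraction g / f with f invertible at x: shrink to a basic open set inside its domain
    and use that sections there form a localization. *)
Lemma affine_germ x (hx : U x) (a : lring x) : exists f g : 'O_X U,
  is_unit (rgerm hx f) /\ rgerm hx f * a = rgerm hx g.
Proof.
have [_ _ _ basis [_ loc]] := aU; have [V [hV [s ->]]] := stalk_surj a.
have [|//|f [fx fV]] := basis (opensI U V) x; first by move=> ? [].
have fV' : basic_open f `<=` V by move=> y /fV[].
have [/(_ (rg_res 'O_X fV' s))[n [m em]] _] := loc f.
have ux : is_unit (rgerm hx f).
  by case: fx => k; rewrite (Prop_irrelevance k hx).
exists (f ^+ n), m; rewrite rmorphXn; split; first exact: is_unitX.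
transitivity (rgerm fx (rg_res 'O_X (@basic_open_sub _ U f) f ^+ n * rg_res 'O_X fV' s)).
  rewrite rmorphM rmorphXn /=.
  by rewrite (rgerm_res _ hx fx) (rgerm_res _ hV fx).
rewrite -(rgerm_res (@basic_open_sub _ U f) hx fx m).
exact: (congr1 (rgerm fx) (esym em)).
Qed.

Section Pullback.
Variables (x : X) (hx : U x).

Definition pull (P : set (lring x)) : set ('O_X U) := [set f | P (rgerm hx f)].

Lemma pull_prime P : is_prime_ideal P -> is_prime_ideal (pull P).
Proof.
move=> [[P0 PD PM] P1 pr]; rewrite /pull; split=> [||a b] /=.
- split=> [|a b|a b] /=; rewrite ?raddf0 ?raddfD ?rmorphM //.
    exact: PD.
  exact: PM.
- by rewrite rmorph1.
- by rewrite rmorphM; exact: pr.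
Qed.

(** Each germ is a fraction with invertible denominator, so numerators decide membership in an
    ideal. *)
Lemma pull_sub P Q : is_prime_ideal P -> is_prime_ideal Q ->
  pull P `<=` pull Q -> P `<=` Q.
Proof.
move=> [[_ _ PM] _ _] [[_ _ QM] _ _] PQ a Pa.
have [f [g [[b fb] fa]]] := affine_germ hx a.
rewrite -[a]mul1r -fb [_ * b]mulrC -mulrA fa; apply: QM.
by apply: PQ; rewrite /pull /= -fa; exact: PM.
Qed.

Lemma prime_point P : is_prime_ideal P ->
  exists y (hy : U y), vanishing hy = pull P.
Proof. by move=> /pull_prime prP; have [_ _ + _ _] := aU; exact. Qed.

End Pullback.

(** Both sides say that a basic open set containing [z] contains [y]; the smaller ideal belongs to
    the more generic point. *)
Lemma vanishing_closure y z (hy : U y) (hz : U z) :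
  vanishing hy `<=` vanishing hz <-> closure [set y] z.
Proof.
have [_ _ _ basis _] := aU; split=> [h|/closure1P h f /= nu].
  apply/closure1P => V Vz; have [|//|f [[k fz] fV]] := basis (opensI U V) z.
    by move=> ? [].
  have [] // : opensI U V y.
  apply: fV; exists hy; apply: contrapT => /h; apply.
  by rewrite (Prop_irrelevance hz k).
move=> fz; apply: nu; have [k fy] : basic_open f y by apply: h; exists hz.
by rewrite (Prop_irrelevance hy k).
Qed.

End AffineOpen.

Lemma prime_chain_le (R : comPzRingType) m n : (m <= n)%N ->
  prime_chain R n -> prime_chain R m.
Proof.
move=> mn [P [prP ltP]]; exists P; split=> i im; first exact/prP/(leq_trans im).
exact/ltP/(leq_trans im).
Qed.

(** * Chains of primes and chains of closed sets *)

Section Points.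
Variable X : scheme.

Lemma closure_antisym (x y : X) :
  closure [set x] y -> closure [set y] x -> x = y.
Proof.
move=> xy yx; have [U Ux aU] := sch_affine x.
have Uy : U y by move/closure1P: yx; exact.
have [_ inj _ _ _] := aU; apply: (inj x y Ux Uy); apply/seteqP.
by split; exact/(vanishing_closure aU).
Qed.

Lemma closure1_irreducible (x : X) : irreducible_set (closure [set x]).
Proof.
split; first by exists x; exact: subset_closure.
move=> C D cC cD h; have : (C `|` D) x by apply: h; exact: subset_closure.
have sub B : closed B -> B x -> closure [set x] `<=` B.
  by move=> cB Bx; rewrite [X in _ `<=` X](closure_id B).1 //; apply: closure_subset => _ ->.
by move=> [/sub|/sub]; [left|right]; auto.
Qed.

Lemma closure_chain (y : nat -> X) n :
  (forall i, (i < n)%N -> closure [set y i.+1] (y i) /\ y i.+1 <> y i) ->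
  irreducible_chain X n.
Proof.
move=> h; exists (fun i => closure [set y i]); split=> i lin.
  by split; [exact: closed_closure|exact: closure1_irreducible].
have [yi ne] := h i lin; rewrite properEneq; split; last first.
  rewrite [X in _ `<=` X](closure_id _).1; last exact: closed_closure.
  by apply: closure_subset => _ ->.
apply/eqP => e; apply: ne; apply: closure_antisym => //.
by rewrite e; exact: subset_closure.
Qed.

(* Primes of the local ring at x are generizations of x. *)
Lemma prime_chain_points (x : X) n :
  prime_chain (lring x) n -> irreducible_chain X n.
Proof.
move=> [P [prP ltP]]; have [U Ux aU] := sch_affine x.
have ex i : exists y, (i <= n)%N -> exists hy : U y, vanishing hy = pull Ux (P i).
  have [lin|] := leqP i n; last by exists x.
  by have [y [hy e]] := prime_point aU Ux (prP i lin); exists y => _; exists hy.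
have [y hy] := choice ex.
(* A larger prime has a smaller closure, so the points are listed backwards. *)
apply: (@closure_chain (fun i => y (n - i)%N)) => i lin.
have [j ej] : exists j, (n - i)%N = j.+1.
  by exists (n - i).-1; rewrite prednK // subn_gt0.
have -> : (n - i.+1)%N = j by rewrite subnS ej.
have ljn : (j < n)%N by rewrite -ej leq_subr.
rewrite ej; have [h1 e1] := hy j (ltnW ljn); have [h2 e2] := hy j.+1 ljn.
have := ltP j ljn; rewrite properEneq => -[/eqP ne sub]; split.
  by apply/(vanishing_closure aU h1 h2); rewrite e1 e2 => f /sub.
move=> e; apply: ne; move: h1 h2 e1 e2; rewrite e => h1 h2 e1 e2.
have e12 : pull Ux (P j) = pull Ux (P j.+1).
  by rewrite -e1 -e2 (Prop_irrelevance h1 h2).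
by apply/seteqP; split; apply: (pull_sub aU (hx := Ux));
  rewrite ?e12 //; apply: prP => //; exact: ltnW.
Qed.

End Points.

(** * Subsheaves and direct limits *)

Section SubLmodule.
Variables (R : comPzRingType) (M : lmodType R) (N : submod M).

Definition submod_pred : {pred M} := fun u => `[< N u >].

Lemma submod_predP u : reflect (N u) (u \in submod_pred).
Proof. exact: asboolP. Qed.

Lemma submod_pred_closed : subsemimod_closed submod_pred.
Proof.
split; first split.
- by apply/submod_predP; exact: submod0.
- by move=> u v /submod_predP hu /submod_predP hv; apply/submod_predP; exact: submodD.
- by move=> a u /submod_predP hu; apply/submod_predP; exact: submodZ.
Qed.

HB.instance Definition _ := GRing.isSubmodClosed.Build R M submod_pred submod_pred_closed.

Record sub_lmod := SubLmod { sub_lmod_val : M; _ : sub_lmod_val \in submod_pred }.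

HB.instance Definition _ := [isSub for sub_lmod_val].
HB.instance Definition _ := [Choice of sub_lmod by <:].
HB.instance Definition _ := [SubChoice_isSubLmodule of sub_lmod by <:].

Lemma sub_lmodP (u : sub_lmod) : N (val u).
Proof. exact/submod_predP/(valP u). Qed.

Definition to_sub_lmod u (h : N u) : sub_lmod := SubLmod (introT (submod_predP u) h).

End SubLmodule.

Section Subsheaf.
Variables (X : ringed_space) (M : omod X) (P : forall U : opens X, submod (M U)).
Arguments P : clear implicits.
Hypothesis P_res : forall (U V : opens X) (h : V `<=` U) s,
  P U s -> P V (pm_res M h s).
Hypothesis P_local : forall (U : opens X) s,
  (forall x, U x -> exists (V : opens X) (h : V `<=` U), V x /\ P V (pm_res M h s)) ->
  P U s.

Definition subsheaf_res (U V : opens X) (h : V `<=` U) (s : sub_lmod (P U)) :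
  sub_lmod (P V) := to_sub_lmod (P_res h (sub_lmodP s)).

Lemma subsheaf_res_is_additive (U V : opens X) (h : V `<=` U) :
  zmod_morphism (subsheaf_res h).
Proof. by move=> s t; apply: val_inj; rewrite /= raddfB. Qed.

HB.instance Definition _ (U V : opens X) (h : V `<=` U) :=
  GRing.isZmodMorphism.Build (sub_lmod (P U)) (sub_lmod (P V)) (subsheaf_res h)
    (subsheaf_res_is_additive h).

Lemma subsheaf_res_id (U : opens X) (h : U `<=` U) s : subsheaf_res h s = s.
Proof. by apply: val_inj; exact: pm_res_id. Qed.

Lemma subsheaf_res_comp (U V W : opens X) (h : V `<=` U) (k : W `<=` V)
  (l : W `<=` U) s : subsheaf_res k (subsheaf_res h s) = subsheaf_res l s.
Proof. by apply: val_inj; exact: pm_res_comp. Qed.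

Lemma subsheaf_resZ (U V : opens X) (h : V `<=` U) a s :
  subsheaf_res h (a *: s) = rg_res 'O_X h a *: subsheaf_res h s.
Proof. by apply: val_inj; exact: pm_resZ. Qed.

Definition subsheaf_pre : premod X :=
  Premod subsheaf_res_id subsheaf_res_comp subsheaf_resZ.

Lemma subsheaf_is_sheaf : is_sheaf (ab_of_mod subsheaf_pre).
Proof.
move=> U I V h cov s glue.
have [|t [et uniq]] := @om_is_sheaf _ M U I V h cov (fun i => val (s i)).
- by move=> i j W hi hj; exact: (congr1 val (glue i j W hi hj)).
have Pt : P U t.
  apply: P_local => x /cov[i _ Vx]; exists (V i), (h i); split=> //.
  by rewrite [pm_res _ _ _]et; exact: sub_lmodP.
exists (to_sub_lmod Pt); split=> [i|t' et'].
  by apply: val_inj; exact: et i.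
by apply: val_inj; apply: uniq => i; exact: (congr1 val (et' i)).
Qed.

Definition subsheaf : omod X := Omod subsheaf_is_sheaf.

Definition subsheaf_val (U : opens X) : subsheaf U -> M U := val.

Lemma subsheaf_val_is_linear U : linear (@subsheaf_val U).
Proof. by []. Qed.

HB.instance Definition _ U := GRing.isLinear.Build ('O_X U) (subsheaf U) (M U) _
  (@subsheaf_val U) (@subsheaf_val_is_linear U).

Lemma subsheaf_val_res (U V : opens X) (h : V `<=` U) s :
  subsheaf_val (pm_res subsheaf h s) = pm_res M h (subsheaf_val s).
Proof. by []. Qed.

Definition subsheaf_incl : mhom subsheaf M :=
  @Mhom _ subsheaf M (fun U => @subsheaf_val U) subsheaf_val_res.

Lemma subsheaf_incl_mono : mhom_mono subsheaf_incl.
Proof. by move=> U; exact: val_inj. Qed.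

Section Lift.
Variables (L : omod X) (f : mhom L M).
Hypothesis fP : forall U s, P U (f U s).

Definition subsheaf_lift_fun U (s : L U) : subsheaf U := to_sub_lmod (fP s).

Lemma subsheaf_lift_is_linear U : linear (@subsheaf_lift_fun U).
Proof. by move=> a s t; apply: val_inj; rewrite /= linearP. Qed.

HB.instance Definition _ U := GRing.isLinear.Build ('O_X U) (L U) (subsheaf U) _
  (@subsheaf_lift_fun U) (@subsheaf_lift_is_linear U).

Lemma subsheaf_lift_res (U V : opens X) (h : V `<=` U) s :
  subsheaf_lift_fun (pm_res L h s) = pm_res subsheaf h (subsheaf_lift_fun s).
Proof. by apply: val_inj; exact: mh_res. Qed.

Definition subsheaf_lift : mhom L subsheaf :=
  @Mhom _ L subsheaf (fun U => @subsheaf_lift_fun U) subsheaf_lift_res.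

End Lift.

End Subsheaf.

Section SectionMap.
Variables (X : ringed_space) (N : omod X) (s : N (opensT X)).
Implicit Types U V : opens X.

Lemma opensT_sub U : U `<=` opensT X.
Proof. exact: subsetT. Qed.

(** The map that takes 1 to [s]; it later removes the choice of the coherent subsheaf from the
    diagonal map. *)
Definition section_map_fun U (a : OX X U) : N U := (a : 'O_X U) *: pm_res N (@opensT_sub U) s.

Lemma section_map_is_linear U : linear (@section_map_fun U).
Proof. by move=> c a b; rewrite /section_map_fun scalerDl scalerA. Qed.

HB.instance Definition _ U := GRing.isLinear.Build ('O_X U) (OX X U) (N U) _
  (@section_map_fun U) (@section_map_is_linear U).

Lemma section_map_res (U V : opens X) (h : V `<=` U) a :
  section_map_fun (pm_res (OX X) h a) = pm_res N h (section_map_fun a).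
Proof. by rewrite /section_map_fun pm_resZ (pm_res_comp _ _ (@opensT_sub V)). Qed.

Definition section_map : mhom (OX X) N :=
  @Mhom _ (OX X) N (fun U => @section_map_fun U) section_map_res.

Lemma section_mapE U (a : OX X U) :
  section_map U a = (a : 'O_X U) *: pm_res N (@opensT_sub U) s.
Proof. by []. Qed.

End SectionMap.

Section MonoLimit.
Variables (X : scheme) (D : direct_system X) (M : qcoh X)
  (c : forall i, mhom (D i) M).
Hypotheses (c_cocone : is_cocone c) (c_mono : forall i, mhom_mono (c i))
  (c_surj : forall (U : opens X) (s : M U), exists i t, c i U t = s).

(** Two representatives of one section meet in a common stage, where injectivity makes them equal.
    [c_surj] provides a single stage for each section, not one near each point, so the limit map is
    defined on sections without gluing. *)
Lemma mono_direct_limit : is_direct_limit c.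
Proof.
split=> // N g g_cocone.
have glue (U : opens X) i j (s : D i U) (t : D j U) :
    c i U s = c j U t -> g i U s = g j U t.
  move=> e; have [k [hi hj]] := ds_directed i j.
  rewrite -(g_cocone _ _ hi) -(g_cocone _ _ hj) /=; congr (g k U _).
  apply: (@c_mono k U).
  by move: e; rewrite -(c_cocone hi) -(c_cocone hj).
have exF (U : opens X) : exists F : M U -> N U,
    forall s i t, c i U t = s -> F s = g i U t.
  have /choice[F hF] (s : M U) : exists y, forall i t, c i U t = s -> y = g i U t.
    have [i [t e]] := c_surj s; exists (g i U t) => j t' e'.
    by apply: glue; rewrite e e'.
  by exists F.
pose F U := sval (cid (exF U)).
have FE (U : opens X) i t : F U (c i U t) = g i U t.
  exact: (svalP (cid (exF U))).
have FP (U : opens X) : linear (F U).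
  move=> a s t; have [i [s' <-]] := c_surj s; have [j [t' <-]] := c_surj t.
  have [k [hi hj]] := ds_directed i j.
  have -> : c i U s' = c k U (ds_map hi U s') by rewrite -(c_cocone hi).
  have -> : c j U t' = c k U (ds_map hj U t') by rewrite -(c_cocone hj).
  by rewrite -linearP !FE linearP.
pose fU U : {linear M U -> N U} := sval (cid (ex_linear (FP U))).
have fUE U : fU U =1 F U := svalP (cid (ex_linear (FP U))).
have f_res (U V : opens X) (h : V `<=` U) s :
    fU V (pm_res M h s) = pm_res N h (fU U s).
  have [i [t <-]] := c_surj s.
  by rewrite !fUE -mh_res !FE mh_res.
exists (Mhom f_res); split=> [i|f' hf'].
  by apply: mhomP => U t; rewrite /= fUE FE.
apply: mhomP => U s; have [i [t <-]] := c_surj s.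
by rewrite /= fUE FE -(hf' i).
Qed.

End MonoLimit.

Lemma inj_surj_bij (T U : Type) (f : T -> U) :
  injective f -> (forall y, exists x, f x = y) -> bijective f.
Proof.
move=> inj /choice[g gK]; exists g => // x; exact/inj/gK.
Qed.

Lemma lring_OX_bij (X : ringed_space) (x : X) : bijective (@lring_OX X x).
Proof.
apply: inj_surj_bij => [a b|m].
  have [U [hU [s [t [-> ->]]]]] := stalk_surj2 a b.
  rewrite -!/(rgerm _ _) (lring_OXE hU s) (lring_OXE hU t) => /germ_eq h.
  exact/germ_eq.
by have [U [hU [s ->]]] := stalk_surj m; exists (rgerm hU s); exact: lring_OXE.
Qed.

(** * One-dimensional regular schemes *)

Section Curve.
Variables (X : scheme) (eta : X).
Hypotheses (X_regular : regular_scheme X) (X_dim1 : has_dimension X 1)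
  (eta_gen : generic_point eta).
Let K := lring eta.
Implicit Types U V : opens X.

Lemma closure_generic x : closure [set eta] x.
Proof. by rewrite eta_gen. Qed.

Lemma generic_in x V : V x -> V eta.
Proof. by move: V; apply/closure1P; exact: closure_generic. Qed.

Definition gsp x : {rmorphism lring x -> K} := cosp (@generic_in x).

Lemma gspE x V (hx : V x) (he : V eta) (s : 'O_X V) :
  gsp x (rgerm hx s) = rgerm he s.
Proof. exact: cospE. Qed.

Lemma local_lring (x : X) : local_ring (lring x).
Proof. by have [] := X_regular x. Qed.

Lemma noetherian_lring (x : X) : noetherian_ring (lring x).
Proof. by have [] := X_regular x. Qed.

Lemma lring_nonzero (x : X) : ~ is_unit (0 : lring x).
Proof. by have [h _ _] := local_lring x. Qed.

(** A prime of O_eta is a point that specializes to [eta], and only [eta] itself does; so all primes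
    of O_eta coincide. *)
Lemma K_prime_chain1 : ~ prime_chain K 1.
Proof.
move=> [P [prP ltP]]; have [U Ue aU] := sch_affine eta.
have eqv i : (i <= 1)%N -> pull Ue (P i) = vanishing Ue.
  move=> /prP pr; have [y [hy e]] := prime_point aU Ue pr.
  suff ye : y = eta.
    by rewrite -e; move: hy e; rewrite ye => hy _; rewrite (Prop_irrelevance hy Ue).
  apply: (closure_antisym _ (@closure_generic y)).
  apply/(vanishing_closure aU hy Ue); rewrite e => f Pf /= [b fb].
  by case: pr => -[_ _ PM] P1 _; apply: P1; rewrite -fb mulrC; exact: PM.
have /andP[] : (0 < 1)%N && (1 <= 1)%N by [].
move=> /ltP; rewrite properEneq => -[/eqP ne _] _; apply: ne.
by apply/seteqP; split; apply: (pull_sub aU (hx := Ue)); rewrite ?eqv //; exact: prP.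
Qed.

(** The Krull dimension is 0, so by regularity the maximal ideal is generated by no element at
    all. *)
Lemma K_unit (k : K) : k <> 0 -> is_unit k.
Proof.
move=> k0; apply: contrapT => nk; apply: k0.
have [_ _ [d [chain _] [g eg]]] := X_regular eta.
case: d chain g eg => [|d] chain g eg; last first.
  by case: K_prime_chain1; exact: prime_chain_le chain.
by have : ideal_gen g k by [rewrite -eg]; move=> [a _ <-]; rewrite big_ord0.
Qed.

Lemma K_mulI (a b c : K) : a <> 0 -> a * b = a * c -> b = c.
Proof. by move=> /K_unit; exact: is_unit_mulI. Qed.

Lemma K_one_neq0 : (1 : K) <> 0.
Proof. by move=> e; apply: (@lring_nonzero eta); rewrite -e; exact: is_unit1. Qed.

Lemma K_mul_neq0 (a b : K) : a <> 0 -> b <> 0 -> a * b <> 0.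
Proof.
move=> /K_unit ua /K_unit ub e; apply: (@lring_nonzero eta).
by rewrite -e; exact: is_unitM.
Qed.

Lemma K_unit_neq0 (a : K) : is_unit a -> a <> 0.
Proof. by move=> ua a0; apply: (@lring_nonzero eta); rewrite -a0. Qed.

(** Regularity gives as many generators as the Krull dimension, which is at most 1 by the dimension
    of X. It is not 0, as some nonunit has nonzero image in K; the one generator divides it, so it
    too lies outside the kernel of O_x -> K. *)
Lemma lring_uniformizer (x : X) : x <> eta ->
  (exists t : lring x, uniformizer t) /\ injective (gsp x).
Proof.
move=> xe; have [U Ux aU] := sch_affine x; have Ue := generic_in Ux.
(* As [x] does not specialize to [eta], some function vanishes at [x] and not at [eta]. *)
have [f nf uf] : exists2 f : 'O_X U, ~ is_unit (rgerm Ux f) & rgerm Ue f <> 0.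
  apply: contrapT => h; apply: xe; apply: (closure_antisym _ (@closure_generic x)).
  apply/(vanishing_closure aU Ux Ue) => f nf /= uf; apply: h.
  by exists f => //; exact: K_unit_neq0.
have sf : gsp x (rgerm Ux f) <> 0 by rewrite (gspE Ux Ue).
have [_ _ [d [chain _] [g eg]]] := X_regular x.
have d2 : (d < 2)%N.
  rewrite ltnNge; apply/negP => /prime_chain_le/(_ chain)/prime_chain_points.
  by case: X_dim1.
case: d d2 chain g eg => [|[|//]] _ _ g eg.
  have [a _ e] : ideal_gen g (rgerm Ux f) by rewrite -eg.
  by case: sf; rewrite -e big_ord0 rmorph0.
have princ := nonunits1_principal eg.
have [b eb] := princ _ nf.
have nt : ~ is_unit (g ord0).
  suff : @nonunits (lring x) (g ord0) by [].
  by rewrite eg; exact: ideal_gen_mem.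
have gt : gsp x (g ord0) <> 0 by move=> e; apply: sf; rewrite eb rmorphM e mulr0.
have [||ht kerP] := @uniformizer_of_prime _ (g ord0) [set a | gsp x a = 0]
  (@local_lring x) (@noetherian_lring x) princ nt.
- split=> [||a b'].
  + split=> [|a c e1 e2|a c e]; first exact: rmorph0.
      exact: etrans (rmorphD (gsp x) a c) (etrans (congr2 +%R e1 e2) (addr0 0)).
    exact: etrans (rmorphM (gsp x) a c) (etrans (congr1 ( *%R _) e) (mulr0 _)).
  + move=> e; apply: K_one_neq0; rewrite -(rmorph1 (gsp x)); exact: e.
  + move=> /= e; rewrite rmorphM in e; apply: contrapT => /not_orP[h1 h2].
    exact: K_mul_neq0 e.
- exact: gt.
split; first by exists (g ord0).
move=> a c /eqP; rewrite -subr_eq0 -rmorphB => /eqP e.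
have : [set a | gsp x a = 0] (a - c) by [].
by rewrite kerP => /eqP; rewrite subr_eq0 => /eqP.
Qed.

Lemma gsp_eta (a : K) : gsp eta a = a.
Proof. have [V [hV [s ->]]] := stalk_surj a; exact: (gspE hV hV). Qed.

Lemma gsp_inj x : injective (gsp x).
Proof.
have [->|xe] := pselect (x = eta); last by have [] := lring_uniformizer xe.
by move=> a b; rewrite !gsp_eta.
Qed.

Lemma eta_not_closed : ~ closed [set eta].
Proof.
move=> /closure_id; rewrite eta_gen => e.
have [[Z [irr lt]] _] := X_dim1.
have all x : x = eta by have : [set: X] x by []; rewrite -e.
have [_ [[y Zy] _]] := irr 0%N isT.
have [+ _] : Z 0%N `<` Z 1%N by exact: lt.
move=> _; have := lt 0%N isT; rewrite properEneq => -[/eqP ne sub]; apply: ne.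
apply/seteqP; split=> // z _; by rewrite (all z) -(all y).
Qed.

(** A further specialization z would give the chain of the closures of z, x and eta, which has
    length 2. *)
Lemma nongeneric_closed x : x <> eta -> closed [set x].
Proof.
move=> xe; suff -> : [set x] = closure [set x] by exact: closed_closure.
apply/seteqP; split=> [|z xz]; first exact: subset_closure.
apply: contrapT => zx; have [_ no_chain] := X_dim1; apply: no_chain.
apply: (@closure_chain X (fun i => if i is i'.+1 then if i' is _.+1 then eta else x else z)).
case=> [|[|//]] _ /=; first by split=> // e; apply: zx; rewrite /= e.
by split; [exact: (@closure_generic x)|move=> e; apply: xe].
Qed.

Lemma closed_neq_eta x : closed [set x] -> x <> eta.
Proof. by move=> cx e; apply: eta_not_closed; rewrite -e. Qed.

(** * Sections as elements of the function field *)

Lemma sect_ext V (s t : 'O_X V) :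
  (forall h : V eta, rgerm h s = rgerm h t) -> s = t.
Proof.
move=> e; apply: (sheaf_ext (F := ab_of_ring 'O_X) (@rs_is_sheaf X)) => x hx.
apply: (@gsp_inj x); have he := generic_in hx.
by apply: etrans (gspE hx he s) (etrans _ (esym (gspE hx he t))).
Qed.

(** The local ring O_x as a subset of K. *)
Definition reg x : set K := range (gsp x).

Lemma regD x a b : reg x a -> reg x b -> reg x (a + b).
Proof. by move=> [c _ <-] [d _ <-]; exists (c + d); rewrite ?rmorphD. Qed.

Lemma regM x a b : reg x a -> reg x b -> reg x (a * b).
Proof. by move=> [c _ <-] [d _ <-]; exists (c * d); rewrite ?rmorphM. Qed.

Lemma reg0 x : reg x 0.
Proof. by exists 0; rewrite ?rmorph0. Qed.

Lemma reg_sect V x (hx : V x) (he : V eta) (s : 'O_X V) : reg x (rgerm he s).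
Proof. by exists (rgerm hx s) => //; exact: gspE. Qed.

Lemma reg_unit V x (hx : V x) (he : V eta) (s : 'O_X V) k :
  is_unit (rgerm hx s) -> reg x (rgerm he s * k) -> reg x k.
Proof.
move=> [b sb] [c _ ec]; exists (b * c) => //.
by rewrite rmorphM ec -(gspE hx he) mulrA -rmorphM [b * _]mulrC sb rmorph1 mul1r.
Qed.

Lemma reg_eta k : reg eta k.
Proof. by exists k; rewrite ?gsp_eta. Qed.

(** With [sect_ext], this makes O_X(V) the intersection in K of the O_x for x in V: local lifts of
    [k] agree on overlaps because their generic germs do. *)
Lemma sect_glue V (he : V eta) k :
  (forall x, V x -> reg x k) -> exists s, rgerm he s = k.
Proof.
move=> regk.
have /choice[W hW] (i : {x | V x}) : exists W : {W : opens X & 'O_X W},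
    [/\ tag W `<=` V, tag W (sval i) & forall h : tag W eta, rgerm h (tagged W) = k].
  case: i => x hx /=; have [a _ <-] := regk x hx.
  have [W [Wx [s es]]] := stalk_surj a.
  exists (Tagged (fun W => 'O_X W) (rg_res 'O_X (@opensIr _ V W) s)) => /=.
  split; [exact: opensIl|by []|move=> h].
  rewrite es -[germ Wx s]/(rgerm Wx s) (gspE Wx (generic_in Wx)).
  exact: rgerm_res.
have hWV i : tag (W i) `<=` V by case: (hW i).
have [||s [es _]] := @rs_is_sheaf X V {x | V x} (fun i => tag (W i)) hWV _
    (fun i => tagged (W i)).
- by move=> x hx; exists (exist _ x hx) => //; case: (hW (exist _ x hx)).
- move=> i j U hi hj; apply: sect_ext => h; rewrite /=.
  have [_ _ ei] := hW i; have [_ _ ej] := hW j.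
  by rewrite (rgerm_res hi (hi _ h)) (rgerm_res hj (hj _ h)) ei ej.
exists s; have [_ Wi ei] := hW (exist _ eta he).
have := es (exist _ eta he) => /(congr1 (rgerm Wi)).
by rewrite ei => <-; rewrite /= (rgerm_res _ he).
Qed.

(** Clears denominators: [k] is a section over D(f), where sections form the localization of O(U) at
    f. If [f] is 0 at [eta], then D(f) misses [eta] and the product is simply 0. *)
Lemma affine_den U (Ue : U eta) (f : 'O_X U) k : affine U ->
  (forall x, basic_open f x -> reg x k) ->
  exists n m, rgerm Ue f ^+ n * k = rgerm Ue m.
Proof.
move=> aU regk; have [f0|fe] := pselect (rgerm Ue f = 0).
  by exists 1%N, 0; rewrite f0 expr1 mul0r raddf0.
have De : basic_open f eta by exists Ue; exact: K_unit.
have [s es] := sect_glue De regk; have [_ _ _ _ [_ loc]] := aU.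
have [/(_ s)[n [m em]] _] := loc f; exists n, m.
rewrite -(rgerm_res (@basic_open_sub _ U f) Ue De m).
have -> : rgerm De (rg_res 'O_X (@basic_open_sub _ U f) m) =
   rgerm De (rg_res 'O_X (@basic_open_sub _ U f) f ^+ n * s) by exact: congr1 em.
by rewrite rmorphM rmorphXn /= es (rgerm_res _ Ue).
Qed.

Lemma vanishing_prime V x (hx : V x) : is_prime_ideal (vanishing hx).
Proof.
have [[P0 PD PM] P1 pr] := local_nonunits_prime (@local_lring x).
rewrite /vanishing; split=> [||a b] /=.
- split=> [|a b|a b] /=; rewrite ?raddf0 ?raddfD ?rmorphM //.
    exact: PD.
  exact: PM.
- by rewrite rmorph1.
- by rewrite rmorphM; exact: pr.
Qed.

Lemma sect_unit V (s : 'O_X V) :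
  (forall x (h : V x), is_unit (rgerm h s)) -> is_unit s.
Proof.
move=> us; have [he|ne] := pselect (V eta); last first.
  by exists 0; apply: sect_ext => he; case: ne.
have [k sk] := us eta he; have [|s' es'] := @sect_glue V he k.
  move=> x hx; apply: (reg_unit (he := he) (us x hx)).
  by rewrite sk; exists 1; rewrite ?rmorph1.
exists s'; apply: sect_ext => h.
by rewrite rmorphM rmorph1 /= (Prop_irrelevance h he) es'.
Qed.

(** This allows charts to be shrunk. Functions on D(f) are fractions m / f ^ n with m on U, which
    carries primes, basic open sets and localizations from U to D(f). *)
Lemma affine_basic U (f : 'O_X U) :
  affine U -> basic_open f eta -> affine (basic_open f).
Proof.
move=> aU De; pose W := basic_open f; pose WU : W `<=` U := @basic_open_sub _ U f.
have Ue : U eta by exact: WU.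
have [_ inj surj basis [funit loc]] := aU.
have van y (hy : W y) (Uy : U y) (g : 'O_X U) :
    rgerm hy (rg_res 'O_X WU g) = rgerm Uy g by exact: rgerm_res.
have uf y (Uy : U y) : W y -> is_unit (rgerm Uy f).
  by move=> [k]; rewrite (Prop_irrelevance k Uy).
have num (s : 'O_X W) : exists n m,
    rg_res 'O_X WU m = rg_res 'O_X WU f ^+ n * s.
  by have [/(_ s)[n [m em]] _] := loc f; exists n, m; exact: em.
split; [by move=> y hy; exact: vanishing_prime| | | |split].
- move=> y z hy hz e; apply: (inj y z (WU _ hy) (WU _ hz)).
  apply/seteqP; split=> g /= ng.
    have : vanishing hy (rg_res 'O_X WU g) by rewrite /vanishing /= (van _ _ (WU _ hy)).
    by rewrite e /vanishing /= (van _ _ (WU _ hz)).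
  have : vanishing hz (rg_res 'O_X WU g) by rewrite /vanishing /= (van _ _ (WU _ hz)).
  by rewrite -e /vanishing /= (van _ _ (WU _ hy)).
- move=> P prP; have [[P0 PD PM] P1 pr] := prP.
  have [|y [Uy e]] := surj [set g | P (rg_res 'O_X WU g)].
    split=> [||a b] /=; rewrite ?rmorph1 ?rmorphM //; last exact: pr.
    split=> [|a b|a b] /=; rewrite ?raddf0 ?raddfD ?rmorphM //; first exact: PD.
    exact: PM.
  have nPf : ~ P (rg_res 'O_X WU f).
    move=> Pf; have [b fb] := funit f; apply: P1; rewrite -fb mulrC; exact: PM.
  have ufy : is_unit (rgerm Uy f).
    apply: contrapT => h; have : vanishing Uy f by [].
    by rewrite e.
  have Wy : W y by exists Uy.
  have nPfn n : ~ P (rg_res 'O_X WU f ^+ n).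
    elim: n => [|n IH]; first by rewrite expr0.
    by rewrite exprS => /pr[].
  exists y, Wy; apply/seteqP; split=> s; have [n [m em]] := num s.
    move=> ns; have : vanishing Uy m.
      move=> um; apply: ns; apply: (@is_unitMr _ (rgerm Wy (rg_res 'O_X WU f ^+ n))).
      by rewrite -rmorphM -em /= (van _ _ Uy).
    by rewrite e /= em => /pr[/nPfn|].
  move=> Ps us; have : vanishing Uy m by rewrite e /= em; exact: PM.
  apply; rewrite -(van _ Wy) em rmorphM rmorphXn /= (van _ _ Uy).
  by apply: is_unitM => //; exact: is_unitX.
- move=> V y VW Vy; have [|g [gy gV]] := basis V y _ Vy.
    by move=> z /VW/WU.
  have eD z : basic_open (rg_res 'O_X WU g) z -> basic_open g z.
    by move=> [hz]; rewrite (van _ _ (WU _ hz)); exists (WU _ hz).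
  exists (rg_res 'O_X WU g); split; last by move=> z /eD/gV.
  have hy := VW _ Vy; exists hy; rewrite (van _ _ (WU _ hy)).
  by case: gy => k; rewrite (Prop_irrelevance k (WU _ hy)).
- move=> g; apply: sect_unit => x [hx ux].
  by rewrite (rgerm_res _ hx).
- move=> g; split=> [s|m em].
    have [ge|ne] := pselect (basic_open g eta); last first.
      by exists 0%N, 0; apply: sect_ext => h; case: ne.
    pose k := rgerm ge s; have [j [g' eg']] := num g.
    (* Here g' = f ^ j * g extends to U, where D(f * g') is the set D(g) of W. Denominators are
       cleared on U, and the powers of [f], invertible on W, are divided out. *)
    have [z [Uz uz]|n [m em]] := @affine_den U Ue (f * g') k aU.
      move: uz; rewrite rmorphM => uz.
      have Wz : W z by exists Uz; exact: is_unitMl uz.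
      suff gz : basic_open g z by exact: reg_sect.
      exists Wz; apply: (@is_unitMr _ (rgerm Wz (rg_res 'O_X WU f ^+ j))).
      by rewrite -rmorphM -eg' /= (van _ _ Uz); exact: is_unitMr uz.
    have [|m' em'] := @sect_glue W De (rgerm De g ^+ n * k).
      move=> z Wz; have Uz := WU _ Wz.
      (* The exponent comes from (f * g') ^ n = f ^ (j.+1 * n) * g ^ n. *)
      have ufn : is_unit (rgerm Uz (f ^+ (j.+1 * n)%N)).
        by rewrite rmorphXn; apply: is_unitX; exact: uf.
      apply: (reg_unit (he := Ue) ufn).
      suff -> : rgerm Ue (f ^+ (j.+1 * n)%N) * (rgerm De g ^+ n * k) = rgerm Ue m.
        exact: reg_sect.
      rewrite -em rmorphM /= -(van _ De Ue g') eg' rmorphM !rmorphXn /= (van _ _ Ue).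
      by rewrite [rgerm Ue f * _]mulrA -exprS exprMn -exprM mulrA.
    exists n, m'; apply: sect_ext => h.
    rewrite /= (rgerm_res _ De) em' -[_ *: _]/(_ * _) rmorphM rmorphXn /=.
    by rewrite (rgerm_res _ De) (Prop_irrelevance h ge).
  have [ge|ne] := pselect (basic_open g eta).
    exists 0%N; rewrite expr0 scale1r; apply: sect_ext => h.
    rewrite raddf0 -(rgerm_res (@basic_open_sub _ W g) h ge).
    by rewrite [X in rgerm _ X]em raddf0.
  exists 1%N; rewrite expr1; suff -> : g = 0 by rewrite scale0r.
  apply: sect_ext => h; rewrite raddf0; apply: contrapT => /K_unit ug; apply: ne.
  by exists h.
Qed.

(** * Finiteness of zeros and poles *)

Hypothesis X_noetherian : noetherian_scheme X.

(** Noetherian induction on ideals I containing a function nonzero at [eta]. For I prime, the zero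
    set lies in the closure of a point other than [eta], hence is at most one point. Otherwise I
    contains a product a b with neither factor in I, and each zero of I is a zero of I + (a) or of I
    + (b). *)
Lemma zeros_finite U (f : 'O_X U) : affine U -> noetherian_ring ('O_X U) ->
  basic_open f eta ->
  finite_set [set x | exists h : U x, ~ is_unit (rgerm h f)].
Proof.
move=> aU noethU fe; have Ue : U eta by case: fe.
pose Q (I : set ('O_X U)) := (exists2 g, I g & basic_open g eta) ->
  finite_set [set x | exists h : U x, I `<=` vanishing h].
have step I : is_ideal I -> (forall J, is_ideal J -> I `<` J -> Q J) -> Q I.
  move=> idI IH [g Ig ge].
  have [I1|nI1] := pselect (I 1).
    apply: (sub_finite_set _ (finite_set0 X)) => x [h /(_ _ I1)]; apply.
    by rewrite rmorph1; exact: is_unit1.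
  have [prI|nprI] := pselect (forall a b, I (a * b) -> I a \/ I b).
    have [_ _ surj _ _] := aU; have [|y [Uy ey]] := surj I; first by split.
    have ye : y <> eta.
      move=> e; have : vanishing Uy g by rewrite ey.
      apply; case: ge => k; move: Uy {ey}; rewrite e => Uy.
      by rewrite (Prop_irrelevance k Uy).
    apply: (sub_finite_set _ (finite_set1 y)) => x [Ux]; rewrite -ey => sub.
    have := nongeneric_closed ye => /closure_id->.
    exact/(vanishing_closure aU Uy Ux).
  have [a [b [Iab nIa nIb]]] : exists a b, [/\ I (a * b), ~ I a & ~ I b].
    apply: contrapT => h; apply: nprI => a b Iab; apply: contrapT => /not_orP[na nb].
    by apply: h; exists a, b.
  have [I0 ID IM] := idI.
  pose J c : set ('O_X U) := [set i + d * c | i in I & d in [set: 'O_X U]].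
  have finJ c : ~ I c -> finite_set [set x | exists h : U x, J c `<=` vanishing h].
    move=> nIc; have IJ : I `<=` J c.
      by move=> i Ii; exists i => //; exists 0 => //; rewrite mul0r addr0.
    apply: IH; last by exists g => //; exact: IJ.
    - split=> [|_ _ [i Ii [d _ <-]] [i' Ii' [d' _ <-]]|e _ [i Ii [d _ <-]]].
      + exact: IJ.
      + exists (i + i'); first exact: ID.
        by exists (d + d') => //; ring.
      + exists (e * i); first exact: IM.
        by exists (e * d) => //; ring.
    - rewrite properEneq; split=> //; apply/eqP => e; apply: nIc; rewrite e.
      by exists 0 => //; exists 1 => //; rewrite add0r mul1r.
  have : finite_set ([set x | exists h : U x, J a `<=` vanishing h] `|`
                     [set x | exists h : U x, J b `<=` vanishing h]).
    by rewrite finite_setU; split; exact: finJ.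
  apply: sub_finite_set => x [Ux sub].
  have [[_ vD vM] _ vpr] := vanishing_prime Ux.
  by case: (vpr a b (sub _ Iab)) => [va|vb]; [left|right]; exists Ux => _ [i /sub vi [d _ <-]];
    apply: vD => //; exact: vM.
have idF : is_ideal [set a * f | a in [set: 'O_X U]].
  split=> [|_ _ [a _ <-] [b _ <-]|a _ [b _ <-]].
  - by exists 0 => //; rewrite mul0r.
  - by exists (a + b) => //; rewrite mulrDl.
  - by exists (a * b) => //; rewrite mulrA.
have finF : finite_set
    [set x | exists h : U x, [set a * f | a in [set: 'O_X U]] `<=` vanishing h].
  apply: (noetherian_ind noethU step idF).
  by exists f => //; exists 1 => //; rewrite mul1r.
apply: (sub_finite_set _ finF) => x [Ux nu]; exists Ux => _ [a _ <-].
by rewrite /vanishing /= rmorphM => /is_unitMr.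
Qed.

Lemma noetherian_nbhs x :
  exists U : opens X, [/\ U x, affine U & noetherian_ring ('O_X U)].
Proof.
have [n [U [aU cov]]] := X_noetherian.
have [i _ Ux] : (\bigcup_i U i) x by rewrite cov.
by exists (U i); case: (aU i).
Qed.

(** On each chart of a finite cover [k] is a fraction g / f, and its poles are zeros of f. *)
Lemma poles_finite k : finite_set [set x | ~ reg x k].
Proof.
have [n [U [aU cov]]] := X_noetherian.
have : finite_set (\bigcup_(i in [set: 'I_n]) [set x | U i x /\ ~ reg x k]).
  apply: bigcup_finite => // i _; have [aUi noethUi] := aU i.
  have [Ue|nUe] := pselect (U i eta); last first.
    apply: (sub_finite_set _ (finite_set0 X)) => x [/generic_in//].
  have [f [g [uf fk]]] := affine_germ aUi Ue k.
  apply: (sub_finite_set _ (zeros_finite aUi noethUi (f := f) _)); last by exists Ue.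
  move=> x [Ux nreg]; exists Ux => ux; apply: nreg; apply: (reg_unit (he := Ue) ux).
  by rewrite fk; exact: reg_sect.
apply: sub_finite_set => x nreg; have [i _ Ux] : (\bigcup_i U i) x by rewrite cov.
by exists i.
Qed.

(** A finite union of closed points is closed, so some basic open set around [y] misses it, and
    basic open sets containing [eta] are affine. *)
Lemma affine_avoid U (B : set X) y : affine U -> U y -> finite_set B ->
  (forall x, B x -> closed [set x]) -> ~ B y ->
  exists V : opens X, [/\ V `<=` U, V y, affine V & forall x, V x -> ~ B x].
Proof.
move=> aU Uy finB clB nBy.
have clB' : closed B.
  rewrite (_ : B = \bigcup_(x in B) [set x]); first exact: closed_bigcup.
  by apply/seteqP; split=> [x Bx|x [z Bz ->]]//; exists x.
have oB : open (~` B) by exact: closed_openC.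
have [_ _ _ basis _] := aU.
have [|//|f [fy fV]] := basis (opensI U (Opens oB)) y; first by move=> ? [].
exists (basic_open f); split=> //; first exact: basic_open_sub.
  by apply: affine_basic => //; exact: generic_in fy.
by move=> x /fV[].
Qed.

(** * Uniformizers, pole orders and effective divisors *)

Definition unif (x : closed_point X) : lring (sval x) :=
  sval (cid (proj1 (lring_uniformizer (closed_neq_eta (svalP x))))).

Lemma unifP (x : closed_point X) : uniformizer (unif x).
Proof. exact: (svalP (cid (proj1 (lring_uniformizer (closed_neq_eta (svalP x)))))). Qed.

Definition tau (x : closed_point X) : K := gsp (sval x) (unif x).

Lemma tauX (x : closed_point X) n : tau x ^+ n = gsp (sval x) (unif x ^+ n).
Proof. by rewrite rmorphXn. Qed.

Lemma tauX_neq0 (x : closed_point X) n : tau x ^+ n <> 0.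
Proof.
rewrite tauX -(rmorph0 (gsp (sval x))) => /gsp_inj.
exact: (uniformizerX_neq0 (unifP x)).
Qed.

Lemma reg_tau (x : closed_point X) n : reg (sval x) (tau x ^+ n).
Proof. by rewrite tauX; exists (unif x ^+ n). Qed.

Lemma K_fraction x (k : K) : exists a b : lring x, b <> 0 /\ gsp x b * k = gsp x a.
Proof.
have [U Ux aU] := sch_affine x; have Ue := generic_in Ux.
have [f [g [uf fk]]] := affine_germ aU Ue k.
exists (rgerm Ux g), (rgerm Ux f); rewrite !(gspE _ Ue); split=> // e.
by apply: (K_unit_neq0 uf); rewrite -(gspE Ux Ue) e rmorph0.
Qed.

Lemma pole_order (x : closed_point X) k : exists n, reg (sval x) (tau x ^+ n * k).
Proof.
have [a [b [b0 e]]] := K_fraction (sval x) k.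
have [_ _ _ val] := unifP x; have [n [u [[v uv] eb]]] := val b b0.
exists n; exists (v * a) => //; rewrite rmorphM -e eb !rmorphM -tauX.
transitivity (gsp (sval x) (u * v) * (tau x ^+ n * k)); last by rewrite uv rmorph1 mul1r.
by rewrite rmorphM; ring.
Qed.

(** Effective divisors: the multiplicity is the pole order allowed at the point. *)
Definition divisor :=
  {n : closed_point X -> nat | finite_set [set x | n x <> 0%N]}.

Definition mk_divisor n (h : finite_set [set x | n x <> 0%N]) : divisor := exist _ n h.

Definition mult (D : divisor) : closed_point X -> nat := sval D.

Lemma closed_point_inj (x y : closed_point X) : sval x = sval y -> x = y.
Proof.
case: x y => [x cx] [y cy] /= e; case: y / e cy => cy.
by rewrite (Prop_irrelevance cx cy).
Qed.

Lemma finite_closed_points (B : set X) :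
  finite_set B -> finite_set [set x : closed_point X | B (sval x)].
Proof.
by apply: finite_preimage => x y _ _; exact: closed_point_inj.
Qed.

Lemma pole_divisor k : exists D : divisor,
  forall x : closed_point X, reg (sval x) (tau x ^+ mult D x * k).
Proof.
(* The value 0 is imposed wherever [k] is regular; otherwise the chosen orders could have infinite
   support. *)
have /choice[n hn] (x : closed_point X) : exists n,
    reg (sval x) (tau x ^+ n * k) /\ (reg (sval x) k -> n = 0%N).
  have [r|nr] := pselect (reg (sval x) k); first by exists 0%N; rewrite expr0 mul1r.
  by have [n hn] := pole_order x k; exists n.
suff fin : finite_set [set x | n x <> 0%N].
  by exists (exist _ n fin) => x; case: (hn x).
apply: (sub_finite_set _ (finite_closed_points (poles_finite k))) => x nx r.
by apply: nx; case: (hn x) => _; apply.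
Qed.

Lemma div0_finite : finite_set [set _ : closed_point X | 0%N <> 0%N].
Proof. by apply: (sub_finite_set _ (finite_set0 _)) => x; apply. Qed.

Definition div0 : divisor := mk_divisor div0_finite.

Lemma divD_finite (D E : divisor) :
  finite_set [set x | (mult D x + mult E x)%N <> 0%N].
Proof.
have : finite_set ([set x | mult D x <> 0%N] `|` [set x | mult E x <> 0%N]).
  by rewrite finite_setU; split; [exact: (svalP D)|exact: (svalP E)].
apply: sub_finite_set => x /= h; apply: contrapT => /not_orP[/contrapT a /contrapT b].
by apply: h; rewrite a b.
Qed.

Definition divD (D E : divisor) : divisor := mk_divisor (divD_finite D E).

Definition pole_bound (D : divisor) (V : opens X) (k : K) : Prop :=
  forall x : closed_point X, V (sval x) -> reg (sval x) (tau x ^+ mult D x * k).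

Lemma pole_boundM D E V (k l : K) :
  pole_bound D V k -> pole_bound E V l -> pole_bound (divD D E) V (k * l).
Proof.
move=> hk hl x Vx; have := regM (hk x Vx) (hl x Vx).
by rewrite /= exprD; congr reg; ring.
Qed.

(** At a closed point y, write a uniformizer as g / f on a chart with f invertible at y. Its
    numerator g, raised to the multiplicity at y, is the equation, once the other points of D and
    the other zeros of g are removed. Around [eta] all of D is removed and 1 serves. *)
Lemma local_equation D y : exists (U : opens X) (g : K),
  [/\ U y, affine U, g <> 0 & forall (x : closed_point X) k, U (sval x) ->
    (reg (sval x) (tau x ^+ mult D x * k) <-> reg (sval x) (g * k))].
Proof.
have [U [Uy aU noethU]] := noetherian_nbhs y; have Ue := generic_in Uy.
pose S := [set x | exists2 z : closed_point X, x = sval z & mult D z <> 0%N].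
have finS : finite_set S.
  apply: (sub_finite_set _ (finite_image sval (svalP D))) => _ [z -> hz].
  by exists z.
have clS x : S x -> closed [set x] by move=> [z -> _]; exact: (svalP z).
have notS (x : closed_point X) : ~ S (sval x) -> mult D x = 0%N.
  by move=> h; apply: contrapT => n0; apply: h; exists x.
have [ye|ye] := pselect (y = eta).
  have nSy : ~ S y by rewrite ye => /clS/eta_not_closed.
  have [V [VU Vy aV nS]] := affine_avoid aU Uy finS clS nSy.
  exists V, 1; split=> //; first exact: K_one_neq0.
  by move=> x k Vx; rewrite notS ?expr0 //; exact: nS.
pose y' : closed_point X := exist _ y (nongeneric_closed ye).
have [f [g [uf fg]]] := affine_germ aU Uy (unif y').
have eg : rgerm Ue g = rgerm Ue f * tau y'.
  by rewrite -(gspE Uy Ue g) -fg rmorphM (gspE Uy Ue f).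
have g0 : rgerm Ue g <> 0.
  rewrite eg; apply: K_mul_neq0; last by have := @tauX_neq0 y' 1%N.
  by apply: K_unit_neq0; rewrite -(gspE Uy Ue f); exact: is_unit_rmorph.
pose Z := [set x | exists h : U x, ~ is_unit (rgerm h g)].
have finZ : finite_set Z.
  by apply: (zeros_finite aU noethU); exists Ue; exact: K_unit.
have clZ x : Z x -> closed [set x].
  move=> [h nu]; apply: nongeneric_closed => e; move: h nu; rewrite e => h; apply.
  by rewrite (Prop_irrelevance h Ue); exact: K_unit.
have [|||V [VU Vy aV nSZ]] := @affine_avoid U ((S `|` Z) `\ y) y aU Uy.
- by apply: (@sub_finite_set _ _ (S `|` Z)); [by move=> x []|rewrite finite_setU].
- by move=> x [[/clS|/clZ]].
- by move=> [_]; apply.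
have Ve := generic_in Vy.
exists V, (rgerm Ue g ^+ mult D y'); split; [by []|by []| |].
  elim: (mult D y') => [|n IH]; first exact: K_one_neq0.
  by rewrite exprS; exact: K_mul_neq0.
move=> x k Vx; have Ux := VU _ Vx; have [xy|xy] := pselect (sval x = y).
  have {xy} -> : x = y' by exact: closed_point_inj.
  rewrite eg exprMn -mulrA; split=> [h|h].
    by apply: regM h; rewrite -rmorphXn; exact: (reg_sect Uy).
  apply: (reg_unit (he := Ue) (hx := Uy) (s := f ^+ mult D y')).
    by rewrite rmorphXn; exact: is_unitX.
  by rewrite rmorphXn.
have nSx : ~ S (sval x) by move=> Sx; apply: (nSZ _ Vx); split=> //; left.
have ux : is_unit (rgerm Ux g).
  by apply: contrapT => nu; apply: (nSZ _ Vx); split=> //; right; exists Ux.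
rewrite notS // expr0 mul1r -rmorphXn; split=> [h|].
  by apply: regM h; exact: (reg_sect Ux).
by apply: (reg_unit (hx := Ux)); rewrite rmorphXn; exact: is_unitX.
Qed.

(** * The sheaves O(D) *)

Let Q1 := adic_quo 'm_eta (mstalk (OX X) eta) 1.

(** Values of the constant sheaf live in the quotient of the stalk by the first power of the maximal
    ideal at [eta]. This ideal is 0, so [toQ] and its inverse [ofQ] identify the quotient with K. *)
Definition toQ (k : K) : Q1 := qpi _ (lring_OX k).

Lemma toQ_inj : injective toQ.
Proof.
move=> k l /qpi_eq/ideal_pow0 e; apply: (bij_inj (@lring_OX_bij X eta)).
apply/eqP; rewrite -subr_eq0; apply/eqP/e => a na.
by apply: contrapT => /K_unit.
Qed.

Lemma toQ_surj q : exists k, toQ k = q.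
Proof.
have [m ->] := qpi_surj q; have [g _ gK] := @lring_OX_bij X eta.
by exists (g m); rewrite /toQ gK.
Qed.

Definition ofQ q : K := sval (cid (toQ_surj q)).

Lemma ofQK q : toQ (ofQ q) = q.
Proof. exact: (svalP (cid (toQ_surj q))). Qed.

Lemma toQK k : ofQ (toQ k) = k.
Proof. by apply: toQ_inj; rewrite ofQK. Qed.

Lemma toQ_linear (a k l : K) : toQ (a * k + l) = a *: toQ k + toQ l.
Proof. by rewrite /toQ -linearP -[in RHS]linearP. Qed.

Lemma ofQ_linear (a : K) p q : ofQ (a *: p + q) = a * ofQ p + ofQ q.
Proof. by apply: toQ_inj; rewrite toQ_linear !ofQK. Qed.

Lemma ofQ0 : ofQ 0 = 0.
Proof. by have := ofQ_linear (-1) 0 0; rewrite scaler0 addr0 mulN1r addNr. Qed.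

Lemma ofQD p q : ofQ (p + q) = ofQ p + ofQ q.
Proof. by have := ofQ_linear 1 p q; rewrite scale1r mul1r. Qed.

Lemma ofQZ a p : ofQ (a *: p) = a * ofQ p.
Proof. by have := ofQ_linear a p 0; rewrite ofQ0 !addr0. Qed.

Lemma ofQ_inj : injective ofQ.
Proof. exact: (can_inj ofQK). Qed.

Section DivisorSheaf.
Variable D : divisor.

Definition div_set U : set (constK eta U) :=
  [set s | forall h : U eta, pole_bound D U (ofQ (s h))].

Lemma div_set0 U : @div_set U 0.
Proof. by move=> h x Ux; rewrite [X in _ * X]ofQ0 mulr0; exact: reg0. Qed.

Lemma div_setD U s t : @div_set U s -> @div_set U t -> @div_set U (s + t).
Proof.
move=> hs ht h x Ux; rewrite [X in _ * X]ofQD mulrDr; apply: regD.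
  exact: hs.
exact: ht.
Qed.

Lemma div_setZ U (a : 'O_X U) s : @div_set U s -> @div_set U (a *: s).
Proof.
move=> hs h x Ux; rewrite [X in _ * X]ofQZ mulrCA; apply: regM.
  exact: reg_sect.
exact: hs.
Qed.

Definition div_submod U : submod (constK eta U) :=
  Submod (@div_set0 U) (@div_setD U) (@div_setZ U).

Lemma div_res (U V : opens X) (h : V `<=` U) (s : constK eta U) :
  div_submod U s -> div_submod V (pm_res (constK eta) h s).
Proof. by move=> hs k x Vx; exact: hs (h _ Vx). Qed.

Lemma div_local (U : opens X) (s : constK eta U) :
  (forall x, U x -> exists (V : opens X) (h : V `<=` U),
     V x /\ div_submod V (pm_res (constK eta) h s)) -> div_submod U s.
Proof.
move=> loc h x Ux; have [V [VU [Vx hV]]] := loc _ Ux.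
have Ve := generic_in Vx; rewrite (Prop_irrelevance h (VU _ Ve)).
exact: (hV Ve x Vx).
Qed.

Definition div_sheaf : omod X := subsheaf div_res div_local.

Definition dval U (s : div_sheaf U) (h : U eta) : K := ofQ (subsheaf_val s h).

Lemma dval_bound U (s : div_sheaf U) h : pole_bound D U (dval s h).
Proof. exact: (sub_lmodP s). Qed.

Lemma dval_inj U (s t : div_sheaf U) : (forall h, dval s h = dval t h) -> s = t.
Proof. by move=> e; apply: val_inj; apply/funext => h; apply: ofQ_inj; exact: e. Qed.

Lemma dvalZ U a (s : div_sheaf U) h : dval (a *: s) h = rgerm h a * dval s h.
Proof. exact: ofQZ. Qed.

Lemma dvalD U (s t : div_sheaf U) h : dval (s + t) h = dval s h + dval t h.
Proof. exact: (ofQD (subsheaf_val s h) (subsheaf_val t h)). Qed.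

Lemma dval0 U h : dval (0 : div_sheaf U) h = 0.
Proof. exact: ofQ0. Qed.

Lemma dval_res (U V : opens X) (VU : V `<=` U) (s : div_sheaf U) h h' :
  dval (pm_res div_sheaf VU s) h = dval s h'.
Proof. by rewrite (Prop_irrelevance h' (VU _ h)). Qed.

Lemma ex_dval U k : (U eta -> pole_bound D U k) ->
  exists s : div_sheaf U, forall h, dval s h = k.
Proof.
move=> hk; have Ps : div_submod U (fun _ => toQ k).
  by move=> h; rewrite toQK; exact: hk.
by exists (to_sub_lmod Ps) => h; rewrite /dval /subsheaf_val /= toQK.
Qed.

(** Multiplication by the local equation g carries sections of O(D) onto those of O_X inside K.
    Localization thus reduces to [affine_den], and the inverse of g generates. *)
Lemma div_coherent : coherent div_sheaf.
Proof.
move=> y; have [U [g [Uy aU g0 eqn]]] := local_equation D y; exists U; split=> //.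
- move=> f; have Ue := generic_in Uy; split=> [s|m em].
    have [fe|ne] := pselect (basic_open f eta); last first.
      by exists 0%N, 0; apply: dval_inj => h; case: ne.
    have [z fz|n [a ea]] := @affine_den U Ue f (g * dval s fe) aU.
      have [->|ze] := pselect (z = eta); first exact: reg_eta.
      pose z' : closed_point X := exist _ z (nongeneric_closed ze).
      have Uz : U z by case: fz.
      apply/(eqn z' _ Uz); exact: (@dval_bound _ s fe z' fz).
    have [|m hm] := @ex_dval U (rgerm Ue f ^+ n * dval s fe).
      move=> _ x Ux; apply/eqn => //; rewrite mulrCA ea; exact: reg_sect.
    exists n, m; apply: dval_inj => h.
    rewrite (dval_res _ _ _ Ue) hm dvalZ (Prop_irrelevance h fe) rmorphXn /=.
    by rewrite (rgerm_res _ Ue).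
  have [fe|ne] := pselect (basic_open f eta).
    exists 0%N; rewrite expr0 scale1r; apply: dval_inj => h.
    by rewrite dval0 -(dval_res (@basic_open_sub _ U f) _ fe) em dval0.
  exists 1%N; rewrite expr1; apply: dval_inj => h; rewrite dvalZ dval0.
  have -> : rgerm h f = 0; last by rewrite mul0r.
  by apply: contrapT => /K_unit uf; apply: ne; exists h.
- have [g' gg'] := K_unit g0; have Ue := generic_in Uy.
  have [|e he] := @ex_dval U g'.
    move=> _ x Ux; apply/eqn => //; rewrite gg'.
    by exists 1; rewrite ?rmorph1.
  exists 1%N, (fun _ => e) => m.
  have [z Uz|a ea] := @sect_glue U Ue (g * dval m Ue).
    have [->|ze] := pselect (z = eta); first exact: reg_eta.
    pose z' : closed_point X := exist _ z (nongeneric_closed ze).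
    apply/(eqn z' _ Uz); exact: (@dval_bound _ m Ue z' Uz).
  exists (fun _ => a); rewrite big_ord1; apply: dval_inj => h.
  rewrite dvalZ he (Prop_irrelevance h Ue) ea.
  by rewrite mulrAC gg' mul1r.
Qed.

Definition qcdiv : qcoh X := @Qcoh X div_sheaf
  (fun x => let: ex_intro U (And4 h aU l _) := div_coherent x in
            ex_intro _ U (And3 h aU l)).

Definition div_incl : mhom qcdiv (constK eta) := subsheaf_incl div_res div_local.

Lemma div_incl_mono : mhom_mono div_incl.
Proof. exact: subsheaf_incl_mono. Qed.

Section Lift.
Variables (L : omod X) (f : mhom L (constK eta)).
Hypothesis fP : forall U s (h : U eta), pole_bound D U (ofQ (f U s h)).

Definition div_lift : mhom L qcdiv := @subsheaf_lift X _ _ div_res div_local L f fP.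

Lemma div_liftK : mhom_comp div_incl div_lift = f.
Proof. exact: mhomP. Qed.

Lemma dval_lift U (s : L U) h : dval (div_lift U s) h = ofQ (f U s h).
Proof. by []. Qed.

End Lift.

Section DivisorStalk.
Variable x : closed_point X.
Let px := sval x.
Let n := mult D x.

(** Multiplication by t ^ n trivializes the stalk. The equation is asked of all representatives of
    the germ, so the chosen value can be computed from any of them. *)
Lemma theta_ex (m : mstalk div_sheaf px) : exists a : lring px,
  forall (U : opens X) (hx : U px) (he : U eta) (s : div_sheaf U),
    m = mgerm hx s -> gsp px a = tau x ^+ n * dval s he.
Proof.
have [U [hx [s ->]]] := stalk_surj m; have he := generic_in hx.
have [a _ ea] := dval_bound s he hx; exists a => V hxV heV t.
move=> /germ_eq[W [h [k [Wx e]]]]; rewrite ea; congr (_ * _).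
have We := generic_in Wx.
by rewrite -(dval_res h s We) -(dval_res k t We) [X in dval X _]e.
Qed.

Definition theta_fun (m : mstalk div_sheaf px) : (lring px)^o :=
  sval (cid (theta_ex m)).

Lemma theta_funE (U : opens X) (hx : U px) (he : U eta) (s : div_sheaf U) :
  gsp px (theta_fun (mgerm hx s)) = tau x ^+ n * dval s he.
Proof. exact: (svalP (cid (theta_ex (mgerm hx s)))). Qed.

Lemma theta_is_linear : linear theta_fun.
Proof.
move=> a u v; have [U [hx [f [s [t [-> -> ->]]]]]] := mstalk_surj3' a u v.
have he := generic_in hx; apply: gsp_inj; rewrite -mgermZ -mgermD rmorphD rmorphM.
rewrite !(theta_funE _ he) dvalD dvalZ (gspE hx he); ring.
Qed.

HB.instance Definition _ := GRing.isLinear.Build (lring px) (mstalk div_sheaf px)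
  (lring px)^o _ theta_fun theta_is_linear.

Definition theta : {linear mstalk div_sheaf px -> (lring px)^o} := theta_fun.

Lemma thetaE (U : opens X) (hx : U px) (he : U eta) (s : div_sheaf U) :
  gsp px (theta (mgerm hx s)) = tau x ^+ n * dval s he.
Proof. exact: theta_funE. Qed.

Lemma theta_bij : bijective theta.
Proof.
apply: inj_surj_bij => [u v e|a].
  have [U [hx [s [t [eu ev]]]]] := stalk_surj2 u v; have he := generic_in hx.
  have := congr1 (gsp px) e; rewrite eu ev !(thetaE _ he) => /(K_mulI (@tauX_neq0 x n)) est.
  by congr germ; apply: dval_inj => h; rewrite (Prop_irrelevance h he).
have [k ek] := K_unit (@tauX_neq0 x n).
(* The preimage of [a] is a section near [x] with value a / t ^ n, so the other poles of this
   quotient have to be removed from the chart. *)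
pose B := [set y | ~ reg y (gsp px a * k) /\ y <> px].
have [U [Ux aU _]] := noetherian_nbhs px.
have [|||V [_ Vx _ nB]] := @affine_avoid U B px aU Ux.
- by apply: (sub_finite_set _ (poles_finite (gsp px a * k))) => y [].
- move=> y [nreg _]; apply: nongeneric_closed => e; apply: nreg.
  by rewrite e; exact: reg_eta.
- by case.
have [|s hs] := @ex_dval V (gsp px a * k).
  move=> _ y Vy; have [/closed_point_inj->|yx] := pselect (sval y = px).
    by rewrite mulrCA ek mulr1; exists a.
  apply: regM; first exact: reg_tau.
  by apply: contrapT => h; exact: (nB _ Vy).
exists (mgerm Vx s); apply: (@gsp_inj px).
by rewrite (thetaE Vx (generic_in Vx)) hs mulrCA ek mulr1.
Qed.

End DivisorStalk.

End DivisorSheaf.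

(** * The constant sheaf as the union of the O(D) *)

Definition div_le (D E : divisor) : Prop := forall x, (mult D x <= mult E x)%N.

Lemma pole_bound_le D E V k : div_le D E -> pole_bound D V k -> pole_bound E V k.
Proof.
move=> DE h x Vx; rewrite -(subnK (DE x)) exprD -mulrA; apply: regM (h x Vx).
exact: reg_tau.
Qed.

Lemma div_trans_bound D E (DE : div_le D E) U (s : qcdiv D U) (h : U eta) :
  pole_bound E U (ofQ (div_incl D U s h)).
Proof. apply: pole_bound_le DE _; exact: dval_bound. Qed.

Definition div_trans D E (DE : div_le D E) : mhom (qcdiv D) (qcdiv E) :=
  div_lift (div_trans_bound DE).

Lemma div_incl_lift D (L : omod X) (f g : mhom L (qcdiv D)) :
  mhom_comp (div_incl D) f = mhom_comp (div_incl D) g -> f = g.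
Proof.
move=> e; apply: mhomP => U s; apply: (@div_incl_mono D).
exact: (congr1 (fun m : mhom L _ => m U s) e).
Qed.

Lemma div_le_refl D : div_le D D. Proof. by move=> x. Qed.

Lemma div_le_trans D E F : div_le D E -> div_le E F -> div_le D F.
Proof. by move=> DE EF x; exact: leq_trans (DE x) (EF x). Qed.

Lemma div_directed D E : exists F, div_le D F /\ div_le E F.
Proof.
by exists (divD D E); split=> x /=; [exact: leq_addr|exact: leq_addl].
Qed.

Lemma div_trans_id D (h : div_le D D) : div_trans h = mhom_id (qcdiv D).
Proof. by apply: div_incl_lift; apply: mhomP. Qed.

Lemma div_trans_comp D E F (h : div_le D E) (h' : div_le E F) (l : div_le D F) :
  mhom_comp (div_trans h') (div_trans h) = div_trans l.
Proof. by apply: div_incl_lift; apply: mhomP. Qed.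

Definition div_system : direct_system X :=
  @DirectSystem X divisor div_le div_le_refl div_le_trans (inhabits div0)
    div_directed qcdiv div_trans div_trans_id div_trans_comp.

(** A section over an open set containing [eta] is a single element of K, and its pole divisor is a
    stage from which it comes. *)
Lemma constK_limit :
  @is_direct_limit X div_system (constK eta) (fun D => div_incl D).
Proof.
apply: mono_direct_limit; first by move=> D E h; exact: mhomP.
  exact: div_incl_mono.
move=> U s; have [Ue|nUe] := pselect (U eta); last first.
  by exists div0, 0; apply/funext => h; case: (nUe h).
have [D hD] := pole_divisor (ofQ (s Ue)).
have [|t ht] := @ex_dval D U (ofQ (s Ue)); first by move=> _ x _; exact: hD.
exists D, t; apply/funext => h; apply: ofQ_inj.
by rewrite (Prop_irrelevance h Ue); exact: ht.
Qed.

(** * Adeles *)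

Section Adeles.
Variables (A : adele_functor X) (Kx : closed_point X -> fieldType)
  (iota : forall x : closed_point X, {rmorphism hatO (sval x) -> Kx x}).
Hypothesis iota_frac : forall x, is_fraction_field (iota x).

Lemma iota_inj x : injective (iota x).
Proof. by case: (iota_frac x). Qed.

Definition iot (x : closed_point X) (a : lring (sval x)) : Kx x :=
  iota x (to_rcomp _ a).

Lemma iotB x a b : @iot x (a - b) = iot a - iot b.
Proof. by rewrite /iot !rmorphB. Qed.

Lemma iotM x a b : @iot x (a * b) = iot a * iot b.
Proof. by rewrite /iot !rmorphM. Qed.

Lemma iot1 x : @iot x 1 = 1.
Proof. by rewrite /iot !rmorph1. Qed.

Lemma iot_neq0 x a : a <> 0 -> @iot x a != 0.
Proof.
move=> a0; apply/eqP => e; apply: a0; apply: (to_rcomp_inj (unifP x)).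
by apply: (@iota_inj x); rewrite !rmorph0.
Qed.

(** A fraction a / b is sent to the same fraction in K_x. All presentations of [k] are covered at
    once, so each property of [diag] can be checked on a convenient one. *)
Lemma diag_ex (x : closed_point X) (k : K) : exists z : Kx x,
  forall a b, gsp (sval x) b * k = gsp (sval x) a -> iot b * z = iot a.
Proof.
have [a [b [b0 e]]] := K_fraction (sval x) k; exists (iot a / iot b) => c d e'.
apply: (mulIf (iot_neq0 b0)); rewrite -mulrA mulfVK ?iot_neq0 // -!iotM.
congr iot; apply: (@gsp_inj (sval x)); rewrite !rmorphM -e -e'; ring.
Qed.

Definition diag_fun x (k : K) : Kx x := sval (cid (diag_ex x k)).

Lemma diag_funE x k a b :
  gsp (sval x) b * k = gsp (sval x) a -> iot b * diag_fun x k = iot a.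
Proof. exact: (svalP (cid (diag_ex x k))). Qed.

Lemma diag_fun_additive x : zmod_morphism (diag_fun x).
Proof.
move=> k l; have [a [b [b0 e]]] := K_fraction (sval x) k.
have [c [d [d0 e']]] := K_fraction (sval x) l.
apply: (mulfI (mulf_neq0 (iot_neq0 b0) (iot_neq0 d0))).
rewrite -iotM (@diag_funE x _ (a * d - c * b)); last first.
  by rewrite rmorphB !rmorphM -e -e'; ring.
by rewrite iotB !iotM -(diag_funE e) -(diag_funE e'); ring.
Qed.

Lemma diag_fun_multiplicative x : monoid_morphism (diag_fun x).
Proof.
split; first by rewrite -[LHS]mul1r -iot1 (@diag_funE x _ 1) ?iot1 // mulr1.
move=> k l; have [a [b [b0 e]]] := K_fraction (sval x) k.
have [c [d [d0 e']]] := K_fraction (sval x) l.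
apply: (mulfI (mulf_neq0 (iot_neq0 b0) (iot_neq0 d0))).
rewrite -iotM (@diag_funE x _ (a * c)); last first.
  by rewrite !rmorphM -e -e'; ring.
by rewrite !iotM -(diag_funE e) -(diag_funE e'); ring.
Qed.

HB.instance Definition _ x :=
  GRing.isZmodMorphism.Build K (Kx x) (diag_fun x) (diag_fun_additive x).
HB.instance Definition _ x :=
  GRing.isMonoidMorphism.Build K (Kx x) (diag_fun x) (diag_fun_multiplicative x).

Definition diag x : {rmorphism K -> Kx x} := diag_fun x.

Lemma diagE x k a b :
  gsp (sval x) b * k = gsp (sval x) a -> iot b * diag x k = iot a.
Proof. exact: diag_funE. Qed.

Lemma diag_gsp x a : diag x (gsp (sval x) a) = iot a.
Proof. by rewrite -[LHS]mul1r -iot1 (@diagE x _ a) // rmorph1 mul1r. Qed.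

Lemma diag_inj x : injective (diag x).
Proof.
move=> k l /eqP; rewrite -subr_eq0 -rmorphB => /eqP e; apply/eqP.
rewrite -subr_eq0; apply/eqP; move: (k - l) e => {k l}k e.
have [a [b [b0 eab]]] := K_fraction (sval x) k.
have := diagE eab; rewrite e mulr0 => /esym a0.
have {a0} : a = 0 by apply: contrapT => /(@iot_neq0 x); rewrite a0 eqxx.
move=> a0; rewrite a0 rmorph0 in eab; apply: contrapT => k0.
have nb : gsp (sval x) b <> 0 by rewrite -(rmorph0 (gsp (sval x))) => /gsp_inj.
exact: K_mul_neq0 nb k0 eab.
Qed.

Section Component.
Variables (D : divisor) (x : closed_point X).
Let t := unif x.

(* The stalk of O(D) at x is t ^- n O_x, with n the multiplicity of D at x. *)
Definition psi (c : completion 'm_(sval x) (mstalk (qcdiv D) (sval x))) : Kx x :=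
  iota x (comp_map (theta D x) c) / iot (t ^+ mult D x).

Lemma iot_unif_neq0 n : iot (t ^+ n) != 0.
Proof. by apply: iot_neq0; exact: (uniformizerX_neq0 (unifP x)). Qed.

Lemma psi_is_additive : zmod_morphism psi.
Proof. by move=> c d; rewrite /psi raddfB /= rmorphB mulrBl. Qed.

HB.instance Definition _ := GRing.isZmodMorphism.Build
  (completion 'm_(sval x) (mstalk (qcdiv D) (sval x))) (Kx x) psi psi_is_additive.

Lemma psi_inj : injective psi.
Proof.
move=> c d /(mulIf (invr_neq0 (iot_unif_neq0 _)))/iota_inj.
exact: (bij_inj (comp_map_bij 'm_(sval x) (theta_bij D x))).
Qed.

Lemma psi_surj z : range (iota x) (iot (t ^+ mult D x) * z) ->
  exists c, psi c = z.
Proof.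
move=> [c _ e]; have [g _ gK] := comp_map_bij 'm_(sval x) (theta_bij D x).
by exists (g c); rewrite /psi gK e mulrAC mulfV ?mul1r // iot_unif_neq0.
Qed.

Lemma psi_integral c : mult D x = 0%N -> range (iota x) (psi c).
Proof.
move=> e; exists (comp_map (theta D x) c) => //.
by rewrite /psi e expr0 iot1 divr1.
Qed.

End Component.

(** With f = a / b and the trivializations [theta] of both stalks, the claim is an identity in O_x
    with denominators cleared, which passes to completions by [comp_map_scale]. *)
Lemma psi_mul D E (f : K) (mu : mhom (qcdiv D) (qcdiv E)) x c :
  (forall U s (h : U eta), dval (mu U s : div_sheaf E U) h = f * dval (s : div_sheaf D U) h) ->
  psi (comp_map (mstalk_map (x := sval x) mu) c) = diag x f * psi (D := D) c.
Proof.
move=> hmu; have [a [b [b0 e]]] := K_fraction (sval x) f.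
pose th : {linear mstalk (qcdiv D) (sval x) -> (lring (sval x))^o} :=
  theta E x \o mstalk_map (x := sval x) mu.
have scale u : (b * unif x ^+ mult D x) * th u = (a * unif x ^+ mult E x) * theta D x u.
  have [U [hx [s ->]]] := stalk_surj u; have he := generic_in hx.
  apply: (@gsp_inj (sval x)); rewrite -[germ hx s]/(mgerm hx s) /th /= mstalk_mapE.
  rewrite !rmorphM (thetaE _ he) (thetaE _ he) hmu -!tauX -e; ring.
have := comp_map_scale c scale => /(congr1 (iota x)).
rewrite /psi (@comp_map_comp _ _ _ _ _ _ _ th) // !rmorphM -!/(iot _) => es.
apply: (mulIf (iot_unif_neq0 x (mult E x))); rewrite mulfVK ?iot_unif_neq0 //.
apply: (mulfI (mulf_neq0 (iot_neq0 b0) (iot_unif_neq0 x (mult D x)))).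
rewrite es -(diagE e).
by have nz := iot_unif_neq0 x (mult D x); field.
Qed.

(** * Components of adeles in the complete fields *)

Lemma bold1_closed (y : X) : bold1 X [tuple y] -> closed [set y].
Proof. by move=> [[z cz] /(congr1 (@tval _ _)) [->]]. Qed.

Lemma ad1_ext (M : qcoh X) (hM : coherent M) (a b : A 0%N (bold1 X) M) :
  (forall x, ad_stalk A hM (bold1_in x) a = ad_stalk A hM (bold1_in x) b) -> a = b.
Proof.
move=> e; have [c [_ uniq]] := ad_stalk_prod A hM
  (fun y (h : bold1 X [tuple y]) => ad_stalk A hM h a).
rewrite -(uniq a) // -(uniq b) // => y h.
have ce := e (exist _ y (bold1_closed h)); rewrite /= in ce.
by rewrite (Prop_irrelevance h (bold1_in (exist _ y (bold1_closed h)))) ce.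
Qed.

Lemma ad1_ex (M : qcoh X) (hM : coherent M)
    (y : forall x : closed_point X, completion 'm_(sval x) (mstalk M (sval x))) :
  exists a : A 0%N (bold1 X) M, forall x, ad_stalk A hM (bold1_in x) a = y x.
Proof.
have [a [ea _]] := ad_stalk_prod A hM
  (fun z (h : bold1 X [tuple z]) => y (exist _ z (bold1_closed h))).
exists a => x; rewrite ea; case: x => z cz /=.
by rewrite (Prop_irrelevance (bold1_closed _) cz).
Qed.

Lemma bold1_chains : bold1 X `<=` chains 0.
Proof. by move=> t [x ->]. Qed.

Lemma qcdiv_coherent D : coherent (qcdiv D).
Proof. exact: div_coherent. Qed.

Definition cmpt D (b : A 0%N (bold1 X) (qcdiv D)) x : Kx x :=
  psi (ad_stalk A (qcdiv_coherent D) (bold1_in x) b).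

Lemma cmptB D (b c : A 0%N (bold1 X) (qcdiv D)) x :
  cmpt (b - c) x = cmpt b x - cmpt c x.
Proof. by rewrite /cmpt raddfB /= raddfB. Qed.

Lemma cmpt_ext D (b c : A 0%N (bold1 X) (qcdiv D)) :
  (forall x, cmpt b x = cmpt c x) -> b = c.
Proof.
move=> e; apply: (@ad1_ext (qcdiv D) (qcdiv_coherent D)) => x.
by apply: psi_inj; exact: e.
Qed.

Lemma cmpt_mul D E (f : K) (mu : mhom (qcdiv D) (qcdiv E)) b x :
  (forall U s (h : U eta), dval (mu U s : div_sheaf E U) h = f * dval (s : div_sheaf D U) h) ->
  cmpt (ad_map A (bold1 X) mu b) x = diag x f * cmpt b x.
Proof.
move=> hmu; rewrite /cmpt (ad_stalk_map (qcdiv_coherent D) (qcdiv_coherent E)).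
exact: psi_mul.
Qed.

Lemma cmpt_trans D E (h : div_le D E) b x :
  cmpt (ad_map A (bold1 X) (div_trans h) b) x = cmpt b x.
Proof.
rewrite (@cmpt_mul _ _ 1) ?rmorph1 ?mul1r // => U s he.
by rewrite mul1r.
Qed.

Lemma adK_rep (c : A 0%N (bold1 X) (constK eta)) :
  exists D b, ad_map A (bold1 X) (div_incl D) b = c.
Proof.
have [sur _] := ad_lim A bold1_chains constK_limit; exact: sur.
Qed.

(** By [ad_lim] the difference dies at some larger divisor, and enlarging the divisor does not
    change components. *)
Lemma adK_incl D E b b' :
  ad_map A (bold1 X) (div_incl D) b = ad_map A (bold1 X) (div_incl E) b' ->
  forall x, cmpt b x = cmpt b' x.
Proof.
move=> e x; have [F [DF EF]] := div_directed D E.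
pose w := ad_map A (bold1 X) (div_trans DF) b - ad_map A (bold1 X) (div_trans EF) b'.
have w0 : ad_map A (bold1 X) (div_incl F) w = 0.
  rewrite /w raddfB /= -!ad_map_comp.
  rewrite (_ : mhom_comp _ _ = div_incl D); last exact: mhomP.
  by rewrite (_ : mhom_comp _ (div_trans EF) = div_incl E) ?e ?subrr //; exact: mhomP.
have [_ inj] := ad_lim A bold1_chains constK_limit.
have [G [FG eG]] := inj F w w0.
have : cmpt w x = 0.
  rewrite -(cmpt_trans FG) [ad_map _ _ _ _]eG /cmpt.
  exact: etrans (congr1 _ (raddf0 _)) (raddf0 _).
by rewrite cmptB !cmpt_trans => /eqP; rewrite subr_eq0 => /eqP.
Qed.

Lemma Phi_ex (c : A 0%N (bold1 X) (constK eta)) : exists z : forall x, Kx x,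
  forall D b, ad_map A (bold1 X) (div_incl D) b = c -> forall x, cmpt b x = z x.
Proof.
have [D [b <-]] := adK_rep c; exists (cmpt b) => E b'; exact: adK_incl.
Qed.

Definition Phi c : forall x, Kx x := sval (cid (Phi_ex c)).

Lemma PhiE D b x : Phi (ad_map A (bold1 X) (div_incl D) b) x = cmpt b x.
Proof.
apply/esym; exact: (svalP (cid (Phi_ex (ad_map A (bold1 X) (div_incl D) b))) D b erefl).
Qed.

Lemma adK_rep2 (c d : A 0%N (bold1 X) (constK eta)) :
  exists D b b', ad_map A (bold1 X) (div_incl D) b = c /\
    ad_map A (bold1 X) (div_incl D) b' = d.
Proof.
have [D [b <-]] := adK_rep c; have [E [b' <-]] := adK_rep d.
have [F [DF EF]] := div_directed D E.
exists F, (ad_map A (bold1 X) (div_trans DF) b), (ad_map A (bold1 X) (div_trans EF) b').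
by split; rewrite -ad_map_comp; congr (ad_map _ _ _ _); exact: mhomP.
Qed.

Lemma PhiB c d x : Phi (c - d) x = Phi c x - Phi d x.
Proof.
have [D [b [b' [<- <-]]]] := adK_rep2 c d.
by rewrite -raddfB !PhiE cmptB.
Qed.

Lemma Phi_inj c d : (forall x, Phi c x = Phi d x) -> c = d.
Proof.
have [D [b [b' [<- <-]]]] := adK_rep2 c d => e; congr (ad_map _ _ _ _).
by apply: cmpt_ext => x; rewrite -!PhiE.
Qed.

Lemma Phi_finite c : finite_set [set x | ~ range (iota x) (Phi c x)].
Proof.
have [D [b <-]] := adK_rep c; apply: (sub_finite_set _ (svalP D)) => x /= nx e.
by apply: nx; rewrite PhiE; exact: psi_integral.
Qed.

(** A denominator is a unit times a power of the uniformizer, by [rcomp_factor]. *)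
Lemma Kx_pole x (z : Kx x) : exists n, range (iota x) (iot (unif x ^+ n) * z).
Proof.
have [_ /(_ z)[a [b [b0 ->]]]] := iota_frac x.
have nb : b <> 0 by move=> e; rewrite e rmorph0 eqxx in b0.
have [n [u [[v uv] eb]]] := rcomp_factor (unifP x) nb.
exists n; exists (v * a) => //.
rewrite eb -rmorphXn !rmorphM -/(iot _).
have u0 : iota x u * iota x v = 1 by rewrite -rmorphM uv rmorph1.
have un : iota x u != 0.
  by apply/eqP => e; move: u0; rewrite e mul0r => /eqP; rewrite eq_sym oner_eq0.
have tn := iot_unif_neq0 x n.
have -> : iota x v = (iota x u)^-1 by rewrite -[LHS](mulKf un) u0 mulr1.
by rewrite invfM mulrCA [_^-1 * _^-1]mulrC mulVKf // mulrC.
Qed.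

Lemma Phi_surj (f : forall x, Kx x) :
  finite_set [set x | ~ range (iota x) (f x)] -> exists c, forall x, Phi c x = f x.
Proof.
(* Pole orders of [f], forced to be 0 where [f] is integral so that they form a divisor. *)
move=> fin; have /choice[n hn] x : exists n,
    range (iota x) (iot (unif x ^+ n) * f x) /\ (range (iota x) (f x) -> n = 0%N).
  have [r|nr] := pselect (range (iota x) (f x)).
    by exists 0%N; rewrite expr0 iot1 mul1r.
  by have [n hn] := Kx_pole (f x); exists n.
have finn : finite_set [set x | n x <> 0%N].
  by apply: (sub_finite_set _ fin) => x nx r; apply: nx; case: (hn x) => _; apply.
pose D := mk_divisor finn.
have ex x : exists c : completion 'm_(sval x) (mstalk (qcdiv D) (sval x)), psi c = f x.
  by apply: psi_surj; case: (hn x).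
have [b eb] := @ad1_ex (qcdiv D) (qcdiv_coherent D) (fun x => sval (cid (ex x))).
exists (ad_map A (bold1 X) (div_incl D) b) => x.
by rewrite PhiE /cmpt eb; exact: (svalP (cid (ex x))).
Qed.

Lemma constK_mulE (f : K) U (s : constK eta U) (h : U eta) :
  ofQ (constK_mul f U s h) = f * ofQ (s h).
Proof. exact: ofQZ. Qed.

(** Multiplication by [f] need not preserve O(D); it maps O(D) to O(E + D), where E bounds the poles
    of [f], and components are compared there. *)
Lemma Phi_mul (f : K) c x : Phi (ad_map A (bold1 X) (constK_mul f) c) x = diag x f * Phi c x.
Proof.
have [D [b <-]] := adK_rep c; have [E hE] := pole_divisor f.
have bound U (s : qcdiv D U) (h : U eta) :
    pole_bound (divD E D) U (ofQ (mhom_comp (constK_mul f) (div_incl D) U s h)).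
  rewrite [X in pole_bound _ _ X]constK_mulE; apply: pole_boundM => [y _|]; first exact: hE.
  exact: dval_bound.
rewrite -ad_map_comp -(div_liftK bound) ad_map_comp !PhiE.
by apply: cmpt_mul => U s h; rewrite (dval_lift bound) [LHS]constK_mulE.
Qed.

(** * From A(01, O_X) to A(1, K) *)

Lemma nonunits_eta (a : K) : nonunits a -> a = 0.
Proof. by move=> na; apply: contrapT => /K_unit. Qed.

Lemma delta_pow r s (u : mstalk (OX X) eta) :
  ideal_pow 'm_eta (mstalk (OX X) eta) r.+1 u ->
  ideal_pow 'm_eta (mstalk (OX X) eta) s (idfun u).
Proof. by move=> /(ideal_pow0 nonunits_eta) ->; exact: submod0. Qed.

(* As 'm_eta = 0, the inverse system j_{r eta} O_X is constant for r > 0. *)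
Definition delta r s : mhom (qcj eta r.+1 (qcOX X)) (qcj eta s (qcOX X)) :=
  @jmap_of X eta s r.+1 (OX X) (OX X) (qmod_map (f := idfun) (@delta_pow r s)).

Lemma deltaE r s U (m : qcj eta r.+1 (qcOX X) U) (h : U eta) u :
  m h = qpi _ u -> delta r s U m h = qpi _ u.
Proof.
move=> e; rewrite -[LHS]/(qmod_map (f := idfun) (@delta_pow r s) (m h)) e.
exact: qmod_mapE.
Qed.

Lemma jtransE r U (m : qcj eta r.+1 (qcOX X) U) (h : U eta) u :
  m h = qpi _ u -> jtrans eta r (qcOX X) U m h = qpi _ u.
Proof.
move=> e; rewrite -[LHS]/(adic_trans _ _ r (m h)) e; exact: qmod_mapE.
Qed.

Lemma delta_trans r s :
  mhom_comp (jtrans eta s (qcOX X)) (delta r s.+1) = delta r s.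
Proof.
apply: mhomP => U m; apply/funext => h; have [u e] := qpi_surj (m h).
by apply: etrans (jtransE _) (esym (deltaE s e)); exact: deltaE.
Qed.

Lemma delta_comp r s t : mhom_comp (delta s t) (delta r s.+1) = delta r t.
Proof.
apply: mhomP => U m; apply/funext => h; have [u e] := qpi_surj (m h).
by apply: etrans (deltaE t _) (esym (deltaE t e)); exact: deltaE.
Qed.

Lemma delta_id r : delta r r.+1 = mhom_id (qcj eta r.+1 (qcOX X)).
Proof.
apply: mhomP => U m; apply/funext => h; have [u e] := qpi_surj (m h).
by apply: etrans (deltaE r.+1 e) _; rewrite /= e.
Qed.

Lemma delta_jtrans r : delta r.+1 r.+1 = jtrans eta r.+1 (qcOX X).
Proof.
apply: mhomP => U m; apply/funext => h; have [u e] := qpi_surj (m h).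
by apply: etrans (deltaE r.+1 e) (esym (jtransE e)).
Qed.

Lemma slice_bold01_neq (x : X) : x <> eta -> slice x (bold01 eta) = set0.
Proof.
move=> xe; apply/seteqP; split=> // t [_ [z e]].
by case: (congr1 (@tval _ _) e) => ex; case: xe.
Qed.

Lemma ad_set0 m (T : set (m.+1.-tuple X)) (M : qcoh X) (a b : A m T M) :
  T = set0 -> a = b.
Proof. by move=> T0; move: a b; rewrite T0 => a b; rewrite (ad_empty a) (ad_empty b). Qed.

Lemma ad_cast_bij m (T T' : set (m.+1.-tuple X)) (e : T = T') (M : qcoh X) :
  bijective (ad_cast A e M).
Proof. by case: T' / e; exists id. Qed.

Let hT := bold01_chains eta_gen.
Let hO := @qcOX_coherent X.

(** Slices at points other than [eta] are empty and contribute 0. At [eta] the transitions between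
    positive levels are inverted by [delta], so level 1 determines the higher levels, and level 0 is
    its image. *)
Lemma ad_slice_ext (a b : A 1%N (bold01 eta) (qcOX X)) :
  ad_slice A hT hO eta 1 a = ad_slice A hT hO eta 1 b -> a = b.
Proof.
move=> e; have [c [_ uniq]] := ad_slice_prod hT hO
  (fun x r => ad_slice_compat hT hO x r a).
rewrite -(uniq a) // -(uniq b) // => x r.
have [->|xe] := pselect (x = eta); last exact/ad_set0/slice_bold01_neq.
have eS : forall r, ad_slice A hT hO eta r.+1 b = ad_slice A hT hO eta r.+1 a.
  elim=> [//|k IH].
  have inj : injective (ad_map A (slice eta (bold01 eta)) (delta k.+1 k.+1)).
    apply: (@can_inj _ _ _ (ad_map A (slice eta (bold01 eta)) (delta k k.+2))) => y.
    by rewrite -ad_map_comp delta_comp delta_id ad_map_id.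
  by apply: inj; rewrite delta_jtrans !ad_slice_compat.
case: r => [|r]; last exact: eS.
by rewrite -!(ad_slice_compat hT hO eta 0) eS.
Qed.

Lemma ad_slice_surj y : exists a, ad_slice A hT hO eta 1 a = y.
Proof.
(* Each family is packed with its compatibility proof, so that [dfwith] can replace the zero family
   at [eta] and keep the proof. *)
pose P (x : X) := {z : forall r, A 0%N (slice x (bold01 eta)) (qcj x r (qcOX X)) |
  forall r, ad_map A (M := qcj x r.+1 (qcOX X)) (N := qcj x r (qcOX X))
    (slice x (bold01 eta)) (jtrans x r (qcOX X)) (z r.+1) = z r}.
have z0 x : P x by exists (fun _ => 0) => r; rewrite raddf0.
pose zf r := ad_map A (slice eta (bold01 eta)) (delta 0 r) y.
have zfP r : ad_map A (M := qcj eta r.+1 (qcOX X)) (N := qcj eta r (qcOX X))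
    (slice eta (bold01 eta)) (jtrans eta r (qcOX X)) (zf r.+1) = zf r.
  by rewrite /zf -ad_map_comp delta_trans.
pose zeta : P eta := exist _ zf zfP.
pose z := dfwith z0 zeta.
have [a [ea _]] := ad_slice_prod hT hO (fun x r => svalP (z x) r).
exists a; rewrite ea /z dfwith_in /=.
by rewrite /zf delta_id ad_map_id.
Qed.

Lemma ad01_to_ad1_bij : bijective (ad01_to_ad1 (A := A) eta_gen).
Proof.
have [g gK Kg] := ad_cast_bij (slice_bold01 eta) (constK eta).
apply: inj_surj_bij => [a b /(can_inj gK)|c]; first exact: ad_slice_ext.
have [a ea] := ad_slice_surj (g c); exists a.
by rewrite /ad01_to_ad1 ea Kg.
Qed.

Lemma ad01_to_ad1_additive : zmod_morphism (ad01_to_ad1 (A := A) eta_gen).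
Proof. by move=> a b; rewrite /ad01_to_ad1 !raddfB. Qed.

(** * The boundary maps *)

Lemma ofQ_OX U (s : OX X U) (h : U eta) : ofQ (OX_to_constK eta U s h) = rgerm h s.
Proof. by rewrite -[RHS]toQK /toQ lring_OXE. Qed.

Lemma OX_bound U (s : OX X U) (h : U eta) :
  pole_bound div0 U (ofQ (OX_to_constK eta U s h)).
Proof. by move=> x Ux; rewrite ofQ_OX expr0 mul1r; exact: reg_sect. Qed.

(** O_X -> K factors through O(0), where [theta] is the identity of O_x up to the identification
    with the stalk of O_X. *)
Lemma Phi_OX (a : A 0%N (bold1 X) (qcOX X)) x (p : hatO (sval x)) :
  ad_stalk A hO (bold1_in x) a = comp_map (@lring_OX X (sval x)) p ->
  Phi (ad_map A (bold1 X) (OX_to_constK eta) a) x = iota x p.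
Proof.
move=> ea; pose lift : mhom (qcOX X) (qcdiv div0) := div_lift OX_bound.
have -> : OX_to_constK eta = mhom_comp (div_incl div0) lift by exact: mhomP.
rewrite ad_map_comp PhiE /cmpt (ad_stalk_map hO (qcdiv_coherent div0)) ea.
rewrite /psi expr0 iot1 divr1; congr (iota x _).
pose l : {linear (lring (sval x))^o -> mstalk (qcdiv div0) (sval x)} :=
  mstalk_map (x := sval x) lift \o @lring_OX X (sval x).
pose th : {linear (lring (sval x))^o -> (lring (sval x))^o} := theta div0 x \o l.
rewrite (@comp_map_comp _ _ _ _ _ _ _ l) // (@comp_map_comp _ _ _ _ _ _ _ th) //.
apply: comp_map_id => u; have [U [hx [s ->]]] := stalk_surj u.
have he := generic_in hx; apply: (@gsp_inj (sval x)).
rewrite -[germ hx s]/(rgerm hx s) /th /= lring_OXE mstalk_mapE (thetaE _ he).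
by rewrite expr0 mul1r (dval_lift OX_bound) ofQ_OX (gspE hx he).
Qed.

Definition germ1 (x : X) : mstalk (qcOX X) x :=
  mgerm (M := OX X) (U := opensT X) (Logic.I : opensT X x) (1 : 'O_X (opensT X)).

(** The element 1, given by its components since the adele groups come without a product. *)
Definition ad_one : A 0%N (bold1 X) (qcOX X) :=
  sval (cid (ad1_ex hO (fun x => to_comp 'm_(sval x) (germ1 (sval x))))).

Lemma ad_oneE x : ad_stalk A hO (bold1_in x) ad_one = to_comp 'm_(sval x) (germ1 (sval x)).
Proof.
exact: (svalP (cid (ad1_ex hO (fun x => to_comp 'm_(sval x) (germ1 (sval x)))))).
Qed.

Definition OX_mul (f : K) : mhom (qcOX X) (constK eta) :=
  mhom_comp (constK_mul f) (OX_to_constK eta).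

Lemma ofQ_OX_mul (f : K) U (s : OX X U) (h : U eta) :
  ofQ (OX_mul f U s h) = f * rgerm h s.
Proof. by rewrite [LHS]constK_mulE ofQ_OX. Qed.

(** The diagonal image of [f], as f times 1, with no subsheaf to choose. *)
Definition ad_diag (f : K) : A 0%N (bold1 X) (constK eta) :=
  ad_map A (bold1 X) (OX_mul f) ad_one.

Lemma Phi_diag f x : Phi (ad_diag f) x = diag x f.
Proof.
rewrite /ad_diag /OX_mul ad_map_comp Phi_mul (@Phi_OX _ _ 1) ?rmorph1 ?mulr1 //.
rewrite ad_oneE -(rmorph1 (to_rcomp _)) [RHS]comp_map_to_comp; congr to_comp.
have h : opensT X (sval x) by [].
have -> : (1 : lring (sval x)) = rgerm h 1 by rewrite rmorph1.
apply: etrans (esym (lring_OXE h 1)); by rewrite /germ1 (Prop_irrelevance h Logic.I).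
Qed.

(* A section of a coherent N in K is the image of 1 under O_X -> N, and the
   composite O_X -> N -> K only depends on the section. *)
Lemma constK_diagP (f : K) c : constK_diag (A := A) f c <-> c = ad_diag f.
Proof.
split=> [[N [hN [i [s [b [_ si bs ->]]]]]]|->].
  pose sg : mhom (qcOX X) N := section_map s.
  have -> : b = ad_map A (bold1 X) sg ad_one.
    apply: (@ad1_ext N hN) => x. rewrite bs (ad_stalk_map hO hN) ad_oneE comp_map_to_comp.
    congr to_comp; have h : opensT X (sval x) by [].
    rewrite (Prop_irrelevance Logic.I h); apply: etrans (esym (mstalk_mapE sg _ _)).
    by rewrite [sg _ _]section_mapE scale1r pm_res_id (Prop_irrelevance h Logic.I).
  rewrite -ad_map_comp /ad_diag; congr (ad_map _ _ _ _).
  apply: mhomP => U a; apply/funext => h; apply: ofQ_inj; rewrite ofQ_OX_mul.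
  rewrite -[mhom_comp _ _ _ _]/(i U (section_map s U a)) section_mapE linearZ mh_res si.
  by rewrite [LHS]ofQZ mulrC; congr (_ * _); exact: toQK.
(* Multiplication by 0 is not a monomorphism, so for f = 0 the witness is the zero section of O_X
   inside K. *)
have [f0|f0] := pselect (f = 0).
  exists (qcOX X), hO, (OX_to_constK eta), 0, 0; split.
  - move=> U s t e; apply: sect_ext => h; rewrite -!ofQ_OX.
    by move: (congr1 (fun m : constK eta U => m h) e) => ->.
  - rewrite linear0; apply/funext => h; apply: ofQ_inj; rewrite f0.
    by apply: etrans ofQ0 (esym (toQK 0)).
  - move=> x h; rewrite raddf0 (_ : mgerm _ _ = 0) ?raddf0 //; exact: (raddf0 (germ _)).
  - rewrite raddf0; apply: Phi_inj => x; rewrite Phi_diag f0 rmorph0.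
    by have := PhiB 0 0 x; rewrite !subrr.
have mulf_inj := K_mulI f0.
exists (qcOX X), hO, (OX_mul f), (1 : 'O_X (opensT X)), ad_one; split=> //.
- move=> U s t e; apply: sect_ext => h; apply: mulf_inj; rewrite -!ofQ_OX_mul.
  by move: (congr1 (fun m : constK eta U => m h) e) => ->.
- apply/funext => h; apply: ofQ_inj; rewrite ofQ_OX_mul rmorph1 mulr1.
  exact/esym/toQK.
- move=> x h; pose z : closed_point X := exist _ x (bold1_closed h).
  rewrite (Prop_irrelevance h (bold1_in z)); exact: (ad_oneE z).
Qed.

(** The set is one point and the maximal ideal at [eta] is 0, so the completed stalk is K itself. *)
Lemma phi0_ex : exists phi0 : {additive A 0%N (bold0 eta) (qcOX X) -> K},
  bijective phi0 /\ forall a, ad_stalk A hO (bold0_in eta) a =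
    to_comp _ (lring_OX (phi0 a)).
Proof.
have st_bij : bijective (ad_stalk A hO (bold0_in eta)).
  have only_eta y (h : bold0 eta [tuple y]) : eta = y.
    by case: (congr1 (@tval _ _) h).
  have uniq a b : ad_stalk A hO (bold0_in eta) a = ad_stalk A hO (bold0_in eta) b -> a = b.
    move=> e; have [c [_ un]] := ad_stalk_prod A hO
      (fun y (h : bold0 eta [tuple y]) => ad_stalk A hO h a).
    rewrite -(un a) // -(un b) // => y h; move: (h); rewrite -(only_eta y h) => h'.
    by rewrite (Prop_irrelevance h' (bold0_in eta)) e.
  apply: inj_surj_bij => [|c]; first exact: uniq.
  have [a [ea _]] := ad_stalk_prod A hO (fun y (h : bold0 eta [tuple y]) =>
    eq_rect eta (fun y => completion 'm_y (mstalk (qcOX X) y)) c y (only_eta y h)).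
  by exists a; rewrite ea (Prop_irrelevance (only_eta _ _) erefl).
have tc_bij := bij_comp (to_comp_bij (mstalk (OX X) eta) nonunits_eta) (@lring_OX_bij X eta).
pose tc : {additive K -> completion 'm_eta (mstalk (qcOX X) eta)} :=
  to_comp 'm_eta (M := mstalk (OX X) eta) \o @lring_OX X eta.
have [g [tcK gK]] := bij_additive (tc_bij : bijective tc).
pose phi0 : {additive A 0%N (bold0 eta) (qcOX X) -> K} := g \o ad_stalk A hO (bold0_in eta).
exists phi0; split; last by move=> a; exact/esym/(gK (ad_stalk A hO (bold0_in eta) a)).
by apply: bij_comp st_bij; exists tc.
Qed.

Lemma phi1_ex x : exists phi1 : {additive A 0%N (bold1 X) (qcOX X) -> hatO (sval x)},
  forall a, ad_stalk A hO (bold1_in x) a = comp_map (@lring_OX X (sval x)) (phi1 a).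
Proof.
have [g [_ gK]] := bij_additive (comp_map_bij 'm_(sval x) (@lring_OX_bij X (sval x))).
pose phi1 : {additive A 0%N (bold1 X) (qcOX X) -> hatO (sval x)} :=
  g \o ad_stalk A hO (bold1_in x).
by exists phi1 => a; exact/esym/gK.
Qed.

(** * Assembly of the identifications *)

Lemma adeles_of_curve :
  exists (dg : forall x, {rmorphism function_field eta -> Kx x})
    (phi0 : {additive A 0%N (bold0 eta) (qcOX X) -> function_field eta})
    (phi1 : forall x : closed_point X,
      {additive A 0%N (bold1 X) (qcOX X) -> hatO (sval x)})
    (phi01 : forall x : closed_point X,
      {additive A 1%N (bold01 eta) (qcOX X) -> Kx x})
    (d0 : {additive A 0%N (bold0 eta) (qcOX X) -> A 1%N (bold01 eta) (qcOX X)})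
    (d1 : {additive A 0%N (bold1 X) (qcOX X) -> A 1%N (bold01 eta) (qcOX X)}),
    (forall (x : closed_point X) (U : opens X) (hx : U (sval x)) (heta : U eta)
        (f : rs_sheaf X U),
      dg x (rgerm heta f) = iota x (to_rcomp _ (rgerm hx f))) /\
    (forall x, injective (dg x)) /\
    (bijective phi0 /\
     forall a, ad_stalk A (qcOX_coherent (X := X)) (bold0_in eta) a =
       to_comp _ (lring_OX (phi0 a))) /\
    ((forall y : forall x : closed_point X, hatO (sval x),
        exists! a, forall x, phi1 x a = y x) /\
     forall a x, ad_stalk A (qcOX_coherent (X := X)) (bold1_in x) a =
       comp_map (@lring_OX X (sval x)) (phi1 x a)) /\
    ((forall a, finite_set [set x | ~ range (iota x) (phi01 x a)]) /\
     (forall f : forall x, Kx x, finite_set [set x | ~ range (iota x) (f x)] ->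
        exists! a, forall x, phi01 x a = f x) /\
     (forall (f : function_field eta) a b,
        ad01_to_ad1 (A := A) eta_gen b =
          ad_map A (bold1 X) (constK_mul f) (ad01_to_ad1 (A := A) eta_gen a) ->
        forall x, phi01 x b = dg x f * phi01 x a)) /\
    bijective (ad01_to_ad1 (A := A) eta_gen) /\
    is_partial0 eta_gen phi0 d0 /\ is_partial1 eta_gen d1 /\
    (forall a x, phi01 x (d0 a) = dg x (phi0 a)) /\
    (forall a x, phi01 x (d1 a) = iota x (phi1 x a)).
Proof.
have [phi0 [phi0_bij phi0E]] := phi0_ex.
pose phi1 x := sval (cid (phi1_ex x)).
have phi1E x a : ad_stalk A hO (bold1_in x) a =
    comp_map (@lring_OX X (sval x)) (phi1 x a) := svalP (cid (phi1_ex x)) a.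
have [w we] := ex_additive ad01_to_ad1_additive.
have w_bij : bijective w by apply: eq_bij ad01_to_ad1_bij _ _ => a.
have [v [wK vK]] := bij_additive w_bij.
have ex01 x : exists p : {additive A 1%N (bold01 eta) (qcOX X) -> Kx x},
    forall a, p a = Phi (ad01_to_ad1 (A := A) eta_gen a) x.
  have [|p hp] := @ex_additive _ _
    (fun a => Phi (ad01_to_ad1 (A := A) eta_gen a) x); last by exists p.
  by move=> a b; rewrite ad01_to_ad1_additive PhiB.
pose phi01 x := sval (cid (ex01 x)).
have phi01E x a : phi01 x a = Phi (ad01_to_ad1 (A := A) eta_gen a) x :=
  svalP (cid (ex01 x)) a.
(* [ad_diag] is not additive in [f] by construction, so additivity is tested on the components
   [Phi]. *)
have [|d0 d0E] := @ex_additive _ _ (fun a => v (ad_diag (phi0 a))).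
  move=> a b; apply: (bij_inj w_bij); rewrite [in RHS]raddfB /= !vK.
  by apply: Phi_inj => x; rewrite PhiB !Phi_diag (raddfB phi0) rmorphB.
pose d1 : {additive A 0%N (bold1 X) (qcOX X) -> A 1%N (bold01 eta) (qcOX X)} :=
  v \o ad_map A (bold1 X) (OX_to_constK eta).
have d1E a : ad01_to_ad1 (A := A) eta_gen (d1 a) =
    ad_map A (bold1 X) (OX_to_constK eta) a by rewrite -we /d1 /= vK.
exists diag, phi0, phi1, phi01, d0, d1.
split; first by move=> x U hx he f; rewrite -(gspE hx he) diag_gsp.
split; first exact: diag_inj.
split; first by [].
split.
  split=> // y.
  have [a ea] := ad1_ex hO (fun x => comp_map (@lring_OX X (sval x)) (y x)).
  have linj x := bij_inj (comp_map_bij 'm_(sval x) (@lring_OX_bij X (sval x))).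
  exists a; split=> [x|b hb]; first by apply: linj; rewrite -phi1E ea.
  by apply: (@ad1_ext (qcOX X) hO) => x; rewrite ea phi1E hb.
split.
  split; last split.
  - move=> a; apply: (sub_finite_set _ (Phi_finite (ad01_to_ad1 (A := A) eta_gen a))).
    by move=> x; rewrite /= phi01E.
  - move=> f /Phi_surj[c hc]; exists (v c); split=> [x|b hb].
      by rewrite phi01E -we vK hc.
    by apply: (bij_inj w_bij); rewrite vK; apply: Phi_inj => x; rewrite hc -hb phi01E we.
  - by move=> f a b e x; rewrite !phi01E e Phi_mul.
split; first exact: ad01_to_ad1_bij.
split; first by move=> a c; rewrite constK_diagP d0E -we vK.
split; first exact: d1E.
split=> a x; first by rewrite phi01E d0E -we vK Phi_diag.
by rewrite phi01E d1E; exact: Phi_OX.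
Qed.

End Adeles.

End Curve.

Theorem proposition8p16 (X : scheme)
    (X_noetherian : noetherian_scheme X) (X_regular : regular_scheme X)
    (X_irreducible : irreducible_space X) (X_dim1 : has_dimension X 1)
    (eta : X) (eta_gen : generic_point eta) (A : adele_functor X) :
  (forall x : closed_point X, complete_dvr (hatO (sval x))) /\
  forall (Kx : closed_point X -> fieldType)
    (iota : forall x : closed_point X, {rmorphism hatO (sval x) -> Kx x}),
    (forall x, is_fraction_field (iota x)) ->
  exists (diag : forall x, {rmorphism function_field eta -> Kx x})
    (phi0 : {additive A 0%N (bold0 eta) (qcOX X) -> function_field eta})
    (phi1 : forall x : closed_point X,
      {additive A 0%N (bold1 X) (qcOX X) -> hatO (sval x)})
    (phi01 : forall x : closed_point X,
      {additive A 1%N (bold01 eta) (qcOX X) -> Kx x})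
    (d0 : {additive A 0%N (bold0 eta) (qcOX X) -> A 1%N (bold01 eta) (qcOX X)})
    (d1 : {additive A 0%N (bold1 X) (qcOX X) -> A 1%N (bold01 eta) (qcOX X)}),
    (* K(X) -> K(X)_x is the embedding compatible with the germs at eta and x *)
    (forall (x : closed_point X) (U : opens X) (hx : U (sval x)) (heta : U eta)
        (f : rs_sheaf X U),
      diag x (rgerm heta f) = iota x (to_rcomp _ (rgerm hx f))) /\
    (forall x, injective (diag x)) /\
    (* A(0, O_X) = K(X) *)
    (bijective phi0 /\
     forall a, ad_stalk A (qcOX_coherent (X := X)) (bold0_in eta) a =
       to_comp _ (lring_OX (phi0 a))) /\
    (* A(1, O_X) is the product of the completed local rings *)
    ((forall y : forall x : closed_point X, hatO (sval x),
        exists! a, forall x, phi1 x a = y x) /\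
     forall a x, ad_stalk A (qcOX_coherent (X := X)) (bold1_in x) a =
       comp_map (@lring_OX X (sval x)) (phi1 x a)) /\
    (* A(01, O_X) is the restricted product, K(X)-linearly *)
    ((forall a, finite_set [set x | ~ range (iota x) (phi01 x a)]) /\
     (forall f : forall x, Kx x, finite_set [set x | ~ range (iota x) (f x)] ->
        exists! a, forall x, phi01 x a = f x) /\
     (forall (f : function_field eta) a b,
        ad01_to_ad1 (A := A) eta_gen b =
          ad_map A (bold1 X) (constK_mul f) (ad01_to_ad1 (A := A) eta_gen a) ->
        forall x, phi01 x b = diag x f * phi01 x a)) /\
    (* the boundary maps *)
    bijective (ad01_to_ad1 (A := A) eta_gen) /\
    is_partial0 eta_gen phi0 d0 /\ is_partial1 eta_gen d1 /\
    (forall a x, phi01 x (d0 a) = diag x (phi0 a)) /\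
    (forall a x, phi01 x (d1 a) = iota x (phi1 x a)).
Proof.
split=> [x|Kx iota frac]; last exact: adeles_of_curve.
have [[t ht] _] := lring_uniformizer X_regular X_dim1 eta_gen
  (closed_neq_eta X_dim1 eta_gen (svalP x)).
exact: complete_dvr_completion ht.
Qed.
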